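(* Let $f \in W^{1,1}(\mathbb{R}^n) \cap W^{1,\infty}(\mathbb{R}^n)$ be nonzero. Assume that one of the following conditions is fulfilled: (a) $K\subset\mathbb{R}^n$ is a star body and $q>n$; (b) $K\subset\mathbb{R}^n$ is a bounded star body and $q\in(-\infty,n)\setminus\{0\}$. Then the following limits hold (each for the sign $+$ throughout and for the sign $-$ throughout): (i) for any fixed $s\in(0,1)$, $\lim_{p\to\infty}|\Pi^{\ast,s}_{p,\pm}f|=|\Pi^{\ast,s}_{\infty,\pm}f|$ and $\lim_{p\to\infty}\widetilde{\mathrm V}_q(K,\Pi^{\ast,s}_{p,\pm}f)=\widetilde{\mathrm V}_q(K,\Pi^{\ast,s}_{\infty,\pm}f)$; (ii) $\lim_{p\to\infty}|\Pi^{\ast}_{p,\pm}f|=|\Pi^{\ast}_{\infty,\pm}f|$ and $\lim_{p\to\infty}\widetilde{\mathrm V}_q(K,\Pi^{\ast}_{p,\pm}f)=\widetilde{\mathrm V}_q(K,\Pi^{\ast}_{\infty,\pm}f)$; (iii) $\lim_{s\to1^-}|\Pi^{\ast,s}_{\infty,\pm}f|=|\Pi^{\ast}_{\infty,\pm}f|$ and $\lim_{s\to1^-}\widetilde{\mathrm V}_q(K,\Pi^{\ast,s}_{\infty,\pm}f)=\widetilde{\mathrm V}_q(K,\Pi^{\ast}_{\infty,\pm}f)$.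
   Context: Functions are real valued; $a_+=\max\{a,0\}$, $a_-=\max\{-a,0\}$ for $a\in\mathbb{R}$. $W^{1,p}(\mathbb{R}^n)=\{f\in L^p: |\nabla f|\in L^p\}$, $p\in[1,\infty]$; elements of $W^{1,\infty}(\mathbb{R}^n)$ are identified with their Lipschitz representatives. For a set $K\subset\mathbb{R}^n$ star-shaped with respect to the origin, the gauge function is $\|x\|_K=\inf\{\lambda>0: x\in\lambda K\}\in[0,\infty]$, the radial function is $\rho_K(x)=\sup\{\lambda>0:\lambda x\in K\}=\|x\|_K^{-1}\in[0,\infty]$, $x\neq0$, and the volume is $|K|=\frac1n\int_{\mathbb{S}^{n-1}}\|\xi\|_K^{-n}\,d\xi$. $K$ is a star body if $\rho_K$ is strictly positive and continuous on $\mathbb{R}^n\setminus\{0\}$. For $q\in\mathbb{R}\setminus\{0,n\}$ the dual mixed volume is $\widetilde{\mathrm V}_q(K,L)=\frac1n\int_{\mathbb{S}^{n-1}}\|\xi\|_K^{-n+q}\|\xi\|_L^{-q}\,d\xi$. The following asymmetric sets, star-shaped with respect to the origin, are defined through their gauge functions (a set with prescribed gauge $\|\cdot\|$ being $\{\xi:\|\xi\|\le 1\}$), for $\xi\in\mathbb{R}^n$, $s\in(0,1)$, $p\in[1,\infty)$: - $\Pi^{\ast,s}_{p,\pm} f$: $\|\xi\|_{\Pi^{\ast,s}_{p,\pm} f}^{ps}=p(1-s)\int_0^\infty t^{-ps-1}\int_{\mathbb{R}^n}(f(x+t\xi)-f(x))_\pm^p\,dx\,dt$; - $\Pi^{\ast}_{p,\pm}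 f$: $\|\xi\|_{\Pi^\ast_{p,\pm} f}^p=\int_{\mathbb{R}^n}\langle\nabla f(x),\xi\rangle_\pm^p\,dx$; - $\Pi^{\ast,s}_{\infty,\pm} f$: $\|\xi\|_{\Pi^{\ast,s}_{\infty,\pm} f}^{s}=\sup_{(x,t)\in\mathbb{R}^n\times(0,\infty)}t^{-s}(f(x+t\xi)-f(x))_\pm$; - $\Pi^{\ast}_{\infty,\pm} f$: $\|\xi\|_{\Pi^\ast_{\infty,\pm} f}=\operatorname{ess\,sup}_{x\in\mathbb{R}^n}\langle\nabla f(x),\xi\rangle_\pm$. *)

(* Defs.v *)
From HB Require Import structures.
From mathcomp Require Import all_boot all_order all_algebra.
From mathcomp Require Import all_classical all_reals all_analysis.
From mathcomp Require Import measurable_realfun ess_sup_inf.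
Set Implicit Arguments.
Unset Strict Implicit.
Unset Printing Implicit Defensive.
Import Order.TTheory GRing.Theory Num.Theory.
Import numFieldNormedType.Exports.
Local Open Scope classical_set_scope.
Local Open Scope ring_scope.

(* Measurable structure of R^n: the product sigma-algebra of the Borel        *)
(* sigma-algebra of R, generated by the coordinate maps.                      *)
Definition rV_display : measure_display. Proof. exact: default_measure_display. Qed.

Section measurable_rV.
Context {R : realType} (n : nat).

Let coors : 'I_n -> 'rV[R]_n -> R := fun i x => x 0 i.

Let rV_set0 : g_sigma_preimage coors set0.
Proof. exact: sigma_algebra0. Qed.

Let rV_setC A : g_sigma_preimage coors A -> g_sigma_preimage coors (~` A).
Proof. exact: sigma_algebraC. Qed.

Let rV_bigcup (F : _^nat) : (forall i, g_sigma_preimage coors (F i)) ->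
  g_sigma_preimage coors (\bigcup_i (F i)).
Proof. exact: sigma_algebra_bigcup. Qed.

HB.instance Definition _ := @isMeasurable.Build rV_display
  'rV[R]_n (g_sigma_preimage coors) rV_set0 rV_setC rV_bigcup.

End measurable_rV.

Section measurable_fun_rV.
Context {R : realType}.

Lemma measurable_coord n (i : 'I_n) :
  measurable_fun [set: 'rV[R]_n] (fun x : 'rV[R]_n => x 0 i).
Proof.
move=> _ Y mY; rewrite setTI; apply: sub_sigma_algebra => /=.
rewrite -bigcup_seq/=; exists i => /=; first by rewrite mem_index_enum.
by exists Y => //; rewrite setTI.
Qed.

Lemma measurable_fun_rV d (T : measurableType d) n (f : T -> 'rV[R]_n) :
  (forall i, measurable_fun [set: T] (fun x => f x 0 i)) ->
  measurable_fun [set: T] f.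
Proof.
move=> mf _ A mA; rewrite setTI.
suff: @measurable _ 'rV[R]_n `<=` [set B | measurable (f @^-1` B)] by exact.
apply: smallest_sub.
  split=> /=; first by rewrite preimage_set0.
    by move=> B mB; rewrite setTD preimage_setC; exact: measurableC.
  by move=> F mF; rewrite preimage_bigcup; exact: bigcup_measurable.
case: n => [|n] in f mf A mA *; first by rewrite big_ord0.
rewrite -bigcup_mkord_ord; apply: bigcup_sub => i Ii B [C mC <-] /=.
by rewrite setTI -[X in measurable X]setTI; exact: mf.
Qed.

End measurable_fun_rV.

(* Lebesgue measure on R^n: the n-fold product of Lebesgue measure on R,      *)
(* transported along (t, y) |-> (t, y_0, ..., y_(n-1)).                       *)
Section lebesgue_rV_step.
Context {R : realType} (n : nat).
Variable m : {sigma_finite_measure set 'rV[R]_n -> \bar R}.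

Definition rV_cons (z : R * 'rV[R]_n) : 'rV[R]_(n.+1) :=
  \row_i oapp (fun j => z.2 0 j) z.1 (unlift ord0 i).

Definition rV_uncons (x : 'rV[R]_(n.+1)) : R * 'rV[R]_n :=
  (x 0 ord0, \row_j x 0 (lift ord0 j)).

Lemma rV_consK : cancel rV_cons rV_uncons.
Proof.
move=> [t y]; rewrite /rV_cons /rV_uncons; congr pair.
  by rewrite !mxE unlift_none.
by apply/rowP => j; rewrite !mxE liftK.
Qed.

Lemma rV_unconsK : cancel rV_uncons rV_cons.
Proof.
move=> x; apply/rowP => i; rewrite mxE /=.
by case: unliftP => [j ->|->] //=; rewrite mxE.
Qed.

Lemma measurable_rV_cons : measurable_fun setT rV_cons.
Proof.
apply: measurable_fun_rV => i; under eq_fun do rewrite mxE.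
case: (unlift ord0 i) => [j|] /=; last exact: measurable_fst.
apply: (@measurableT_comp _ _ _ _ _ _ (fun y : 'rV[R]_n => y 0 j)) => //.
exact: measurable_coord.
Qed.

Lemma measurable_rV_uncons : measurable_fun setT rV_uncons.
Proof.
apply: measurable_fun_pair; first exact: measurable_coord.
apply: measurable_fun_rV => i; under eq_fun do rewrite mxE.
exact: measurable_coord.
Qed.

Definition lebesgue_rVS : set 'rV[R]_(n.+1) -> \bar R :=
  pushforward (@lebesgue_measure R \x m)%E rV_cons.

Let push : {measure set 'rV[R]_(n.+1) -> \bar R} :=
  measure_function_pushforward__canonical__measure_function_Measure
    (@lebesgue_measure R \x m)%E measurable_rV_cons.

HB.instance Definition _ := isMeasure.Build _ _ _ lebesgue_rVS
  (measure0 push) (measure_ge0 push) (@measure_semi_sigma_additive _ _ _ push).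

Let lebesgue_rVS_sigma_finite : sigma_finite setT lebesgue_rVS.
Proof.
have /sigma_finiteP[F [TF ndF Foo]] := sigma_finiteT (@lebesgue_measure R).
have /sigma_finiteP[G [TG ndG Goo]] := sigma_finiteT m.
exists (fun k => rV_uncons @^-1` (F k `*` G k)).
  rewrite -preimage_bigcup; apply/seteqP; split => // x _ /=.
  have [i _ Fi] : (\bigcup_k F k) (rV_uncons x).1 by rewrite -TF.
  have [j _ Gj] : (\bigcup_k G k) (rV_uncons x).2 by rewrite -TG.
  exists (maxn i j) => //; split => /=.
  - by move: Fi; exact/subsetPset/ndF/leq_maxl.
  - by move: Gj; exact/subsetPset/ndG/leq_maxr.
move=> k; have [mF Fk] := Foo k; have [mG Gk] := Goo k; split.
  rewrite -[X in measurable X]setTI; apply: measurable_rV_uncons => //.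
  exact: measurableX.
rewrite /lebesgue_rVS /pushforward -comp_preimage.
rewrite (_ : rV_uncons \o rV_cons = id); last first.
  by apply/funext => z; exact: rV_consK.
by rewrite preimage_id product_measure1E// lte_mul_pinfty// ge0_fin_numE.
Qed.

HB.instance Definition _ := Measure_isSigmaFinite.Build _ _ _ lebesgue_rVS
  lebesgue_rVS_sigma_finite.

End lebesgue_rV_step.

Fixpoint lebesgue_rV (R : realType) (n : nat) :
    {sigma_finite_measure set 'rV[R]_n -> \bar R} :=
  match n with
  | 0 => [the {sigma_finite_measure set 'rV[R]_0 -> \bar R} of \d_(0 : 'rV[R]_0)]
  | k.+1 => [the {sigma_finite_measure set 'rV[R]_(k.+1) -> \bar R}
               of lebesgue_rVS (lebesgue_rV R k)]
  end.

Section euclidean.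
Context {R : realType} {n : nat}.
Implicit Types x y : 'rV[R]_n.

Definition dotp x y : R := \sum_i x 0 i * y 0 i.

(* The library norm `|x| on 'rV[R]_n is the maximum norm. *)
Definition enorm x : R := Num.sqrt (dotp x x).

Definition sphere : set 'rV[R]_n := [set x | enorm x = 1].

Lemma measurable_enorm : measurable_fun [set: 'rV[R]_n] enorm.
Proof.
have dotp_ge0 x : 0 <= dotp x x by apply: sumr_ge0 => i _; rewrite -expr2 sqr_ge0.
rewrite /enorm; under eq_fun do rewrite -powR12_sqrt//.
apply: (measurableT_comp (measurable_powR _)).
by apply: measurable_sum => i; apply: measurable_funM; exact: measurable_coord.
Qed.

Definition unit_ball : set 'rV[R]_n := [set x | enorm x <= 1].

Lemma measurable_unit_ball : measurable unit_ball.
Proof.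
rewrite (_ : unit_ball = setT `&` enorm @^-1` `]-oo, 1]).
  by apply: measurable_enorm => //; exact: measurable_itv.
by rewrite setTI; apply/seteqP; split => x /=; rewrite in_itv.
Qed.

Definition normalize x : 'rV[R]_n := (enorm x)^-1 *: x.

Lemma measurable_normalize : measurable_fun [set: 'rV[R]_n] normalize.
Proof.
apply: measurable_fun_rV => i; under eq_fun do rewrite mxE -powR_inv1 ?sqrtr_ge0//.
apply: measurable_funM; last exact: measurable_coord.
exact: (measurableT_comp (measurable_powR _) measurable_enorm).
Qed.

(* Surface measure of the unit sphere, as a measure on R^n concentrated on    *)
(* the sphere: sigma(A) = n |{r xi : xi in A, 0 < r <= 1}|.  For n = 1 it is  *)
(* the counting measure of {-1, 1}.                                           *)
Let push : {measure set 'rV[R]_n -> \bar R} :=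
  measure_function_pushforward__canonical__measure_function_Measure
    (mrestr (lebesgue_rV R n) measurable_unit_ball) measurable_normalize.

Definition surface_measure : set 'rV[R]_n -> \bar R := mscale (n%:R)%:nng push.

HB.instance Definition _ := Measure.on surface_measure.

End euclidean.

Section sobolev.
Context {R : realType} {n : nat}.
Implicit Types (f phi : 'rV[R]_n -> R) (g : 'rV[R]_n -> 'rV[R]_n).
Local Notation leb := (lebesgue_rV R n).

Definition partial (i : 'I_n) phi : 'rV[R]_n -> R :=
  fun x => 'D_(delta_mx 0 i) phi x.

(* C^oo: all iterated partial derivatives are (Frechet) differentiable. *)
Definition smooth phi :=
  forall (s : seq 'I_n) x, differentiable (foldr partial phi s) x.

Definition test_function phi :=
  smooth phi /\ compact (closure [set x | phi x != 0]).

Definition locally_integrable_rV f :=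
  forall A : set 'rV[R]_n, compact A -> leb.-integrable A (EFin \o f).

Definition weak_gradient f g :=
  [/\ locally_integrable_rV f,
      forall i, locally_integrable_rV (fun x => g x 0 i) &
      forall i phi, test_function phi ->
        (\int[leb]_x (f x * partial i phi x)%:E =
         - \int[leb]_x (g x 0 i * phi x)%:E)%E].

(* A representative of the (almost everywhere unique) weak gradient of f;     *)
(* 0 if there is none.                                                        *)
Definition grad f : 'rV[R]_n -> 'rV[R]_n :=
  xget (fun=> 0) [set g | weak_gradient f g].

Definition sobolev1 (p : \bar R) f :=
  [/\ f \in Lfun leb p, exists g, weak_gradient f g &
      (fun x => enorm (grad f x)) \in Lfun leb p].

End sobolev.

Section star_bodies.
Context {R : realType} {n : nat}.
Implicit Types (K L : set 'rV[R]_n) (x : 'rV[R]_n).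
Local Open Scope ereal_scope.

Definition star_shaped K :=
  forall x (l : R), K x -> (0 <= l <= 1)%R -> K (l *: x)%R.

Definition gauge K x : \bar R :=
  ereal_inf [set l%:E | l in [set l : R | (0 < l)%R /\ [set (l *: y)%R | y in K] x]].

(* The supremum is taken in [0, +oo], so that it is 0 on the empty set. *)
Definition radial K x : \bar R :=
  maxe 0 (ereal_sup [set l%:E | l in [set l : R | (0 < l)%R /\ K (l *: x)%R]]).

Definition star_body K :=
  star_shaped K /\
  forall x, (x != 0)%R -> 0 < radial K x /\ {for x, continuous (radial K)}.

(* a ^ r for a in [0, +oo], with 0 ^ r = +oo and +oo ^ r = 0 for r < 0        *)
(* (whereas the library has 0 `^ r = 0 and +oo `^ r = +oo for all r <> 0).    *)
Definition epow (a : \bar R) (r : R) : \bar R :=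
  if (0 <= r)%R then a `^ r else (a `^ (- r))^-1.

Definition volume K : \bar R :=
  (n%:R^-1)%:E * \int[surface_measure]_(xi in sphere) epow (gauge K xi) (- n%:R).

Definition dual_mixed_volume (q : R) K L : \bar R :=
  (n%:R^-1)%:E * \int[surface_measure]_(xi in sphere)
    (epow (gauge K xi) (- n%:R + q) * epow (gauge L xi) (- q)).

End star_bodies.

Section polar_projection_bodies.
Context {R : realType} {n : nat}.
Implicit Types (f : 'rV[R]_n -> R) (xi : 'rV[R]_n) (s p : R).
Local Notation leb := (lebesgue_rV R n).

(* sgpart true a = a_+ and sgpart false a = a_-. *)
Definition sgpart (b : bool) (a : R) : R :=
  if b then Num.max a 0 else Num.max (- a) 0.

Local Open Scope ereal_scope.

Definition gauge_frac_polar_proj b s p f xi : \bar R :=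
  ((p * (1 - s))%:E *
   \int[lebesgue_measure]_(t in `]0%R, +oo[)
     ((t `^ (- (p * s) - 1))%:E *
      \int[leb]_x (sgpart b (f (x + t *: xi) - f x) `^ p)%:E)) `^ (p * s)^-1.

Definition frac_polar_proj b s p f : set 'rV[R]_n :=
  [set xi | gauge_frac_polar_proj b s p f xi <= 1].

Definition gauge_polar_proj b p f xi : \bar R :=
  (\int[leb]_x (sgpart b (dotp (grad f x) xi) `^ p)%:E) `^ p^-1.

Definition polar_proj b p f : set 'rV[R]_n := [set xi | gauge_polar_proj b p f xi <= 1].

Definition gauge_frac_polar_proj_oo b s f xi : \bar R :=
  (ereal_sup [set (z.2 `^ (- s) * sgpart b (f (z.1 + z.2 *: xi) - f z.1))%:E
             | z in [set z : 'rV[R]_n * R | (0 < z.2)%R]]) `^ s^-1.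

Definition frac_polar_proj_oo b s f : set 'rV[R]_n :=
  [set xi | gauge_frac_polar_proj_oo b s f xi <= 1].

Definition gauge_polar_proj_oo b f xi : \bar R :=
  ess_sup leb (fun x => (sgpart b (dotp (grad f x) xi))%:E).

Definition polar_proj_oo b f : set 'rV[R]_n :=
  [set xi | gauge_polar_proj_oo b f xi <= 1].

End polar_projection_bodies.

(* Main.v *)
Require Import Defs.
From HB Require Import structures.
From mathcomp Require Import all_boot all_order all_algebra.
From mathcomp Require Import all_classical all_reals all_analysis.
From mathcomp Require Import measurable_realfun ess_sup_inf ring lra.
Import Order.TTheory GRing.Theory Num.Theory.
Import numFieldNormedType.Exports.
Local Open Scope classical_set_scope.
Local Open Scope ring_scope.
Set Implicit Arguments.
Unset Strict Implicit.
Unset Printing Implicit Defensive.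

(* Up to p-th roots, the gauges are L^p norms of (increments or directional
   derivatives of) f, so they converge pointwise on the sphere to the sup norms:
   splitting off p - p0 factors of the integrand gives an upper bound
   N ^ (p - p0) C0, and the set where the integrand exceeds a < N gives a lower
   bound a ^ p d which is uniform near a given direction. As f is integrable,
   it increases somewhere in every direction; by compactness of the sphere the
   gauges are bounded and bounded away from 0 uniformly in p, and dominated
   convergence applies to the volumes and the dual mixed volumes. For s -> 1,
   the supremum of t ^ (- s) (f (x + t xi) - f x)_+- tends to the one for s = 1,
   which is the essential supremum of <grad f, xi>_+- : testing the weak
   gradient against bump functions shows that the inequality <grad f, xi> <= N
   almost everywhere is equivalent to f (x + t xi) - f x <= t N for all x and
   t > 0. *)

(** * Lebesgue measure on R^n *)

Section translation1.
Context {R : realType}.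
Local Notation mu := (@lebesgue_measure R).

(** The weak gradient is defined only up to null sets, so its values along a single line carry no
    information. Every link between increments and gradient therefore goes through the function of t
    that integrates u (x + t xi) phi x: moving the shift onto the bump phi makes it differentiable
    in t. Bumps only see averages; to get back from increments to an almost everywhere bound, the
    class of test functions is enlarged from bumps to indicators of bounded measurable sets.
    Dominated convergence on the sphere asks for bounds that are uniform in the direction, while
    nothing is known about continuity in xi of the limit gauges. The Lipschitz property fills this
    gap: a lower bound found in one direction persists, with the same constants and for all large p,
    in all nearby directions. The limit s -> 1 is brought to the same form as the others by s = 1 -
    1 / p, and the two signs are reduced to positive parts by passing to - f. *)

Lemma ge0_integral_translation1 (a : R) (F : R -> \bar R) :
  measurable_fun setT F -> (forall x, (0 <= F x)%E) ->
  (\int[mu]_x F (x + a)%R = \int[mu]_x F x)%E.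
Proof.
move=> mF F0.
have ma : measurable_fun [set: measurableTypeR R] ((fun x : R => x + a) : _ -> measurableTypeR R).
  exact: measurable_funD.
pose nu : {measure set (measurableTypeR R) -> \bar R} :=
  measure_function_pushforward__canonical__measure_function_Measure mu ma.
(* Half-open intervals determine Lebesgue measure, so the pushforward under the shift is compared
   with it on them only. *)
have E A : measurable A -> mu A = nu A.
  move=> mA; apply: lebesgue_measure_unique => // _ [[x y] _ <-] /=.
  rewrite /nu /= /pushforward lebesgue_measure_itv.
  rewrite (_ : (fun x0 : R => (x0 + a)%R) @^-1` [set` `]x, y]] = [set` `](x - a), (y - a)]]); last first.
    by apply/seteqP; split => z /=; rewrite !in_itv/= ltrBlDr lerBrDr.
  rewrite lebesgue_measure_itv /= !lte_fin ltrBlDr subrK.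
  by case: ifP => // _; rewrite -!EFinB; congr EFin; rewrite opprB addrA addrNK.
transitivity (\int[nu]_x F x)%E; last first.
  by apply: eq_measure_integral => A mA _; exact/esym/E.
by rewrite (ge0_integral_pushforward ma).
Qed.

(** The pushforward of Lebesgue measure under multiplication by a, rescaled by a, agrees with
    Lebesgue measure on half-open intervals. *)
Lemma ge0_integral_scale1 (a : R) (F : R -> \bar R) : 0 < a ->
  measurable_fun setT F -> (forall x, (0 <= F x)%E) ->
  (\int[mu]_x F (a * x)%R = (a^-1)%:E * \int[mu]_x F x)%E.
Proof.
move=> a0 mF F0.
have ma : measurable_fun [set: measurableTypeR R] ((fun x : R => a * x) : _ -> measurableTypeR R).
  exact: measurable_funM.
have ai : 0 <= a^-1 by rewrite invr_ge0 ltW.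
pose nu0 : {measure set (measurableTypeR R) -> \bar R} :=
  measure_function_pushforward__canonical__measure_function_Measure mu ma.
pose nu : {measure set (measurableTypeR R) -> \bar R} := mscale (NngNum (ltW a0)) nu0.
have E A : measurable A -> mu A = nu A.
  move=> mA; apply: lebesgue_measure_unique => // _ [[x y] _ <-] /=.
  rewrite /nu /= /mscale /= /nu0 /= /pushforward lebesgue_measure_itv.
  rewrite (_ : (fun x0 : R => (a * x0)%R) @^-1` [set` `]x, y]] = [set` `](x / a), (y / a)]]); last first.
    by apply/seteqP; split => z /=; rewrite !in_itv/= ltr_pdivrMr// ler_pdivlMr// mulrC.
  rewrite lebesgue_measure_itv /= !lte_fin ltr_pM2r ?invr_gt0//.
  case: ifP => // _; last by rewrite mule0.
  by rewrite -!EFinB -EFinM; congr EFin; rewrite -mulrBl mulrCA divff ?mulr1// gt_eqF.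
have -> : (\int[mu]_x F x = \int[nu]_x F x)%E.
  by apply: eq_measure_integral => A mA _; exact/E.
rewrite ge0_integral_mscale//= muleA -EFinM mulVf ?gt_eqF// mul1e.
by rewrite (ge0_integral_pushforward ma).
Qed.

End translation1.

Section lebesgue_rV_lemmas.
Context {R : realType}.
Local Open Scope ereal_scope.

Lemma ge0_integral_rVS (n : nat) (F : 'rV[R]_n.+1 -> \bar R) :
  measurable_fun setT F -> (forall x, 0 <= F x) ->
  \int[lebesgue_rV R n.+1]_x F x =
  \int[@lebesgue_measure R]_t \int[lebesgue_rV R n]_y F (rV_cons (t, y)).
Proof.
move=> mF F0.
pose m : {measure set (measurableTypeR R * 'rV[R]_n) -> \bar R} :=
  (@lebesgue_measure R \x lebesgue_rV R n).
have mc : measurable_fun [set: (measurableTypeR R * 'rV[R]_n)%type]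
  (@rV_cons R n : (measurableTypeR R * 'rV[R]_n)%type -> _) := @measurable_rV_cons R n.
rewrite [LHS](ge0_integral_pushforward mc m (D := setT) measurableT mF)//.
rewrite preimage_setT /m.
rewrite fubini_tonelli1//; last by move=> x; exact: F0.
exact: (measurableT_comp mF mc).
Qed.

Lemma measurable_funD_rV d (T : measurableType d) n (f g : T -> 'rV[R]_n) :
  measurable_fun setT f -> measurable_fun setT g ->
  measurable_fun setT (fun x => f x + g x)%R.
Proof.
move=> mf mg; apply: measurable_fun_rV => i.
under eq_fun do rewrite mxE.
by apply: measurable_funD; apply: (measurableT_comp (measurable_coord i)).
Qed.

Lemma measurable_funZ_rV d (T : measurableType d) n (c : T -> R) (g : T -> 'rV[R]_n) :
  measurable_fun setT c -> measurable_fun setT g ->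
  measurable_fun setT (fun x => c x *: g x)%R.
Proof.
move=> mf mg; apply: measurable_fun_rV => i.
under eq_fun do rewrite mxE.
by apply: measurable_funM => //; apply: (measurableT_comp (measurable_coord i)).
Qed.

(** Induction on the dimension: Tonelli splits off the first coordinate, the induction hypothesis
    shifts the others, and the one-dimensional case shifts the first. *)
Lemma ge0_integral_translation (n : nat) (v : 'rV[R]_n) (F : 'rV[R]_n -> \bar R) :
  measurable_fun setT F -> (forall x, 0 <= F x) ->
  \int[lebesgue_rV R n]_x F (x + v)%R = \int[lebesgue_rV R n]_x F x.
Proof.
elim: n => [|n IH] in v F *.
  move=> mF F0; apply: eq_integral => x _; congr F.
  by apply/rowP => -[].
move=> mF F0.
have mv : measurable_fun setT (fun x : 'rV[R]_n.+1 => x + v)%R.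
  by apply: measurable_funD_rV.
have mFv : measurable_fun setT (fun x : 'rV[R]_n.+1 => F (x + v)%R) by exact: (measurableT_comp mF mv).
rewrite (ge0_integral_rVS mFv (fun x => F0 _)).
rewrite (ge0_integral_rVS mF F0).
pose F' (t : R) (y : 'rV[R]_n) := F (rV_cons (t, y)).
have mF' : measurable_fun setT (fun z : R * 'rV[R]_n => F (rV_cons z)).
  exact: (measurableT_comp mF (@measurable_rV_cons R n)).
pose J t := \int[lebesgue_rV R n]_y F' t y.
transitivity (\int[@lebesgue_measure R]_t J (t + v 0 ord0)%R).
  apply: eq_integral => t _.
  rewrite -[RHS](IH (\row_j v 0 (lift ord0 j))%R)//.
  - apply: eq_integral => y _; congr F; apply/rowP => i.
    rewrite !mxE /=; case: unliftP => [j ->|->] /=; rewrite ?mxE//.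
  - have mt : measurable_fun setT (fun y : 'rV[R]_n => ((t + v 0 ord0)%R, y)).
      exact: measurable_fun_pair.
    by rewrite /F'; exact: (measurableT_comp mF' mt).
  - by move=> y; exact: F0.
apply: (@ge0_integral_translation1 R _ J).
- apply: (measurable_fun_fubini_tonelli_F (fun z => F (rV_cons z))) => //.
- by move=> t; apply: integral_ge0 => y _; exact: F0.
Qed.

End lebesgue_rV_lemmas.

(** * Open boxes: balls of the maximum norm and generators of the sigma-algebra *)

Section open_box.
Context {R : realType} {n : nat}.
Implicit Types a b x : 'rV[R]_n.

Definition open_box a b : set 'rV[R]_n := [set x | forall i, a 0 i < x 0 i < b 0 i].

Lemma open_boxE a b :
  open_box a b = \bigcap_(i in [set: 'I_n]) ((fun x => x 0 i) @^-1` `]a 0 i, b 0 i[).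
Proof.
apply/seteqP; split=> x; first by move=> h i _ /=; rewrite in_itv /= h.
by move=> h i; have := h i I; rewrite /= in_itv.
Qed.

Lemma measurable_open_box a b : measurable (open_box a b).
Proof.
rewrite open_boxE.
have fI : finite_set [set: 'I_n] by exact: finite_finset.
apply: fin_bigcap_measurable => // i _.
by rewrite -[X in measurable X]setTI; apply: measurable_coord => //; exact: measurable_itv.
Qed.

Lemma open_box_setI a b c d :
  open_box a b `&` open_box c d =
  open_box (\row_i Num.max (a 0 i) (c 0 i)) (\row_i Num.min (b 0 i) (d 0 i)).
Proof.
apply/seteqP; split => x /=.
  by move=> [h1 h2] i; rewrite !mxE gt_max lt_min; move: (h1 i) (h2 i) => /andP[-> ->] /andP[-> ->].
move=> h; split => i; have := h i; rewrite !mxE gt_max lt_min.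
  by move=> /andP[/andP[-> _] /andP[-> _]].
by move=> /andP[/andP[_ ->] /andP[_ ->]].
Qed.

Lemma normr_rV_lt x e : 0 < e -> (`|x| < e) = [forall i, `|x 0 i| < e].
Proof.
move=> e0; apply/idP/forallP => [h i|h].
  apply: le_lt_trans h; rewrite [in X in _ <= X]/Num.norm /= mx_normrE.
  by apply: (le_trans _ (le_bigmax _ _ (ord0, i))).
rewrite [in X in X < _]/Num.norm /= mx_normrE.
by apply/bigmax_ltP; split => // -[i j] _; rewrite ord1.
Qed.

Lemma normr_coord_le x i : `|x 0 i| <= `|x|.
Proof.
rewrite [in X in _ <= X]/Num.norm /= mx_normrE.
by apply: (le_trans _ (le_bigmax _ _ (ord0, i))).
Qed.

Lemma ball_open_box x e : 0 < e ->
  ball x e = open_box (\row_i (x 0 i - e)) (\row_i (x 0 i + e)).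
Proof.
move=> e0; rewrite -ball_normE; apply/seteqP; split => y /=.
  rewrite normr_rV_lt// => /forallP h i; move: (h i).
  by rewrite !mxE ltr_distlC.
move=> h; rewrite normr_rV_lt//; apply/forallP => i; move: (h i).
by rewrite !mxE ltr_distlC.
Qed.

(** The sigma-algebra comes from the coordinates, so an open set has to be reached by countably many
    coordinate conditions: it is the union of the balls inside it with rational center and radius 1
    / (m + 1), and balls of the maximum norm are boxes. *)
Lemma open_measurable_rV (A : set 'rV[R]_n) : open A -> measurable A.
Proof.
move=> oA.
pose Q : set 'rV[R]_n := [set x | exists q : 'rV[rat]_n, x = map_mx ratr q].
(* [q_] enumerates the rational points. A number that codes nothing yields 0, which is harmless
   because [F] checks inclusion in A. *)
pose q_ (k : nat) : 'rV[R]_n := map_mx ratr (odflt 0 (unpickle k : option 'rV[rat]_n)).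
pose F (k m : nat) := if `[< ball (q_ k) m.+1%:R^-1 `<=` A >] then ball (q_ k) m.+1%:R^-1 else set0.
have -> : A = \bigcup_k \bigcup_m F k m.
  apply/seteqP; split => [x Ax|x [k _ [m _]]]; last first.
    by rewrite /F; case: asboolP => // h /h.
  have /nbhs_ballP[e /= e0 he] := open_nbhs_nbhs (conj oA Ax).
  (* A radius below e / 2 keeps a ball around a rational point inside [ball x e] as soon as it
     contains x. *)
  have [m _ /(_ m (leqnn m)) hm] := near_infty_natSinv_lt (PosNum (divr_gt0 e0 (ltr0n R 2))).
  rewrite /= in hm.
  have hr (i : 'I_n) : exists r : rat, `|x 0 i - ratr r| < m.+1%:R^-1.
    have /dense_rat : ball (x 0 i) (m.+1%:R^-1 : R) !=set0.
      by exists (x 0 i); apply: ballxx; rewrite invr_gt0.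
    by move=> /(_ (ball_open _ _)) [y [yb [r _ ry]]]; exists r; rewrite ry.
  have [r hr'] := choice hr.
  exists (pickle (\row_i r i)) => //; exists m => //.
  have E : q_ (pickle (\row_i r i)) = map_mx ratr (\row_i r i) by rewrite /q_ pickleK.
  have bx : ball (q_ (pickle (\row_i r i))) m.+1%:R^-1 x.
    rewrite E -ball_normE /= normr_rV_lt ?invr_gt0//; apply/forallP => i.
    by rewrite !mxE distrC hr'.
  rewrite /F asboolT// => y hy; apply: he.
  apply: (@ball_splitl _ _ (q_ (pickle (\row_i r i)))).
    by apply/ball_sym; apply: (le_ball (ltW hm)).
  by apply/ball_sym; apply: (le_ball (ltW hm)).
apply: bigcup_measurable => k _; apply: bigcup_measurable => m _.
rewrite /F; case: asboolP => // _.
by rewrite ball_open_box ?invr_gt0//; exact: measurable_open_box.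
Qed.

Lemma continuous_measurable_rV (f : 'rV[R]_n -> R) : continuous f -> measurable_fun setT f.
Proof.
move=> /continuousP cf; apply: (measurability _ (RGenOpens.measurableE R)).
move=> _ [_ [a [b ->] <-]]; rewrite setTI; apply: open_measurable_rV.
exact/cf/interval_open.
Qed.

End open_box.

Section open_box_measure.
Context {R : realType}.
Local Open Scope ereal_scope.

Lemma lebesgue_open_box n (a b : 'rV[R]_n) : (forall i, a 0 i < b 0 i)%R ->
  lebesgue_rV R n (open_box a b) = (\prod_i (b 0 i - a 0 i))%:E.
Proof.
elim: n => [|n IH] in a b *.
  move=> _; rewrite big_ord0 /= diracE mem_set//.
  by move=> [].
move=> ab; pose a' := (\row_j a 0 (lift ord0 j))%R; pose b' := (\row_j b 0 (lift ord0 j))%R.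
have IHab : lebesgue_rV R n (open_box a' b') = (\prod_i (b' 0 i - a' 0 i))%:E.
  by apply: IH => i; rewrite !mxE.
have -> : lebesgue_rV R n.+1 (open_box a b) =
   (@lebesgue_measure R \x lebesgue_rV R n) (`](a 0 ord0)%R, (b 0 ord0)%R[%classic `*` open_box a' b').
  rewrite /= /lebesgue_rVS /pushforward; congr (_ _).
  apply/seteqP; split => [[t y]/=|[t y]/= [h1 h2] i].
    move=> h; split; first by have := h ord0; rewrite !mxE unlift_none/= in_itv.
    by move=> i; have := h (lift ord0 i); rewrite !mxE liftK.
  rewrite !mxE; case: unliftP => [j ->|->] /=; last by move: h1; rewrite in_itv.
  by have := h2 j; rewrite !mxE.
rewrite product_measure1E//; last exact: measurable_open_box.
have L : lebesgue_measure (`](a 0 ord0)%R, (b 0 ord0)%R[%classic : set R) = (b 0 ord0 - a 0 ord0)%:E.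
  by rewrite lebesgue_measure_itv /= lte_fin ab -EFinB.
rewrite (_ : _ * _ = (b 0 ord0 - a 0 ord0)%:E * (\prod_i (b' 0 i - a' 0 i))%:E); last exact: congr2 L IHab.
rewrite -EFinM big_ord_recl.
by congr (_ * _)%:E; apply: eq_bigr => i _; rewrite !mxE.
Qed.

Lemma lebesgue_open_box_gt0 n (a b : 'rV[R]_n) : (forall i, a 0 i < b 0 i)%R ->
  0 < lebesgue_rV R n (open_box a b).
Proof.
move=> ab; rewrite lebesgue_open_box// lte_fin; apply: prodr_gt0 => i _.
by rewrite subr_gt0.
Qed.

Lemma lebesgue_open_box_fin n (a b : 'rV[R]_n) :
  lebesgue_rV R n (open_box a b) < +oo.
Proof.
have [ab|/existsNP[i iab]] := pselect (forall i, a 0 i < b 0 i)%R.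
  by rewrite lebesgue_open_box// ltry.
suff -> : open_box a b = set0 by rewrite measure0.
by apply/seteqP; split => // x /(_ i) /andP[xa xb]; case: iab; apply: lt_trans xb.
Qed.

Lemma bounded_open_box n (A : set 'rV[R]_n) : bounded_set A ->
  exists a b, A `<=` open_box a b.
Proof.
move=> [M [Mr hM]]; exists (\row_i (- (M + 2)))%R, (\row_i (M + 2))%R => x Ax i.
have h : (`|x| <= M + 1)%R by apply: hM Ax; rewrite ltrDl.
rewrite !mxE -ltr_norml; apply: (le_lt_trans (normr_coord_le _ _)).
by apply: (le_lt_trans h); rewrite ltrD2l ltr1n.
Qed.

Lemma lebesgue_bounded_fin n (A : set 'rV[R]_n) : measurable A -> bounded_set A ->
  lebesgue_rV R n A < +oo.
Proof.
move=> mA /bounded_open_box[a [b ab]].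
apply: le_lt_trans (lebesgue_open_box_fin a b).
by apply: le_measure => //; rewrite inE//; exact: measurable_open_box.
Qed.

Lemma lebesgue_ball_gt0 n (x : 'rV[R]_n) (e : R) : (0 < e)%R ->
  0 < lebesgue_rV R n (ball x e).
Proof.
move=> e0; rewrite ball_open_box//; apply: lebesgue_open_box_gt0 => i.
by rewrite !mxE ltrD2l gtrN.
Qed.

Lemma lebesgue_ball_fin n (x : 'rV[R]_n) (e : R) : (0 < e)%R ->
  lebesgue_rV R n (ball x e) < +oo.
Proof. by move=> e0; rewrite ball_open_box//; exact: lebesgue_open_box_fin. Qed.

Lemma measurable_ball_rV n (x : 'rV[R]_n) (e : R) : measurable (ball x e).
Proof. by apply: open_measurable_rV; exact: ball_open. Qed.

Lemma lebesgue_ball n (x y : 'rV[R]_n) (e : R) : (0 < e)%R ->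
  lebesgue_rV R n (ball x e) = lebesgue_rV R n (ball y e).
Proof.
move=> e0; rewrite !ball_open_box// !lebesgue_open_box => [|i|i]; try by rewrite !mxE ltrD2l gtrN.
by congr EFin; apply: eq_bigr => i _; rewrite !mxE; ring.
Qed.

(** Boxes are stable under intersection, so this is the presentation of the sigma-algebra to which
    the Dynkin argument of [test_set] applies. *)
Lemma measurable_rVE n : @measurable _ 'rV[R]_n =
  <<s [set A | exists a b, A = open_box a b] >>.
Proof.
apply/seteqP; split => A; last first.
  apply: smallest_sub => [|_ [a [b ->]]]; last exact: measurable_open_box.
  exact: sigma_algebra_measurable.
set S := <<s _ >>; have SS : sigma_algebra setT S by exact: smallest_sigma_algebra.
suff: @measurable _ 'rV[R]_n `<=` S by exact.
apply: smallest_sub => //.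
case: n => [|n] in A S SS *; first by rewrite big_ord0.
rewrite -bigcup_mkord_ord; apply: bigcup_sub => i Ii B [C mC <-] /=.
rewrite setTI.
suff: @measurable _ (measurableTypeR R) `<=` [set C | S ((fun x : 'rV[R]_n.+1 => x 0 (inord i))%R @^-1` C)].
  exact.
have [S0 SC SU] := SS.
rewrite [X in X `<=` _](RGenInftyO.measurableE R).
apply: smallest_sub.
  split => /=; first by rewrite preimage_set0.
    by move=> D SD; rewrite setTD preimage_setC -setTD; exact: SC.
  by move=> F SF; rewrite preimage_bigcup; exact: SU.
move=> _ [c ->] /=.
(* The half-space x_i < c is exhausted by boxes with side ]-k, c[ in direction i and ]-k, k[ in the
   other directions. *)
rewrite (_ : _ @^-1` _ = \bigcup_k open_box (\row_(_ < n.+1) - k%:R)%R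
    (\row_(j < n.+1) if j == inord i then c else k%:R)%R).
  by apply: SU => k; apply: sub_gen_smallest; do 2 eexists.
apply/seteqP; split => x /=.
  rewrite in_itv /= => xc.
  have hx := archi_boundP (normr_ge0 x).
  exists (Num.bound `|x|)%R => // j; rewrite !mxE.
  have : (`|x 0 j| < (Num.bound `|x|)%:R)%R by apply: le_lt_trans hx; exact: normr_coord_le.
  by rewrite ltr_norml => /andP[-> xj]; case: eqVneq => [->|].
by move=> [k _ /(_ (inord i))]; rewrite !mxE eqxx in_itv /= => /andP[].
Qed.

End open_box_measure.

(** * Smooth bumps *)

Section theta.
Context {R : realType}.
Implicit Types (p q : {poly R}) (t y : R).

(** The classical cutoff exp (- 1 / t), multiplied by a polynomial in 1 / t. The polynomial makes
    the family stable under differentiation, which replaces p by X^2 (p - p'). *)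
Definition theta p t : R := if 0 < t then p.[t^-1] * expR (- t^-1) else 0.

Lemma poly_expRN_bounded p : exists2 C, 0 <= C & forall y, 0 <= y -> `|p.[y] * expR (- y)| <= C.
Proof.
(* For k > 0, exp y is the k-th power of exp (y / k), which is at least y / k. *)
have mon k y : 0 <= y -> y ^+ k * expR (- y) <= k%:R ^+ k.
  move=> y0; case: k => [|k].
    by rewrite !expr0 mul1r -expR0 ler_expR oppr_le0.
  rewrite expRN ler_pdivrMr ?expR_gt0//.
  have -> : y = k.+1%:R * (y / k.+1%:R) by rewrite mulrCA divff ?mulr1// pnatr_eq0.
  rewrite expRM_natl exprMn ler_pM2l ?exprn_gt0//.
  rewrite lerXn2r ?nnegrE ?expR_ge0// ?divr_ge0//.
  by apply: le_trans (expR_ge1Dx _); rewrite lerDr.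
exists (\sum_(i < size p) `|p`_i| * i%:R ^+ i).
  by apply: sumr_ge0 => i _; rewrite mulr_ge0// exprn_ge0.
move=> y y0; rewrite horner_coef mulr_suml.
apply: le_trans (ler_norm_sum _ _ _) _; apply: ler_sum => i _.
rewrite -mulrA normrM ler_wpM2l// ger0_norm; first exact: mon.
by rewrite mulr_ge0 ?expR_ge0 ?exprn_ge0.
Qed.

Lemma theta_bounded p : exists C, forall t, `|theta p t| <= C.
Proof.
have [C C0 hC] := poly_expRN_bounded p; exists C => t; rewrite /theta.
by case: ifPn => t0; [apply: hC; rewrite invr_ge0 ltW|rewrite normr0].
Qed.

(** The boundedness of X^2 p times the exponential, rewritten in t = 1 / y. Quadratic decay gives
    the derivative 0 at t = 0, where the two branches of [theta] meet. *)
Lemma theta_sqr_le p : exists C, forall t, `|theta p t| <= C * t ^+ 2.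
Proof.
have [C C0 hC] := poly_expRN_bounded ('X^2 * p); exists C => t; rewrite /theta.
case: ifPn => t0; last by rewrite normr0 mulr_ge0// sqr_ge0.
have := hC t^-1; rewrite invr_ge0 ltW// => /(_ isT).
rewrite hornerM hornerXn -mulrA normrM exprVn gtr0_norm ?invr_gt0 ?exprn_gt0//.
by rewrite mulrC ler_pdivrMr// exprn_gt0.
Qed.

Lemma theta_is_derive p t : is_derive t (1 : R) (theta p) (theta ('X^2 * (p - p^`())) t).
Proof.
have [t0|t0|->] := ltgtP t 0.
- have E : \near t, cst 0 t = theta p t.
    near=> x; rewrite /theta ifF//; apply/negbTE; rewrite -leNgt.
    apply/ltW; near: x; exact: lt_nbhsl.
  rewrite /theta ifF; last by rewrite ltNge ltW.
  exact: (@near_eq_is_derive _ _ _ (cst 0) (theta p) t 1 0 E (is_derive_cst _ _ _)).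
- have E : \near t, (fun x => p.[x^-1] * expR (- x^-1)) t = theta p t.
    near=> x; rewrite /theta ifT//; near: x; exact: lt_nbhsr.
  have t0' : t != 0 by rewrite gt_eqF.
  have dV : is_derive t 1 (fun x : R => x^-1) (- t ^- 2).
    by have := @is_deriveV _ id t 1 1 t0' (is_derive_id _ _); rewrite /= scaler1.
  apply: (@near_eq_is_derive _ _ _ _ (theta p) t 1 _ E).
  have d1 : is_derive t 1 (fun x : R => p.[x^-1]) (p^`().[t^-1] * - t ^- 2).
    by apply: (@is_derive1_comp _ (horner p) (fun x : R => x^-1)).
  have d2 : is_derive t 1 (fun x : R => expR (- x^-1)) (expR (- t^-1) * t ^- 2).
    have dNV : is_derive t 1 (fun x : R => - x^-1) (t ^- 2).
      by rewrite -[t ^- 2]opprK; exact: is_deriveN.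
    by apply: (@is_derive1_comp _ expR (fun x : R => - x^-1)).
  have d3 := @is_deriveM _ _ _ _ t 1 _ _ d1 d2.
  apply: (is_derive_eq d3).
  rewrite /theta t0 !hornerE /= /GRing.scale /= exprVn; ring.
- rewrite {2}/theta ltxx.
  have [C hC] := theta_sqr_le p.
  have th0 : theta p 0 = 0 by rewrite /theta ltxx.
  suff H : h^-1 *: (theta p (h *: 1 + 0) - theta p 0) @[h --> (0 : R)^'] --> (0 : R).
    apply: DeriveDef; first by apply/cvg_ex; exists 0.
    exact: cvg_lim H.
  apply: norm_cvg0.
  apply: (@squeeze_cvgr _ _ _ _ (cst 0) (fun h => C * `|h|)).
  - near=> h; rewrite normr_ge0 /= th0 subr0 addr0 normrZ /GRing.scale /= mulr1 normfV.
    have h0 : 0 < `|h| by rewrite normr_gt0; near: h; exact: nbhs_dnbhs_neq.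
    rewrite mulrC ler_pdivrMr// -mulrA -expr2 real_normK ?num_real//.
  - exact: cvg_cst.
  - have : C * `|h| @[h --> (0 : R)^'] --> C * `|0 : R|.
      by apply: cvgMl_tmp; apply: cvg_norm; exact: cvg_within.
    by rewrite normr0 mulr0.
Unshelve. all: by end_near. Qed.

End theta.

Section bump_algebra.
Context {R : realType} {n : nat}.
Implicit Types (f g phi : 'rV[R]_n -> R).

(* Stable under partial derivatives, hence made of smooth functions. *)
Inductive bump_algebra : ('rV[R]_n -> R) -> Prop :=
| bump_cst c : bump_algebra (cst c)
| bump_theta p i k c : bump_algebra (fun x => theta p (k * x 0 i + c))
| bump_add f g : bump_algebra f -> bump_algebra g -> bump_algebra (f + g)
| bump_mul f g : bump_algebra f -> bump_algebra g -> bump_algebra (f * g).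

Lemma is_derive_theta_coord p i k c (x v : 'rV[R]_n) :
  is_derive x v (fun x => theta p (k * x 0 i + c))
    (theta ('X^2 * (p - p^`())) (k * x 0 i + c) * (k * v 0 i)).
Proof.
have E (h : R) : theta p (k * (h *: v + x) 0 i + c) =
    theta p (h *: (k * v 0 i) + (k * x 0 i + c)).
  by rewrite !mxE /GRing.scale /=; congr theta; ring.
have [dth dthE] := theta_is_derive p (k * x 0 i + c).
have dfth : differentiable (theta p) (k * x 0 i + c) by exact/derivable1_diffP.
have [dD DE] : is_derive (k * x 0 i + c) (k * v 0 i) (theta p)
    (theta ('X^2 * (p - p^`())) (k * x 0 i + c) * (k * v 0 i)).
  apply: DeriveDef; first exact: diff_derivable.
  by rewrite deriveE// diff1E// derive1E dthE /GRing.scale /= mulrC.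
set f := fun x : 'rV[R]_n => _.
have FE : (fun h => h^-1 *: ((theta p \o shift (k * x 0 i + c)) (h *: (k * v 0 i)) - theta p (k * x 0 i + c)))
   = (fun h => h^-1 *: ((f \o shift x) (h *: v) - f x)).
  by apply/funext => h /=; rewrite /f /shift /= E.
by split; [move: dD; rewrite /derivable FE|rewrite -DE /derive FE].
Qed.

Lemma bump_differentiable phi x : bump_algebra phi -> differentiable phi x.
Proof.
elim=> {phi} [c|p i k c|f g _ df _ dg|f g _ df _ dg].
- exact: differentiable_cst.
- rewrite -[X in differentiable X _]/(theta p \o (fun x : 'rV[R]_n => k * x 0 i + c)).
  apply: (@differentiable_comp _ _ _ _ (fun x : 'rV[R]_n => k * x 0 i + c) (theta p)).
    apply: differentiableD => //; apply: differentiableM => //.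
    exact: differentiable_coord.
  by apply/derivable1_diffP; have [] := theta_is_derive p (k * x 0 i + c).
- exact: differentiableD.
- exact: differentiableM.
Qed.

Lemma bump_partial j phi : bump_algebra phi -> bump_algebra (partial j phi).
Proof.
elim=> {phi} [c|p i k c|f g hf df hg dg|f g hf df hg dg].
- rewrite (_ : partial j _ = cst 0); first exact: bump_cst.
  by apply/funext => x; rewrite /partial derive_cst.
- rewrite (_ : partial j _ = (fun x => theta ('X^2 * (p - p^`())) (k * x 0 i + c)) *
    cst (k * (j == i)%:R)); first by apply: bump_mul; [exact: bump_theta|exact: bump_cst].
  apply/funext => x; rewrite /partial.
  have [_ ->] := is_derive_theta_coord p i k c x (delta_mx 0 j).
  by rewrite mxE eqxx eq_sym.
- rewrite (_ : partial j _ = partial j f + partial j g); first exact: bump_add.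
  by apply/funext => x; rewrite /partial deriveD//; apply: diff_derivable; exact: bump_differentiable.
- rewrite (_ : partial j _ = f * partial j g + g * partial j f).
    by apply: bump_add; exact: bump_mul.
  by apply/funext => x; rewrite /partial deriveM//; apply: diff_derivable; exact: bump_differentiable.
Qed.

Lemma bump_smooth phi : bump_algebra phi -> smooth phi.
Proof.
move=> hphi s x; apply: bump_differentiable.
by elim: s => //= i s; exact: bump_partial.
Qed.

Lemma bump_bounded phi : bump_algebra phi -> exists C, forall x, `|phi x| <= C.
Proof.
elim=> {phi} [c|p i k c|f g _ [C hC] _ [D hD]|f g _ [C hC] _ [D hD]].
- by exists `|c|.
- by have [C hC] := theta_bounded p; exists C.
- by exists (C + D) => x; apply: le_trans (ler_normD _ _) _; apply: lerD.
- by exists (C * D) => x; rewrite normrM; apply: ler_pM.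
Qed.

Lemma bump_shift v phi : bump_algebra phi -> bump_algebra (fun x => phi (x + v)).
Proof.
elim=> {phi} [c|p i k c|f g _ hf _ hg|f g _ hf _ hg].
- exact: bump_cst.
- rewrite (_ : (fun x : 'rV[R]_n => _) = fun x => theta p (k * x 0 i + (k * v 0 i + c))).
    exact: bump_theta.
  by apply/funext => x; rewrite mxE mulrDr addrA.
- exact: (@bump_add (fun x => f (x + v)) (fun x => g (x + v))).
- exact: (@bump_mul (fun x => f (x + v)) (fun x => g (x + v))).
Qed.

Lemma bump_prod (I : Type) (s : seq I) (F : I -> 'rV[R]_n -> R) :
  (forall i, bump_algebra (F i)) -> bump_algebra (fun x => \prod_(i <- s) F i x).
Proof.
move=> hF; elim: s => [|i s IH].
  rewrite (_ : (fun x : 'rV[R]_n => _) = cst 1); first exact: bump_cst.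
  by apply/funext => x; rewrite big_nil.
rewrite (_ : (fun x : 'rV[R]_n => _) = F i * (fun x => \prod_(i <- s) F i x)); first exact: bump_mul.
by apply/funext => x; rewrite big_cons.
Qed.

Lemma bump_derive phi x v : bump_algebra phi ->
  'D_v phi x = \sum_i v 0 i * partial i phi x.
Proof.
move=> hphi; have dphi := bump_differentiable x hphi.
rewrite deriveE// {1}(row_sum_delta v) linear_sum; apply: eq_bigr => i _.
by rewrite linearZ /= /partial deriveE.
Qed.

End bump_algebra.

Section box_bump.
Context {R : realType} {n : nat}.
Implicit Types (a b x v : 'rV[R]_n) (m : R).

Lemma theta1E t : theta 1 t = if 0 < t then expR (- t^-1) else 0 :> R.
Proof. by rewrite /theta; case: ifP => // _; rewrite hornerC mul1r. Qed.

Lemma theta1_ge0 t : 0 <= theta 1 t :> R.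
Proof. by rewrite theta1E; case: ifP => // _; exact: expR_ge0. Qed.

Lemma theta1_le1 t : theta 1 t <= 1 :> R.
Proof.
rewrite theta1E; case: ifPn => // t0.
by rewrite -expR0 ler_expR oppr_le0 invr_ge0 ltW.
Qed.

Lemma theta1_gt0 t : (0 < theta 1 t :> R) = (0 < t).
Proof. by rewrite theta1E; case: ifPn => // _; rewrite ?expR_gt0 ?ltxx. Qed.

(** The arguments are m (x_i - a_i) and m (b_i - x_i), expanded to fit the affine form of
    [bump_theta]. Increasing m sharpens the bump towards the indicator of the box. *)
Definition box_bump a b m x : R :=
  \prod_i (theta 1 (m * x 0 i + - (m * a 0 i)) * theta 1 (- m * x 0 i + m * b 0 i)).

Lemma box_bump_algebra a b m : bump_algebra (box_bump a b m).
Proof. by apply: bump_prod => i; apply: bump_mul; exact: bump_theta. Qed.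

Lemma box_bump_ge0 a b m x : 0 <= box_bump a b m x.
Proof. by apply: prodr_ge0 => i _; rewrite mulr_ge0// theta1_ge0. Qed.

Lemma box_bump_le1 a b m x : box_bump a b m x <= 1.
Proof. by apply: prodr_ile1 => i _; rewrite mulr_ge0 ?theta1_ge0//= mulr_ile1 ?theta1_ge0 ?theta1_le1. Qed.

Lemma box_bump_gt0 a b m x : 0 < m -> open_box a b x -> 0 < box_bump a b m x.
Proof.
move=> m0 h; apply: prodr_gt0 => i _; have /andP[ax xb] := h i.
rewrite mulr_gt0// theta1_gt0; first by rewrite -mulrBr mulr_gt0// subr_gt0.
by rewrite mulNr addrC -mulrBr mulr_gt0// subr_gt0.
Qed.

Lemma box_bump_eq0 a b m x : 0 < m -> ~ open_box a b x -> box_bump a b m x = 0.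
Proof.
move=> m0 /existsNP[i hi]; apply/eqP/prodf_eq0; exists i => //.
rewrite mulf_eq0; apply: contra_notT hi; rewrite negb_or => /andP[h1 h2].
move: (theta1_ge0 (m * x 0 i + - (m * a 0 i))) (theta1_ge0 (- m * x 0 i + m * b 0 i)).
rewrite !le_eqVlt ![0 == _]eq_sym (negbTE h1) (negbTE h2) /= !theta1_gt0.
by rewrite mulNr [_ + m * b _ _]addrC -!mulrBr !pmulr_rgt0// !subr_gt0 => -> ->.
Qed.

Lemma box_bump_shift a b m x v : box_bump a b m (x + v) = box_bump (a - v) (b - v) m x.
Proof. by apply: eq_bigr => i _; rewrite !mxE; congr (theta _ _ * theta _ _); ring. Qed.

Lemma box_bump_test a b m : 0 < m -> test_function (box_bump a b m).
Proof.
move=> m0; split; first exact/bump_smooth/box_bump_algebra.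
pose M := \big[Num.max/0]_i (`|a 0 i| + `|b 0 i|).
have cB : closed [set x : 'rV[R]_n | `|x| <= M].
  rewrite (_ : [set x | _] = (fun x => `|x|) @^-1` [set y | y <= M])//.
  by apply: closed_comp; [move=> x _; exact: norm_continuous|exact: closed_le].
have sB : closure [set x | box_bump a b m x != 0] `<=` [set x : 'rV[R]_n | `|x| <= M].
  rewrite [X in _ `<=` X](closure_id _).1//; apply: closure_subset => x /= xn0.
  have hx : open_box a b x.
    by have [//|/(box_bump_eq0 m0) h] := pselect (open_box a b x); move: xn0; rewrite h eqxx.
  have M0 : 0 <= M by exact: bigmax_ge_id.
  rewrite [in X in X <= _]/Num.norm /= mx_normrE.
  apply/bigmax_leP; split => // -[i j] _ /=; rewrite ord1.
  apply: le_trans (le_bigmax _ _ j).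
  have /andP[/ltW h1 /ltW h2] := hx j.
  rewrite ler_norml; apply/andP; split.
    rewrite (le_trans _ h1)// lerNl (le_trans (ler_norm _))// normrN lerDl//.
  by rewrite (le_trans h2)// (le_trans (ler_norm _))// lerDr.
apply: bounded_closed_compact; last exact: closed_closure.
exists M; split; first exact: num_real.
by move=> y My x /sB /= h; apply: le_trans (ltW My).
Qed.

(** Inside the box each factor has the form exp (- 1 / ((k + 1) c)) with c > 0 and tends to 1;
    outside, all the bumps vanish. *)
Lemma box_bump_cvg a b x :
  box_bump a b k.+1%:R x @[k --> \oo] --> (\1_(open_box a b) x : R).
Proof.
have [h|h] := pselect (open_box a b x); last first.
  rewrite indicE memNset//; apply: cvg_near_cst; apply: nearW => k.
  by rewrite box_bump_eq0.
rewrite indicE mem_set//=.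
have H (c : R) : 0 < c -> theta 1 (k.+1%:R * c) @[k --> \oo] --> (1 : R).
  move=> c0; rewrite (_ : (fun k => _) = fun k => expR (- (k.+1%:R^-1 * c^-1))).
    have : expR (- (k.+1%:R^-1 * c^-1)) @[k --> \oo] --> expR (- (0 * c^-1)).
      apply: continuous_cvg; first exact: continuous_expR.
      by apply: cvgN; apply: cvgMr_tmp; exact: cvg_harmonic.
    by rewrite mul0r oppr0 expR0.
  by apply/funext => k; rewrite theta1E pmulr_rgt0// c0 invfM.
rewrite [X in _ --> X](_ : _ = \prod_(i < n) (1 * 1 : R)); last first.
  by rewrite big1// => i _; rewrite mulr1.
apply: (@cvg_big R _ *%R) => [|i _]; first exact: mul_continuous.
have /andP[ax xb] := h i.
apply: cvgM.
  rewrite (_ : (fun k => _) = fun k => theta 1 (k.+1%:R * (x 0 i - a 0 i))).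
    by apply: H; rewrite subr_gt0.
  by apply/funext => k; rewrite mulrBr.
rewrite (_ : (fun k => _) = fun k => theta 1 (k.+1%:R * (b 0 i - x 0 i))).
  by apply: H; rewrite subr_gt0.
by apply/funext => k; rewrite mulrBr mulNr addrC.
Qed.

End box_bump.

(** * Integration *)

Section integral_rV.
Context {R : realType} {n : nat}.
Local Notation leb := (lebesgue_rV R n).
Implicit Types (u phi : 'rV[R]_n -> R) (v x : 'rV[R]_n).

Lemma measurable_shift_rV v : measurable_fun setT (fun x : 'rV[R]_n => x + v).
Proof. exact: measurable_funD_rV. Qed.

Lemma integral_translation v (F : 'rV[R]_n -> \bar R) : measurable_fun setT F ->
  (\int[leb]_x F (x + v)%R = \int[leb]_x F x)%E.
Proof.
move=> mF; rewrite [LHS]integralE [RHS]integralE; congr (_ - _)%E.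
  have mp : measurable_fun setT (F^\+)%E by exact: measurable_funepos.
  by rewrite -[RHS](ge0_integral_translation v mp (fun x => funepos_ge0 F x)); apply: eq_integral => x _; rewrite !funeposE.
have mm : measurable_fun setT (F^\-)%E by exact: measurable_funeneg.
by rewrite -[RHS](ge0_integral_translation v mm (fun x => funeneg_ge0 F x)); apply: eq_integral => x _; rewrite !funenegE.
Qed.

Lemma integrable_translation v (F : 'rV[R]_n -> \bar R) :
  leb.-integrable setT F -> leb.-integrable setT (fun x => F (x + v)).
Proof.
move=> /integrableP[mF iF]; apply/integrableP; split.
  exact: (measurableT_comp mF (measurable_shift_rV v)).
rewrite (ge0_integral_translation v (F := fun x => `|F x|%E))//.
exact: measurableT_comp.
Qed.

Lemma Rintegral_translation v u : leb.-integrable setT (EFin \o u) ->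
  \int[leb]_x u (x + v) = \int[leb]_x u x.
Proof.
move=> iu; congr fine.
by apply: (integral_translation v (F := EFin \o u)); exact: measurable_int iu.
Qed.

End integral_rV.

Section integrable_bounded.
Context d (T : measurableType d) {R : realType} (mu : {measure set T -> \bar R}).
Implicit Types f g : T -> R.

Lemma integrable_le D f g : measurable D -> mu.-integrable D (EFin \o g) ->
  measurable_fun D f -> (forall x, D x -> `|f x| <= g x) -> mu.-integrable D (EFin \o f).
Proof.
move=> mD ig mf fg; apply: le_integrable ig => //; first exact/measurable_EFinP.
move=> x Dx /=; rewrite lee_fin; apply: le_trans (fg _ Dx) _; exact: ler_norm.
Qed.

Lemma integrable_mul_bounded D f g C : measurable D -> mu.-integrable D (EFin \o f) ->
  measurable_fun D g -> (forall x, D x -> `|g x| <= C) ->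
  mu.-integrable D (fun x => (f x * g x)%:E).
Proof.
move=> mD intf mg gC.
have mf : measurable_fun D f by apply/measurable_EFinP; exact: measurable_int intf.
apply: (@integrable_le D (f \* g) (fun x => C * `|f x|)) => //.
- rewrite (_ : EFin \o _ = fun x => C%:E * `|(EFin \o f) x|)%E; last by apply/funext.
  by apply: integrableZl => //; exact: integrable_abse.
- exact: measurable_funM.
- by move=> x Dx; rewrite /= normrM mulrC ler_wpM2r// gC.
Qed.

Lemma ae_le_Rintegral D f g : measurable D ->
  mu.-integrable D (EFin \o f) -> mu.-integrable D (EFin \o g) ->
  {ae mu, forall x, D x -> f x <= g x} ->
  \int[mu]_(x in D) f x <= \int[mu]_(x in D) g x.
Proof.
move=> mD intf intg fg; rewrite -subr_ge0 -RintegralB//.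
have igf : mu.-integrable D (EFin \o (g \- f)) by exact: (integrableB mD intg intf).
(* The difference is nonnegative only almost everywhere; its absolute value has the same integral
   and is nonnegative everywhere. *)
have -> : \int[mu]_(x in D) (g x - f x) = \int[mu]_(x in D) `|g x - f x|.
  congr fine; apply: ae_eq_integral => //.
  - exact: measurable_int igf.
  - by have := measurable_int _ (integrable_abse igf).
  - by apply: filterS fg => x h Dx /=; rewrite ger0_norm// subr_ge0 h.
exact: Rintegral_ge0.
Qed.

Lemma dominated_cvg_EFin D (f_ : nat -> T -> R) f g : measurable D ->
  (forall k, measurable_fun D (f_ k)) -> mu.-integrable D (EFin \o g) ->
  (forall k x, D x -> `|f_ k x| <= g x) ->
  (forall x, D x -> f_ ^~ x @ \oo --> f x) ->
  mu.-integrable D (EFin \o f) /\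
  (\int[mu]_(x in D) (f_ k x)%:E @[k --> \oo] --> \int[mu]_(x in D) (f x)%:E)%E.
Proof.
move=> mD mf_ intg fg cf.
have mf : measurable_fun D f by apply: (measurable_fun_cvg (h := f_)).
have c1 : {ae mu, forall x, D x -> (EFin \o f_ ^~ x) @ \oo --> (EFin \o f) x}.
  apply: aeW => x Dx; apply: cvg_EFin; last exact: cf.
  by apply: nearW => k.
have b1 : {ae mu, forall x k, D x -> (`|(EFin \o f_ k) x| <= (EFin \o g) x)%E}.
  by apply: aeW => x k Dx /=; rewrite lee_fin fg.
have m1 k : measurable_fun D (EFin \o f_ k) by exact/measurable_EFinP.
have m2 : measurable_fun D (EFin \o f) by exact/measurable_EFinP.
by have [] := dominated_convergence mD m1 m2 c1 intg b1.
Qed.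

Lemma dominated_cvg_Rintegral D (f_ : nat -> T -> R) f g : measurable D ->
  (forall k, measurable_fun D (f_ k)) -> mu.-integrable D (EFin \o g) ->
  (forall k x, D x -> `|f_ k x| <= g x) ->
  (forall x, D x -> f_ ^~ x @ \oo --> f x) ->
  \int[mu]_(x in D) f_ k x @[k --> \oo] --> \int[mu]_(x in D) f x.
Proof.
move=> mD mf_ intg fg cf.
have [intf cvf] := dominated_cvg_EFin mD mf_ intg fg cf.
apply: fine_cvg; rewrite fineK; last exact: integrable_fin_num.
exact: cvf.
Qed.

Lemma integrable_indic_fin (A : set T) : measurable A -> (mu A < +oo)%E ->
  mu.-integrable setT (EFin \o (\1_A : T -> R)).
Proof.
move=> mA fA; apply/integrableP; split; first exact/measurable_EFinP/measurable_indic.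
rewrite (eq_integral (fun x => (\1_A x)%:E)) => [|x _]; last by rewrite /= ger0_norm.
by rewrite integral_indic// setIT.
Qed.

Lemma integrable_cst_fin (D : set T) k : measurable D -> (mu D < +oo)%E ->
  mu.-integrable D (EFin \o cst k).
Proof.
move=> mD fD; apply/integrableP; split; first exact/measurable_EFinP.
under eq_integral do rewrite /=.
by rewrite integral_cst// lte_mul_pinfty// lee_fin.
Qed.

Lemma ae_eq0_measure0 (A : set T) (P : set T) : measurable A ->
  {ae mu, forall x, P x} -> A `<=` ~` P -> mu A = 0%E.
Proof.
move=> mA aeP AP; apply: measure_negligible => //.
by apply: negligibleS aeP => x /AP.
Qed.

End integrable_bounded.

Section bump_integral.
Context {R : realType} {n : nat}.
Local Notation leb := (lebesgue_rV R n).

Lemma bump_continuous (phi : 'rV[R]_n -> R) : bump_algebra phi -> continuous phi.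
Proof. by move=> h x; apply: differentiable_continuous; exact: bump_differentiable. Qed.

Lemma bump_measurable (phi : 'rV[R]_n -> R) : bump_algebra phi -> measurable_fun setT phi.
Proof. by move=> /bump_continuous; exact: continuous_measurable_rV. Qed.

Lemma integrable_box_bump (a b : 'rV[R]_n) (m : R) : 0 < m ->
  leb.-integrable setT (EFin \o box_bump a b m).
Proof.
move=> m0; apply: (@integrable_le _ _ _ _ _ _ (\1_(open_box a b))) => //.
- apply: integrable_indic_fin; first exact: measurable_open_box.
  exact: lebesgue_open_box_fin.
- by apply: bump_measurable; exact: box_bump_algebra.
- move=> x _; rewrite ger0_norm ?box_bump_ge0// indicE.
  have [xab|xab] := pselect (open_box a b x); first by rewrite mem_set// box_bump_le1.
  by rewrite box_bump_eq0// ler0n.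
Qed.

Lemma box_bump_integral_gt0 (a b : 'rV[R]_n) (m : R) : 0 < m -> (forall i, a 0 i < b 0 i) ->
  0 < \int[leb]_x box_bump a b m x.
Proof.
move=> m0 ab; rewrite lt_neqAle Rintegral_ge0 ?andbT; last by move=> x _; exact: box_bump_ge0.
apply/eqP => /esym h.
have ib := integrable_box_bump a b m0.
have fb := integrable_fin_num measurableT ib.
have : (\int[leb]_x `|(box_bump a b m x)%:E| = 0)%E.
  rewrite -[RHS]/(0%R%:E) -h fineK//; apply: eq_integral => x _.
  by rewrite /= ger0_norm// box_bump_ge0.
move=> /(ae_eq_integral_abs leb measurableT (measurable_int _ ib)).1 /= ae0.
have := lebesgue_open_box_gt0 ab.
rewrite (ae_eq0_measure0 (measurable_open_box a b) ae0) ?ltxx// => x xab /(_ I) /= [].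
by move=> h0; have := box_bump_gt0 m0 xab; rewrite h0 ltxx.
Qed.

(** If g x0 > 0, then g > g x0 / 2 on a ball around x0. This ball is a box, and the bump of the box
    contradicts the hypothesis. *)
Lemma le0_of_bump_integral (g : 'rV[R]_n -> R) (B : R) : continuous g ->
  (forall x, `|g x| <= B) ->
  (forall a b, \int[leb]_x (g x * box_bump a b 1 x) <= 0) -> forall x, g x <= 0.
Proof.
move=> cg gB hg x0; rewrite leNgt; apply/negP => gx0.
have /nbhs_ballP[e /= e0 he] : \forall y \near x0, g x0 / 2 < g y.
  by apply: (cvgr_gt (g x0) (cg x0)); rewrite ltr_pdivrMr// ltr_pMr// ltr1n.
have := hg (\row_i (x0 0 i - e)) (\row_i (x0 0 i + e)).
set a := \row_i _; set b := \row_i _; apply/negP; rewrite -ltNge.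
have i1 : leb.-integrable setT (EFin \o (fun x => g x0 / 2 * box_bump a b 1 x)).
  rewrite (_ : EFin \o _ = fun x => (g x0 / 2)%:E * (EFin \o box_bump a b 1) x)%E//.
  by apply: integrableZl => //; exact: integrable_box_bump.
apply: (@lt_le_trans _ _ (\int[leb]_x (g x0 / 2 * box_bump a b 1 x))).
  rewrite RintegralZl//; last exact: integrable_box_bump.
  rewrite mulr_gt0 ?divr_gt0// box_bump_integral_gt0// => i.
  by rewrite !mxE ltrD2l gtrN.
apply: le_Rintegral => //.
  rewrite (_ : EFin \o _ = fun x => (box_bump a b 1 x * g x)%:E).
    apply: (@integrable_mul_bounded _ _ _ _ _ _ _ B) => //.
      exact: integrable_box_bump.
    exact: continuous_measurable_rV.
  by apply/funext => x /=; rewrite mulrC.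
move=> x _; have [xab|xab] := pselect (open_box a b x); last first.
  by rewrite box_bump_eq0// !mulr0.
rewrite ler_wpM2r ?box_bump_ge0// ltW//; apply: he.
by move: xab; rewrite /a /b -ball_open_box.
Qed.

End bump_integral.

(** * Weak gradients and difference quotients *)

Section line_derivative.
Context {R : realType} {n : nat}.
Implicit Types (phi : 'rV[R]_n -> R) (x v w : 'rV[R]_n).

Lemma is_derive_line phi x v t : differentiable phi (x + t *: v) ->
  is_derive t (1 : R) (fun t => phi (x + t *: v)) ('D_v phi (x + t *: v)).
Proof.
move=> /(diff_derivable (v := v)) dphi.
set f := fun t : R => _.
have FE : (fun h => h^-1 *: ((phi \o shift (x + t *: v)) (h *: v) - phi (x + t *: v)))
   = (fun h : R => h^-1 *: ((f \o shift t) (h *: 1) - f t)).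
  apply/funext => h /=; congr (_ *: (phi _ - _)).
  have -> : h *: (1 : R) = h by rewrite /GRing.scale /= mulr1.
  by rewrite /shift /= scalerDl addrCA.
by split; [move: dphi; rewrite /derivable FE|rewrite /derive FE].
Qed.

Lemma derive_shift_rV phi x v w : 'D_v (fun y => phi (y + w)) x = 'D_v phi (x + w).
Proof.
rewrite /derive (_ : (fun h : R => _) =
  (fun h : R => h^-1 *: ((phi \o shift (x + w)) (h *: v) - phi (x + w))))//.
by apply/funext => h /=; rewrite addrA.
Qed.

End line_derivative.

Section Rintegral_sum.
Context d (T : measurableType d) {R : realType} (mu : {measure set T -> \bar R}).

Lemma Rintegral_sum (I : Type) (s : seq I) (F : I -> T -> R) D : measurable D ->
  (forall i, mu.-integrable D (EFin \o F i)) ->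
  \int[mu]_(x in D) (\sum_(i <- s) F i x) = \sum_(i <- s) \int[mu]_(x in D) F i x.
Proof.
move=> mD iF; elim: s => [|i s IH].
  rewrite big_nil; under eq_Rintegral do rewrite big_nil.
  by rewrite Rintegral_cst// mul0r.
rewrite big_cons -IH -RintegralD//.
  by under eq_Rintegral do rewrite big_cons.
have : mu.-integrable D (fun x => \sum_(i <- s) (EFin \o F i) x)%E.
  by apply: integrable_sum => // j _.
by apply: eq_integrable => // x _; rewrite /= sumEFin.
Qed.

End Rintegral_sum.

(* Testing against the bump algebra only; unlike weak_gradient, this property is
   obviously stable under negation of both functions. *)
Definition bump_weak_gradient {R : realType} {n : nat} (u : 'rV[R]_n -> R)
    (G : 'rV[R]_n -> 'rV[R]_n) :=
  forall i phi, bump_algebra phi -> test_function phi ->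
    \int[lebesgue_rV R n]_x (u x * partial i phi x) =
    - \int[lebesgue_rV R n]_x (G x 0 i * phi x).

Section weak_gradient.
Context {R : realType} {n : nat}.
Local Notation leb := (lebesgue_rV R n).
Variables (u : 'rV[R]_n -> R) (G : 'rV[R]_n -> 'rV[R]_n) (L : R).
Hypothesis iu : leb.-integrable setT (EFin \o u).
Hypothesis lu : forall x y, `|u x - u y| <= L * `|x - y|.
Hypothesis wG : bump_weak_gradient u G.
Hypothesis iG : forall i, leb.-integrable setT (EFin \o (fun x => G x 0 i)).

Implicit Types (x xi v a b : 'rV[R]_n).

Lemma integrable_dotp xi : leb.-integrable setT (EFin \o (fun x => dotp (G x) xi)).
Proof.
have : leb.-integrable setT (fun x => \sum_i ((xi 0%R i)%:E * (EFin \o (fun x => G x 0 i)%R) x))%E.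
  by apply: integrable_sum => // i _; exact: integrableZl.
apply: eq_integrable => // x _; rewrite /= /dotp -sumEFin.
by apply: eq_bigr => i _; rewrite /= -EFinM mulrC.
Qed.

Lemma continuous_lip : continuous u.
Proof.
move=> x; apply/(@cvgrPdist_lt _ _ _ (nbhs x) (nbhs_filter x)) => e e0; apply/nbhs_ballP.
exists (e / (`|L| + 1)); first by rewrite /= divr_gt0// ltr_wpDl.
move=> y; rewrite -ball_normE /= ltr_pdivlMr ?ltr_wpDl// => xy.
apply: le_lt_trans (lu _ _) _; apply: le_lt_trans xy; rewrite mulrC.
by rewrite ler_wpM2l// (le_trans (ler_norm _))// lerDl.
Qed.

(** On the unit ball around x the function |u| is at least |u x| - |L|. Integrating over the ball,
    whose measure does not depend on x, bounds this number by the L^1 norm of u over that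
    measure. *)
Lemma bounded_lip : exists2 B, 0 <= B & forall x, `|u x| <= B.
Proof.
have L0 : L <= `|L| by exact: ler_norm.
have nu := measurable_int _ iu.
set c := leb (ball 0 1); have c0 : (0 < c)%E by exact: lebesgue_ball_gt0.
have cfin : c \is a fin_num by rewrite ge0_fin_numE ?(ltW c0)//; exact: lebesgue_ball_fin.
set I := (\int[leb]_x `|(u x)%:E|)%E.
have Ifin : I \is a fin_num.
  by rewrite ge0_fin_numE ?integral_ge0//; have /integrableP[] := iu.
have I0 : (0 <= I)%E by exact: integral_ge0.
exists (`|L| + fine I / fine c).
  by rewrite addr_ge0// divr_ge0// fine_ge0// ltW.
move=> x; rewrite -lerBlDl ler_pdivlMr ?fine_gt0//; last first.
  by rewrite c0/= -ge0_fin_numE ?ltW.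
rewrite -lee_fin EFinM !fineK//.
have [xL|xL] := leP (`|u x| - `|L|) 0.
  by apply: le_trans I0; apply: mule_le0_ge0 => //; exact: ltW.
rewrite /c (lebesgue_ball 0 x ltr01).
rewrite -integral_cst; last exact: measurable_ball_rV.
apply: (@le_trans _ _ (\int[leb]_(y in ball x 1%R) `|(u y)%:E|)%E).
  apply: ge0_le_integral => //.
  - exact: measurable_ball_rV.
  - by move=> y _; rewrite /= lee_fin ltW.
  - by apply: measurableT_comp => //; exact: measurable_funS nu.
  - move=> y; rewrite -ball_normE /= lee_fin => xy.
    rewrite lerBlDl -lerBlDr; apply: le_trans (lerB_dist _ _) _.
    apply: le_trans (lu _ _) _.
    by rewrite (le_trans (ler_wpM2r _ L0))// ler_piMr// ltW.
apply: ge0_subset_integral => //; first exact: measurable_ball_rV.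
exact: measurableT_comp.
Qed.

Lemma integrable_mul_bump (g phi : 'rV[R]_n -> R) : leb.-integrable setT (EFin \o g) ->
  bump_algebra phi -> leb.-integrable setT (EFin \o (g \* phi)).
Proof.
move=> ig bphi; have [C hC] := bump_bounded bphi.
by apply: (@integrable_mul_bounded _ _ _ _ _ _ _ C) => //; exact: bump_measurable.
Qed.

Lemma weak_gradient_dir phi xi : bump_algebra phi -> test_function phi ->
  \int[leb]_x (u x * 'D_xi phi x) = - \int[leb]_x (dotp (G x) xi * phi x).
Proof.
move=> bphi tphi.
transitivity (\int[leb]_x \sum_i (xi 0 i * (u \* partial i phi) x)).
  apply: eq_Rintegral => x _; rewrite bump_derive// mulr_sumr.
  by apply: eq_bigr => i _; rewrite mulrCA.
have iup i : leb.-integrable setT (EFin \o (u \* partial i phi)).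
  by apply: integrable_mul_bump => //; exact: bump_partial.
have iGp i : leb.-integrable setT (EFin \o ((fun x => G x 0 i) \* phi)).
  exact: integrable_mul_bump.
rewrite Rintegral_sum//; last first.
  move=> i; rewrite (_ : EFin \o _ = fun x => (xi 0%R i)%:E * (EFin \o (u \* partial i phi)%R) x)%E.
    exact: integrableZl.
  by apply/funext.
transitivity (- \int[leb]_x \sum_i (xi 0 i * ((fun x => G x 0 i) \* phi) x)); last first.
  congr (- _); apply: eq_Rintegral => x _; rewrite /dotp mulr_suml.
  by apply: eq_bigr => i _; rewrite /= mulrCA mulrA.
rewrite Rintegral_sum//; last first.
  move=> i; rewrite (_ : EFin \o _ = fun x => (xi 0%R i)%:E * (EFin \o ((fun x => G x 0 i) \* phi)%R) x)%E.
    exact: integrableZl.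
  by apply/funext.
rewrite -sumrN; apply: eq_bigr => i _; rewrite !RintegralZl// -mulrN; congr (_ * _).
exact: wG.
Qed.

End weak_gradient.

Section difference_quotients.
Context {R : realType} {n : nat}.
Local Notation leb := (lebesgue_rV R n).
Variables (u : 'rV[R]_n -> R) (G : 'rV[R]_n -> 'rV[R]_n) (L : R).
Hypothesis iu : leb.-integrable setT (EFin \o u).
Hypothesis lu : forall x y, `|u x - u y| <= L * `|x - y|.
Hypothesis wG : bump_weak_gradient u G.
Hypothesis iG : forall i, leb.-integrable setT (EFin \o (fun x => G x 0 i)).

Implicit Types (x xi v a b : 'rV[R]_n).

Lemma integrable_shift_bump xi t phi : bump_algebra phi ->
  leb.-integrable setT (EFin \o (fun x => u (x + t *: xi) * phi x)).
Proof.
move=> bphi; have [C hC] := bump_bounded bphi.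
apply: (@integrable_mul_bounded _ _ _ _ _ (fun x => u (x + t *: xi)) _ C) => //.
  exact: (integrable_translation (t *: xi) iu).
exact: bump_measurable.
Qed.

Lemma Rintegral_shift_bump xi t phi : bump_algebra phi ->
  \int[leb]_x (u (x + t *: xi) * phi x) = \int[leb]_x (u x * phi (x + t *: - xi)).
Proof.
move=> bphi; rewrite -(Rintegral_translation (t *: - xi) (integrable_shift_bump xi t bphi)).
by apply: eq_Rintegral => x _; rewrite scalerN subrK.
Qed.

(** The shift is moved from u to the smooth function phi by translation invariance; then one
    differentiates under the integral sign and applies the weak formulation. *)
Lemma is_derive_Rintegral_shift xi t phi : bump_algebra phi ->
  (forall s, test_function (fun x => phi (x + s *: - xi))) ->
  is_derive t (1 : R) (fun t => \int[leb]_x (u (x + t *: xi) * phi x))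
    (\int[leb]_x (dotp (G x) xi * phi (x + t *: - xi))).
Proof.
move=> bphi tphi; under eq_fun do rewrite Rintegral_shift_bump//.
pose F (t : R) (x : 'rV[R]_n) := u x * phi (x + t *: - xi).
have dphi x : differentiable phi x by exact: bump_differentiable.
have dF s x : is_derive s (1 : R) (F ^~ x) (u x * 'D_(- xi) phi (x + s *: - xi)).
  have d := is_derive_line (dphi (x + s *: - xi)).
  exact: (@is_deriveZ _ _ _ _ (u x) _ _ _ d).
have bD : bump_algebra ('D_(- xi) phi).
  rewrite (_ : 'D_(- xi) phi = fun x => \sum_i (- xi) 0 i * partial i phi x); last first.
    by apply/funext => x; exact: bump_derive.
  elim: (index_enum _) => [|i s IH].
    rewrite (_ : (fun x : 'rV[R]_n => _) = cst 0); first exact: bump_cst.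
    by apply/funext => x; rewrite big_nil.
  rewrite (_ : (fun x : 'rV[R]_n => _) = cst ((- xi) 0 i) * partial i phi +
     (fun x => \sum_(i <- s) (- xi) 0 i * partial i phi x)).
    by apply: bump_add => //; apply: bump_mul; [exact: bump_cst|exact: bump_partial].
  by apply/funext => x; rewrite big_cons.
have [C hC] := bump_bounded bD.
have C0 : 0 <= C by apply: le_trans (hC 0); exact: normr_ge0.
have tI : [set` `]t - 1, t + 1[] t by rewrite /= in_itv /= ltrDl ltrBlDr ltrDl ltr01.
have intF s : [set` `]t - 1, t + 1[] s -> leb.-integrable setT (EFin \o F s).
  move=> _; apply: (integrable_mul_bump iu (phi := fun x => phi (x + s *: - xi))).
  exact: bump_shift.
(* A majorant that is uniform in the parameter: the directional derivative of phi is bounded by C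
   and u is integrable. *)
have intG : leb.-integrable setT (EFin \o (fun x => C * `|u x|)).
  rewrite (_ : EFin \o _ = fun x => C%:E * `|(EFin \o u) x|)%E; last by apply/funext.
  by apply: integrableZl => //; exact: integrable_abse.
have ubF s x : [set` `]t - 1, t + 1[] s -> setT x -> `|partial1of2 F s x| <= C * `|u x|.
  by move=> _ _; rewrite partial1of2E; have [_ ->] := dF s x; rewrite normrM mulrC ler_wpM2r.
have derF s x : [set` `]t - 1, t + 1[] s -> setT x -> derivable (F ^~ x) s 1.
  by move=> _ _; have [] := dF s x.
have G0 x : 0 <= C * `|u x| by rewrite mulr_ge0.
apply: DeriveDef; first exact: (derivable_under_integral measurableT tI intF derF G0 intG ubF).
rewrite -derive1E (differentiation_under_integral measurableT tI intF derF G0 intG ubF).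
transitivity (\int[leb]_x (u x * 'D_(- xi) (fun y => phi (y + t *: - xi)) x)).
  apply: eq_Rintegral => x _; rewrite partial1of2E derive_shift_rV.
  by have [_ ->] := dF t x.
(* Shifting phi produced the direction - xi; its sign cancels the one of the weak formulation. *)
rewrite (weak_gradient_dir iu wG iG); [|exact: bump_shift|exact: tphi].
have -> : \int[leb]_x (dotp (G x) (- xi) * phi (x + t *: - xi)) =
   - \int[leb]_x (dotp (G x) xi * phi (x + t *: - xi)); last by rewrite opprK.
rewrite -[RHS]mulN1r -RintegralZl//.
  apply: eq_Rintegral => x _; rewrite mulrA; congr (_ * _).
  by rewrite /dotp mulN1r -sumrN; apply: eq_bigr => i _; rewrite mxE mulrN.
apply: integrable_mul_bump; first exact: integrable_dotp.
exact: bump_shift.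
Qed.

Lemma box_bump_translate a b m t xi :
  (fun x => box_bump a b m (x + t *: - xi)) = box_bump (a + t *: xi) (b + t *: xi) m.
Proof. by apply/funext => x; rewrite box_bump_shift scalerN !opprK. Qed.

Lemma is_derive_box_bump a b m t xi : 0 < m ->
  is_derive t (1 : R) (fun t => \int[leb]_x (u (x + t *: xi) * box_bump a b m x))
    (\int[leb]_x (dotp (G x) xi * box_bump (a + t *: xi) (b + t *: xi) m x)).
Proof.
move=> m0; rewrite -box_bump_translate.
apply: is_derive_Rintegral_shift; first exact: box_bump_algebra.
by move=> s; rewrite box_bump_translate; exact: box_bump_test.
Qed.

(* The function [t |-> \int u (x + t xi) phi x dx] has slope at most [N \int phi]
   for every bump [phi]. *)
Lemma difference_le_of_ae xi N : {ae leb, forall x, dotp (G x) xi <= N} ->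
  forall x t, 0 <= t -> u (x + t *: xi) - u x <= t * N.
Proof.
move=> aeN x t t0.
have [->|tn0] := eqVneq t 0; first by rewrite scale0r addr0 subrr mul0r.
have tgt0 : 0 < t by rewrite lt_neqAle eq_sym tn0.
(* For fixed t the difference of the two sides is a bounded continuous function of x, so its sign
   can be tested against bumps. *)
rewrite -subr_le0; move: x.
have [B B0 uB] := bounded_lip iu lu.
apply: (@le0_of_bump_integral _ _ _ (B + B + `|t * N|)).
- have cu : continuous u by exact: continuous_lip lu.
  have cv : continuous (fun x => u (x + t *: xi)).
    by apply: (@continuous_lip _ _ _ L) => x y; apply: le_trans (lu _ _) _; rewrite opprD addrACA subrr addr0.
  move=> x; apply: (@continuousB _ _ _ (fun x => u (x + t *: xi) - u x) (cst (t * N)) x).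
    exact: (@continuousB _ _ _ (fun x => u (x + t *: xi)) u x (cv x) (cu x)).
  exact: cst_continuous.
- move=> x; apply: le_trans (ler_normB _ _) _; rewrite lerD2r.
  by apply: le_trans (ler_normB _ _) _; apply: lerD.
move=> a b; set phi := box_bump a b 1.
have bphi : bump_algebra phi by exact: box_bump_algebra.
have iphi : leb.-integrable setT (EFin \o phi) by exact: integrable_box_bump.
pose Phi s := \int[leb]_x (u (x + s *: xi) * phi x).
pose dPhi s := \int[leb]_x (dotp (G x) xi * box_bump (a + s *: xi) (b + s *: xi) 1 x).
have dP s : is_derive s (1 : R) Phi (dPhi s) by exact: is_derive_box_bump.
have dP_le s : dPhi s <= N * \int[leb]_x phi x.
  have -> : \int[leb]_x phi x = \int[leb]_x box_bump (a + s *: xi) (b + s *: xi) 1 x.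
    rewrite -(Rintegral_translation (s *: - xi) iphi); apply: eq_Rintegral => x _.
    by rewrite -box_bump_translate.
  have ib := integrable_box_bump (a + s *: xi) (b + s *: xi) (@ltr01 R).
  rewrite -RintegralZl//; apply: ae_le_Rintegral => //.
  - apply: integrable_mul_bump; first exact: integrable_dotp.
    exact: box_bump_algebra.
  - rewrite (_ : EFin \o _ = fun x => (N%:E * (EFin \o box_bump (a + s *: xi) (b + s *: xi) 1) x)%E)//.
    exact: integrableZl.
  - by apply: filterS aeN => x h _; rewrite ler_wpM2r// box_bump_ge0.
have [c _ hc] := @MVT R Phi dPhi 0 t tgt0 (fun s _ => dP s)
  (derivable_within_continuous (fun s _ => @ex_derive _ _ _ _ _ _ _ (dP s))).
have i1 : leb.-integrable setT (EFin \o (fun x => u (x + t *: xi) * phi x)).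
  exact: integrable_shift_bump.
have i2 : leb.-integrable setT (EFin \o (fun x => u x * phi x)) by exact: integrable_mul_bump.
have i3 : leb.-integrable setT (EFin \o (fun x => t * N * phi x)).
  rewrite (_ : EFin \o _ = fun x => ((t * N)%:E * (EFin \o phi) x)%E)//.
  exact: integrableZl.
have -> : \int[leb]_x ((u (x + t *: xi) - u x - t * N) * phi x) =
   Phi t - Phi 0 - t * N * \int[leb]_x phi x.
  rewrite -RintegralZl// /Phi.
  have -> : \int[leb]_x (u (x + 0 *: xi) * phi x) = \int[leb]_x (u x * phi x).
    by apply: eq_Rintegral => x _; rewrite scale0r addr0.
  rewrite -RintegralB// -RintegralB//.
    by apply: eq_Rintegral => x _; rewrite !mulrBl.
  exact: (integrableB measurableT i1 i2).
rewrite subr_le0 hc subr0 -mulrA mulrC ler_pM2l//.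
Qed.

End difference_quotients.

(** * Weak convergence of the difference quotients *)

Section difference_quotients_weak_limit.
Context {R : realType} {n : nat}.
Local Notation leb := (lebesgue_rV R n).
Variables (u : 'rV[R]_n -> R) (G : 'rV[R]_n -> 'rV[R]_n) (L : R).
Hypothesis iu : leb.-integrable setT (EFin \o u).
Hypothesis lu : forall x y, `|u x - u y| <= L * `|x - y|.
Hypothesis wG : bump_weak_gradient u G.
Hypothesis iG : forall i, leb.-integrable setT (EFin \o (fun x => G x 0 i)).
Variable xi : 'rV[R]_n.
Implicit Types (x v a b : 'rV[R]_n) (w g : 'rV[R]_n -> R) (A Q : set 'rV[R]_n).

Let dq (k : nat) x := k.+1%:R * (u (x + k.+1%:R^-1 *: xi) - u x).
Let dG x := dotp (G x) xi.

Let measurable_dq k : measurable_fun setT (dq k).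
Proof.
have mu : measurable_fun setT u by apply: continuous_measurable_rV; exact: continuous_lip lu.
apply: measurable_funM => //; apply: measurable_funB => //.
exact: (measurableT_comp mu (measurable_shift_rV _)).
Qed.

Let dq_le k x : `|dq k x| <= L * `|xi|.
Proof.
rewrite normrM gtr0_norm// mulrC -ler_pdivlMr//.
apply: le_trans (lu _ _) _; rewrite addrAC subrr add0r normrZ.
by rewrite gtr0_norm ?invr_gt0// mulrCA [leRHS]mulrC.
Qed.

Let integrable_dq_mul k w : leb.-integrable setT (EFin \o w) ->
  leb.-integrable setT (EFin \o (fun x => dq k x * w x)).
Proof.
move=> iw; rewrite (_ : EFin \o _ = fun x => (w x * dq k x)%:E).
  by apply: (integrable_mul_bounded (C := L * `|xi|)).
by apply/funext => x; rewrite /= mulrC.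
Qed.

(** The functions w against which the difference quotients converge weakly to <G, xi>. The next
    statements enlarge this class from bumps to boxes, and from boxes to bounded measurable sets. *)
Let test w := \int[leb]_x (dq k x * w x) @[k --> \oo] --> \int[leb]_x (dG x * w x).

(** This is the derivative at 0 of the integral of the shifted u against the bump, read along the
    steps 1 / (k + 1). *)
Let test_bump a b (m : R) : 0 < m -> test (box_bump a b m).
Proof.
move=> m0; have [d0 e0] := is_derive_box_bump iu wG iG a b 0 xi m0.
set Phi := fun t : R => _ in d0 e0.
have : h^-1 *: ((Phi \o shift 0) (h *: (1 : R)) - Phi 0) @[h --> 0^'] --> 'D_1 Phi 0 by exact: d0.
rewrite e0 scale0r !addr0.
move=> /cvgr_dnbhsP /(_ (fun k => k.+1%:R^-1)) H.
have {}H := H (conj (fun k => invr_neq0 (lt0r_neq0 (ltr0Sn R k))) (@cvg_harmonic R)).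
apply: cvg_trans H; apply: near_eq_cvg; apply: nearW => k /=.
have ib := integrable_box_bump a b m0; have bb := box_bump_algebra a b m.
rewrite /Phi /shift /= addr0 [_ *: (1 : R)]mulr1 invrK.
have -> : \int[leb]_x (u (x + 0 *: xi) * box_bump a b m x) = \int[leb]_x (u x * box_bump a b m x).
  by apply: eq_Rintegral => x _; rewrite scale0r addr0.
have i1 := integrable_shift_bump iu xi k.+1%:R^-1 bb.
have i2 := integrable_mul_bump iu bb.
rewrite -RintegralB// /GRing.scale /= -RintegralZl//; last exact: (integrableB _ i1 i2).
by apply: eq_Rintegral => x _; rewrite /dq -mulrBl mulrA.
Qed.

(** A three-epsilon argument. The quotients are bounded by L |xi| for all k, so exchanging w_j and w
    costs at most L |xi| times the L^1 distance, uniformly in k; on the side of the limit, |<G, xi>|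
    is an integrable majorant. *)
Let test_limit g (w_ : nat -> 'rV[R]_n -> R) w : leb.-integrable setT (EFin \o g) -> (forall x, g x <= 1) ->
  (forall j, measurable_fun setT (w_ j)) -> (forall j x, `|w_ j x| <= g x) ->
  (forall x, w_ ^~ x @ \oo --> w x) -> (forall j, test (w_ j)) -> test w.
Proof.
move=> ig g1 mw wg cw tw.
have mw' : measurable_fun setT w by apply: (measurable_fun_cvg (h := w_)).
have wg' x : `|w x| <= g x.
  have cn : `|w_ j x| @[j --> \oo] --> `|w x| by apply: cvg_norm; exact: cw.
  have <- : limn (fun j => `|w_ j x|) = `|w x| by exact: cvg_lim cn.
  by apply: limr_le; [exact: cvgP cn|apply: nearW].
have g0 x : 0 <= g x by apply: le_trans (wg' x).
have iw : leb.-integrable setT (EFin \o w) by apply: (integrable_le _ ig).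
have iw_ j : leb.-integrable setT (EFin \o w_ j) by apply: (integrable_le _ ig).
have idG : leb.-integrable setT (EFin \o dG) by exact: integrable_dotp.
have mdG : measurable_fun setT dG by apply/measurable_EFinP; exact: measurable_int idG.
have c1 : \int[leb]_x `|w_ j x - w x| @[j --> \oo] --> 0.
  have -> : 0 = \int[leb]_x (cst 0 x : R) :> R by rewrite Rintegral_cst// mul0r.
  apply: (@dominated_cvg_Rintegral _ _ _ _ _ _ _ (fun x => 2 * g x)) => //.
  - by move=> k; apply: measurableT_comp => //; exact: measurable_funB.
  - rewrite (_ : EFin \o _ = fun x => (2%:E * (EFin \o g) x)%E)//; exact: integrableZl.
  - move=> k x _; rewrite normr_id mulr_natl mulr2n.
    by apply: le_trans (ler_normB _ _) _; apply: lerD.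
  - move=> x _; rewrite -(normr0 R) -(subrr (w x)); apply: cvg_norm.
    by apply: cvgB; [exact: cw|exact: cvg_cst].
have c2 : \int[leb]_x (dG x * w_ j x) @[j --> \oo] --> \int[leb]_x (dG x * w x).
  apply: (@dominated_cvg_Rintegral _ _ _ _ _ _ _ (fun x => `|dG x|)) => //.
  - by move=> k; exact: measurable_funM.
  - exact: integrable_abse idG.
  - by move=> k x _; rewrite normrM ler_piMr// (le_trans (wg k x)).
  - by move=> x _; apply: cvgMr; exact: cw.
apply/cvgrPdist_le => e e0.
have L0 : 0 <= L * `|xi| by apply: le_trans (dq_le 0 0).
have e3 : 0 < e / 3 by rewrite divr_gt0.
(* The summand 1 guards against L |xi| = 0. *)
have e4 : 0 < e / 3 / (L * `|xi| + 1) by rewrite divr_gt0// ltr_wpDl.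
near \oo => j.
have h1 : `|\int[leb]_x `|w_ j x - w x| | <= e / 3 / (L * `|xi| + 1).
  rewrite -[X in `|X|]subr0 distrC; near: j.
  by move/cvgrPdist_le : c1 => /(_ _ e4).
have h2 : `|\int[leb]_x (dG x * w x) - \int[leb]_x (dG x * w_ j x)| <= e / 3.
  by near: j; move/cvgrPdist_le : c2 => /(_ _ e3).
near=> k.
have h3 : `|\int[leb]_x (dG x * w_ j x) - \int[leb]_x (dq k x * w_ j x)| <= e / 3.
  by near: k; move/cvgrPdist_le : (tw j) => /(_ _ e3).
have h4 : `|\int[leb]_x (dq k x * w_ j x) - \int[leb]_x (dq k x * w x)| <= e / 3.
  rewrite -RintegralB//; [|exact: integrable_dq_mul|exact: integrable_dq_mul].
  have iB : leb.-integrable setT (EFin \o (fun x => w_ j x - w x)) by exact: (integrableB _ (iw_ j) iw).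
  have iBn : leb.-integrable setT (EFin \o (fun x => `|w_ j x - w x|)) by exact: integrable_abse iB.
  apply: (@le_trans _ _ (\int[leb]_x ((L * `|xi|) * `|w_ j x - w x|))).
    have E : (fun x => dq k x * w_ j x - dq k x * w x) = (fun x => dq k x * (w_ j x - w x)).
      by apply/funext => x; rewrite mulrBr.
    rewrite E; apply: le_trans (le_normr_Rintegral _ _) _ => //; first exact: integrable_dq_mul.
    apply: le_Rintegral => //.
    - exact: integrable_abse (integrable_dq_mul k iB).
    - rewrite (_ : EFin \o _ = fun x => ((L * `|xi|)%:E * (EFin \o (fun x => `|w_ j x - w x|)%R) x)%E)//.
      exact: integrableZl.
    - by move=> x _; rewrite normrM ler_wpM2r.
  rewrite RintegralZl//.
  apply: (@le_trans _ _ ((L * `|xi| + 1) * (e / 3 / (L * `|xi| + 1)))).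
    apply: ler_pM => //; first by apply: Rintegral_ge0 => x _.
      by rewrite lerDl.
    by apply: le_trans h1; exact: ler_norm.
  by rewrite mulrC divfK// gt_eqF// ltr_wpDl.
rewrite (_ : e = e / 3 + e / 3 + e / 3); last by field.
set a := \int[leb]_x (dG x * w x) in h2 *; set b := \int[leb]_x (dG x * w_ j x) in h2 h3.
set c := \int[leb]_x (dq k x * w_ j x) in h3 h4.
rewrite (_ : a - _ = (a - b) + (b - c) + (c - \int[leb]_x (dq k x * w x))); last by ring.
apply: le_trans (ler_normD _ _) _; apply: lerD => //.
by apply: le_trans (ler_normD _ _) _; apply: lerD.
Unshelve. all: by end_near. Qed.

Let test_box a b : test (\1_(open_box a b)).
Proof.
apply: (@test_limit (\1_(open_box a b)) (fun k => box_bump a b k.+1%:R)).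
- apply: integrable_indic_fin; first exact: measurable_open_box.
  exact: lebesgue_open_box_fin.
- by move=> x; rewrite indicE lern1 leq_b1.
- by move=> j; apply: bump_measurable; exact: box_bump_algebra.
- move=> j x; rewrite ger0_norm ?box_bump_ge0// indicE.
  have [xab|xab] := pselect (open_box a b x); first by rewrite mem_set// box_bump_le1.
  by rewrite box_bump_eq0// ler0n.
- by move=> x; exact: box_bump_cvg.
- by move=> j; exact: test_bump.
Qed.

Let integrable_dG_mul w : leb.-integrable setT (EFin \o w) -> (forall x, `|w x| <= 1) ->
  leb.-integrable setT (EFin \o (fun x => dG x * w x)).
Proof.
move=> iw w1; apply: (@integrable_mul_bounded _ _ _ _ _ dG w 1) => //.
  exact: integrable_dotp.
by apply/measurable_EFinP; exact: measurable_int iw.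
Qed.

Let testB w1 w2 : leb.-integrable setT (EFin \o w1) -> (forall x, `|w1 x| <= 1) ->
  leb.-integrable setT (EFin \o w2) -> (forall x, `|w2 x| <= 1) ->
  test w1 -> test w2 -> test (w1 \- w2).
Proof.
move=> i1 h1 i2 h2 t1 t2; rewrite /test.
have -> : \int[leb]_x (dG x * (w1 x - w2 x)) = \int[leb]_x (dG x * w1 x) - \int[leb]_x (dG x * w2 x).
  rewrite -RintegralB//; [|exact: integrable_dG_mul|exact: integrable_dG_mul].
  by apply: eq_Rintegral => x _; rewrite mulrBr.
rewrite (_ : (fun k => _) = fun k => \int[leb]_x (dq k x * w1 x) - \int[leb]_x (dq k x * w2 x)).
  exact: cvgB.
apply/funext => k; rewrite -RintegralB//; [|exact: integrable_dq_mul|exact: integrable_dq_mul].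
by apply: eq_Rintegral => x _; rewrite /= mulrBr.
Qed.

Let indic_le1 A x : `|\1_A x : R| <= 1.
Proof. by rewrite ger0_norm// indicE lern1 leq_b1. Qed.

(** Dynkin induction from boxes. The fixed box Q keeps all measures finite: complements within Q are
    differences, and disjoint unions are limits of partial sums dominated by the indicator of Q. *)
Let test_set a b A : measurable A -> test (\1_(A `&` open_box a b)).
Proof.
set Q := open_box a b.
have mQ : measurable Q by exact: measurable_open_box.
have iI B : measurable B -> leb.-integrable setT (EFin \o \1_(B `&` Q)).
  move=> mB; apply: integrable_indic_fin; first exact: measurableI.
  apply: le_lt_trans (lebesgue_open_box_fin a b).
  by apply: le_measure; rewrite ?inE//; exact: measurableI.
rewrite measurable_rVE; move: A.
apply: (@dynkin_induction _ _ _ (fun A => test (\1_(A `&` Q)))).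
- exact: measurable_rVE.
- by move=> _ _ [c [d ->]] [c' [d' ->]]; rewrite open_box_setI; do 2 eexists.
- by rewrite setTI; exact: test_box.
- by move=> _ [c [d ->]]; rewrite open_box_setI; exact: test_box.
- move=> S mS tS; rewrite (_ : \1_(~` S `&` Q) = (\1_Q \- \1_(S `&` Q) : _ -> R)).
    apply: testB => //; [|exact: iI|exact: test_box].
    by have := iI _ measurableT; rewrite setTI.
  apply/funext => x; rewrite /= !indicE !in_setI in_setC.
  by case: (x \in S); case: (x \in Q); rewrite /= ?subrr ?subr0.
- move=> F mF tF HF.
  (* By disjointness only the index k contributes at a point of F k, so the partial sum is 1 from j
     = k + 1 on. *)
  have FE j k x : F k x -> Q x -> (\sum_(i < j) \1_(F i `&` Q) x : R) = (k < j)%N%:R.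
    move=> Fkx Qx.
    have E i : \1_(F i `&` Q) x = (i == k)%:R :> R.
      rewrite indicE in_setI (mem_set Qx) andbT; congr (_%:R); congr nat_of_bool.
      apply/idP/eqP => [|->]; last exact: mem_set.
      by rewrite inE => Fix; apply: tF => //; exists x.
    have [kj|jk] := ltnP k j.
      rewrite (bigD1 (Ordinal kj))//= E eqxx big1 ?addr0// => i.
      by rewrite E -val_eqE /= => /negbTE ->.
    rewrite big1// => i _; rewrite E; case: eqP => // ik.
    by have := ltn_ord i; rewrite ik ltnNge jk.
  have F0 j x : ~ (\bigcup_k F k `&` Q) x -> (\sum_(i < j) \1_(F i `&` Q) x : R) = 0.
    move=> nx; rewrite big1// => i _; rewrite indicE memNset// => -[Fi Qx].
    by apply: nx; split => //; exists i.
  have mS j : measurable_fun setT (fun x => \sum_(i < j) (\1_(F i `&` Q) x : R)).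
    by apply: measurable_sum => i; apply: measurable_indic; exact: measurableI.
  have hS j x : `|\sum_(i < j) (\1_(F i `&` Q) x : R)| <= \1_Q x.
    rewrite indicE; have [[[k _ Fkx] Qx]|nx] := pselect ((\bigcup_k F k `&` Q) x).
      by rewrite (FE j k x Fkx Qx) (mem_set Qx) ger0_norm// ler_nat leq_b1.
    by rewrite F0// normr0 ler0n.
  have iQ : leb.-integrable setT (EFin \o \1_Q) by have := iI _ measurableT; rewrite setTI.
  have Q1 x : \1_Q x <= 1 :> R by rewrite indicE lern1 leq_b1.
  apply: (@test_limit (\1_Q) (fun j x => \sum_(i < j) (\1_(F i `&` Q) x : R))) => //.
  + move=> x; rewrite indicE.
    have [[[k _ Fkx] Qx]|nx] := pselect ((\bigcup_k F k `&` Q) x).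
      rewrite mem_set; last by split => //; exists k.
      apply: cvg_near_cst; near=> j; rewrite (FE j k x Fkx Qx).
      by near: j; exists k.+1 => // j /= ->.
    rewrite memNset//; apply: cvg_near_cst; apply: nearW => j; exact: F0.
  + elim=> [|j IH].
      (* [testB] offers differences only: the empty sum is written as 1_Q - 1_Q, and in the
         induction step an indicator is added by subtracting its negative, (1_Q - 1_Q) minus the
         indicator. *)
      rewrite (_ : (fun x => _) = (\1_Q \- \1_Q : _ -> R)).
        by apply: testB => //; exact: test_box.
      by apply/funext => x; rewrite big_ord0 /= subrr.
    rewrite (_ : (fun x => _) = ((fun x => \sum_(i < j) (\1_(F i `&` Q) x : R)) \-
      ((\1_Q \- \1_Q) \- \1_(F j `&` Q)))).
      have i0 : leb.-integrable setT (EFin \o (\1_Q \- \1_Q : _ -> R)) by exact: (integrableB _ iQ iQ).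
      have iF := iI _ (mF j).
      apply: testB => //.
      * exact: (integrable_le _ iQ).
      * by move=> x; apply: le_trans (Q1 x).
      * exact: (integrableB _ i0 iF).
      * by move=> x; rewrite /= subrr sub0r normrN.
      * apply: testB => //.
          by move=> x; rewrite /= subrr normr0.
        by apply: testB => //; exact: test_box.
    by apply/funext => x; rewrite big_ord_recr /= subrr sub0r opprK.
Unshelve. all: by end_near. Qed.

(** The quotients are at most N, hence so is their weak limit when tested on the part of {<G, xi> >
    N} in a box. There <G, xi> - N is positive with integral at most 0, so this part is a null set;
    countably many boxes exhaust the space. *)
Lemma ae_le_of_difference (N : R) : (forall x t, 0 < t -> u (x + t *: xi) - u x <= t * N) ->
  {ae leb, forall x, dotp (G x) xi <= N}.
Proof.
move=> uN.
have idG : leb.-integrable setT (EFin \o dG) by exact: integrable_dotp.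
have mdG : measurable_fun setT dG by apply/measurable_EFinP; exact: measurable_int idG.
pose Q k : set 'rV[R]_n := open_box (\row_(_ < n) - k%:R) (\row_(_ < n) k%:R).
pose B := [set x | N < dG x].
have mB : measurable B.
  rewrite -[B]setTI; have := mdG measurableT `]N, +oo[%classic (measurable_itv _).
  by congr (measurable (_ `&` _)); apply/seteqP; split => x /=; rewrite in_itv /= andbT.
have hk k : leb (B `&` Q k) = 0%E.
  have mBQ : measurable (B `&` Q k) by apply: measurableI => //; exact: measurable_open_box.
  have fBQ : (leb (B `&` Q k) < +oo)%E.
    apply: le_lt_trans (lebesgue_open_box_fin (\row_(_ < n) - k%:R) (\row_(_ < n) k%:R)).
    by apply: le_measure; rewrite ?inE//; exact: measurable_open_box.
  have iI : leb.-integrable setT (EFin \o \1_(B `&` Q k)) by exact: integrable_indic_fin.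
  have iNI : leb.-integrable setT (EFin \o (fun x => N * \1_(B `&` Q k) x)).
    rewrite (_ : EFin \o _ = fun x => (N%:E * (EFin \o \1_(B `&` Q k)) x)%E)//.
    exact: integrableZl.
  have idGI : leb.-integrable setT (EFin \o (fun x => dG x * \1_(B `&` Q k) x)).
    exact: integrable_dG_mul.
  have le1 : \int[leb]_x (dG x * \1_(B `&` Q k) x) <= \int[leb]_x (N * \1_(B `&` Q k) x).
    have c := test_set (a := \row_(_ < n) - k%:R) (b := \row_(_ < n) k%:R) mB.
    rewrite -(cvg_lim _ c)//; apply: limr_le; first exact: cvgP c.
    apply: nearW => j; apply: le_Rintegral => //; first exact: integrable_dq_mul.
    move=> x _; rewrite ler_wpM2r ?indicE ?ler0n// /dq mulrC -ler_pdivlMr// mulrC.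
    by apply: uN; rewrite invr_gt0.
  have h0 : (\int[leb]_x `|((dG x - N) * \1_(B `&` Q k) x)%:E| = 0)%E.
    have ge0 x : 0 <= (dG x - N) * \1_(B `&` Q k) x.
      rewrite indicE; have [[Bx Qx]|nx] := pselect ((B `&` Q k) x).
        by rewrite mem_set// mulr1 subr_ge0 ltW.
      by rewrite memNset// mulr0.
    have iBI : leb.-integrable setT (EFin \o (fun x => (dG x - N) * \1_(B `&` Q k) x)).
      rewrite (_ : EFin \o _ = ((EFin \o (fun x => dG x * \1_(B `&` Q k) x)%R) \-
        (EFin \o (fun x => N * \1_(B `&` Q k) x)%R))%E); first exact: integrableB.
      by apply/funext => x; rewrite /= mulrBl EFinB.
    rewrite (eq_integral (EFin \o (fun x => (dG x - N) * \1_(B `&` Q k) x))); last first.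
      by move=> x _; rewrite /= ger0_norm.
    rewrite -(fineK (integrable_fin_num measurableT iBI)); congr EFin.
    apply/eqP; rewrite eq_le; apply/andP; split; last by apply: Rintegral_ge0 => x _.
    rewrite -[leLHS]/(\int[leb]_x ((dG x - N) * \1_(B `&` Q k) x)).
    under eq_Rintegral do rewrite mulrBl.
    by rewrite RintegralB// subr_le0.
  have mI : measurable_fun setT (fun x => ((dG x - N) * \1_(B `&` Q k) x)%:E).
    apply/measurable_EFinP; apply: measurable_funM; first exact: measurable_funB.
    exact: measurable_indic.
  have ae0 := (ae_eq_integral_abs leb measurableT mI).1 h0.
  apply: (ae_eq0_measure0 mBQ ae0) => x [Bx Qx] /(_ I) /= [].
  rewrite indicE mem_set// mulr1 => /eqP; rewrite subr_eq0 => /eqP h.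
  by move: Bx; rewrite /B /= h ltxx.
have nB : leb.-negligible (\bigcup_k (B `&` Q k)).
  apply: negligible_bigcup => k; exists (B `&` Q k); split => //.
    by apply: measurableI => //; exact: measurable_open_box.
  exact: hk.
apply: negligibleS nB => x /= /negP; rewrite -ltNge => Bx.
have hx := archi_boundP (normr_ge0 x).
exists (Num.bound `|x|) => //; split => // i; rewrite !mxE -ltr_norml.
by apply: le_lt_trans hx; exact: normr_coord_le.
Qed.

End difference_quotients_weak_limit.

(** * Integrable Lipschitz functions increase somewhere in every direction *)

Section increase.
Context {R : realType} {n : nat}.
Local Notation leb := (lebesgue_rV R n).
Variables (u : 'rV[R]_n -> R) (L : R).
Hypothesis iu : leb.-integrable setT (EFin \o u).
Hypothesis lu : forall x y, `|u x - u y| <= L * `|x - y|.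

(* The integrals of |u| over the balls of fixed radius centered at x + k v tend to 0. *)
Lemma integrable_lip_ray (x v : 'rV[R]_n) (c : R) : v != 0 -> 0 < c ->
  exists k : nat, `|u (x + k%:R *: v)| < c.
Proof.
move=> v0 c0; apply: contrapT => /forallNP H.
have {}H k : c <= `|u (x + k%:R *: v)| by rewrite leNgt; apply/negP; exact: H.
(* On a ball of radius d the function changes by at most c / 2, so |u| >= c / 2 on all the balls
   [B k] if the claim fails. *)
pose d := c / 2 / (`|L| + 1).
have d0 : 0 < d by rewrite !divr_gt0// ltr_wpDl.
pose B k := ball (x + k%:R *: v) d.
have mB k : measurable (B k) by exact: measurable_ball_rV.
have fB k : (leb (B k) < +oo)%E by exact: (lebesgue_ball_fin _ d0).
have iB k : leb.-integrable setT (EFin \o \1_(B k)) by exact: (integrable_indic_fin (mB k) (fB k)).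
have mu : measurable_fun setT u by apply/measurable_EFinP; exact: measurable_int iu.
have c1 : \int[leb]_y (`|u y| * \1_(B k) y) @[k --> \oo] --> 0.
  have -> : 0 = \int[leb]_y (cst 0 y : R) :> R by rewrite Rintegral_cst// mul0r.
  apply: (@dominated_cvg_Rintegral _ _ _ _ _ _ _ (fun y => `|u y|)) => //.
  - move=> k; apply: measurable_funM; first exact: measurableT_comp.
    exact: measurable_indic.
  - exact: integrable_abse iu.
  - move=> k y _; rewrite normrM normr_id ler_piMr//.
    by rewrite ger0_norm// indicE lern1 leq_b1.
  (* The balls travel to infinity along v, so a given y lies in finitely many of them. *)
  - move=> y _; apply: cvg_near_cst; near=> k.
    rewrite indicE memNset ?mulr0// /B -ball_normE /= => h.
    have : `|k%:R *: v| < d + `|y - x|.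
      have := ler_distD y (x + k%:R *: v) x; rewrite [x + _]addrC addrK => /le_lt_trans; apply.
      by rewrite ltrD2r [_ + x]addrC.
    rewrite normrZ normr_nat -ltr_pdivlMr ?normr_gt0//; apply/negP; rewrite -leNgt.
    by near: k; exact: nbhs_infty_ger.
have lB k : fine (leb (B k)) = fine (leb (B 0%N)) by rewrite /B (lebesgue_ball _ (x + 0%:R *: v)).
have B0 : 0 < fine (leb (B 0%N)).
  by rewrite fine_gt0//; apply/andP; split; [exact: (lebesgue_ball_gt0 _ d0)|exact: fB].
have e0 : 0 < c / 2 * fine (leb (B 0%N)) by rewrite mulr_gt0// divr_gt0.
move/cvgrPdist_lt : c1 => /(_ _ e0)[N _ /(_ N (leqnn N))].
rewrite sub0r normrN; apply/negP; rewrite -leNgt.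
apply: le_trans (ler_norm _).
have -> : c / 2 * fine (leb (B 0%N)) = \int[leb]_y (c / 2 * \1_(B N) y).
  rewrite RintegralZl// -(lB N); congr (_ * _).
  by rewrite /Rintegral integral_indic// setIT.
apply: le_Rintegral => //.
- rewrite (_ : EFin \o _ = fun y => ((c / 2)%:E * (EFin \o \1_(B N)) y)%E)//.
  exact: integrableZl.
- apply: (@integrable_mul_bounded _ _ _ _ _ (fun y => `|u y|) (\1_(B N)) 1) => //.
    exact: integrable_abse iu.
  by move=> y _; rewrite ger0_norm// indicE lern1 leq_b1.
move=> y _; rewrite indicE; have [yB|yB] := pselect (B N y); last first.
  by rewrite memNset// !mulr0.
rewrite mem_set// !mulr1.
have h1 : `|u (x + N%:R *: v)| - `|u y| <= c / 2.
  apply: le_trans (lerB_dist _ _) _; apply: le_trans (lu _ _) _.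
  move: yB; rewrite /B -ball_normE /= ltr_pdivlMr ?ltr_wpDl// => yB.
  apply: le_trans (ltW yB); rewrite mulrC ler_wpM2l//.
  by rewrite (le_trans (ler_norm _))// lerDl.
have h2 := H N; lra.
Unshelve. all: by end_near. Qed.

(* Otherwise u is nonincreasing on every line directed by xi, hence |u| does not
   tend to 0 along one of the two half-lines from a point where u <> 0. *)
Lemma exists_increase (xi : 'rV[R]_n) : xi != 0 -> (exists x, u x != 0) ->
  exists x t, 0 < t /\ u x < u (x + t *: xi).
Proof.
move=> xi0 [x0 ux0]; apply: contrapT => H.
have {}H x t : 0 < t -> u (x + t *: xi) <= u x.
  by move=> t0; rewrite leNgt; apply/negP => h; apply: H; exists x, t.
have {}H x (k : nat) : u (x + k%:R *: xi) <= u x.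
  by case: k => [|k]; [rewrite scale0r addr0|apply: H].
have c0 : 0 < `|u x0| by rewrite normr_gt0.
have [u0|u0] := ltP 0 (u x0).
  have nxi0 : - xi != 0 by rewrite oppr_eq0.
  have [k] := integrable_lip_ray x0 nxi0 c0.
  apply/negP; rewrite -leNgt gtr0_norm//; apply: le_trans (ler_norm _).
  by have := H (x0 + k%:R *: - xi) k; rewrite scalerN subrK.
have [k] := integrable_lip_ray x0 xi0 c0.
apply/negP; rewrite -leNgt ler0_norm// -[`|u (_ + _)|]normrN; apply: le_trans (ler_norm _).
by rewrite lerN2.
Qed.

End increase.

(** * Gauges on the sphere *)

Section sphere.
Context {R : realType} {n : nat}.
Implicit Types x : 'rV[R]_n.
Local Notation S := (@sphere R n).

Lemma coord_le_enorm x i : `|x 0 i| <= enorm x.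
Proof.
rewrite /enorm -sqrtr_sqr ler_sqrt; last first.
  by apply: sumr_ge0 => j _; rewrite -expr2 sqr_ge0.
rewrite /dotp (bigD1 i)//= -expr2 lerDl.
by apply: sumr_ge0 => j _; rewrite -expr2 sqr_ge0.
Qed.

Lemma enorm_ge0 x : 0 <= enorm x. Proof. exact: sqrtr_ge0. Qed.

Lemma norm_le_enorm x : `|x| <= enorm x.
Proof.
rewrite [in X in X <= _]/Num.norm /= mx_normrE; apply/bigmax_leP; split.
  exact: enorm_ge0.
by move=> [i j] _ /=; rewrite ord1; exact: coord_le_enorm.
Qed.

Lemma sphere_norm_le1 x : S x -> `|x| <= 1.
Proof. by rewrite /sphere /= => <-; exact: norm_le_enorm. Qed.

Lemma sphere_neq0 x : S x -> x != 0.
Proof.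
apply: contraPneq => ->; rewrite /sphere /enorm /dotp /= big1 => [|i _].
  by rewrite sqrtr0 => /esym/eqP; rewrite oner_eq0.
by rewrite mxE mulr0.
Qed.

Lemma continuous_enorm : continuous (@enorm R n).
Proof.
move=> x; apply: continuous_comp; last exact: sqrt_continuous.
rewrite /dotp.
apply: (@cvg_big R 'I_n +%R 0 xpredT add_continuous _ (nbhs x) _ _ _ (nbhs_filter x)) => i _.
by apply: (@cvgM _ _ _ (nbhs_filter x)); exact: coord_continuous.
Qed.

Lemma closed_sphere : closed S.
Proof.
rewrite (_ : S = enorm @^-1` [set 1])//; apply: closed_comp; last exact: closed_eq.
by move=> x _; exact: continuous_enorm.
Qed.

Lemma measurable_sphere : measurable S.
Proof.
have oS : open (~` S) by apply: closed_openC; exact: closed_sphere.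
by rewrite -[S]setCK; apply: measurableC; exact: open_measurable_rV.
Qed.

Lemma compact_sphere : compact S.
Proof.
apply: bounded_closed_compact; last exact: closed_sphere.
exists 1; split; first exact: num_real.
by move=> y y1 x /sphere_norm_le1 /= h; apply: le_trans (ltW y1).
Qed.

(** Compactness in the form of near coverings, with constants tending to 0 from the right. This form
    is why P has to be inherited by smaller constants: then a local constant c serves all small
    ones. *)
Lemma sphere_uniform (P : R -> 'rV[R]_n -> Prop) :
  (forall c d x, 0 < c -> c <= d -> P d x -> P c x) ->
  (forall x, S x -> exists2 c, 0 < c & \forall y \near x, P c y) ->
  exists2 c, 0 < c & forall x, S x -> P c x.
Proof.
move=> anti loc.
have /compact_near_coveringP nc := compact_sphere.
have H : \forall c \near (0 : R)^'+, S `<=` P c.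
  apply: nc => x /loc [c c0 hc].
  exists ([set y | P c y], [set d | 0 < d <= c]) => /=.
    split => //; near=> d; apply/andP; split; first by near: d; exact: nbhs_right_gt.
    by near: d; exact: nbhs_right_le.
  by move=> [y d] /= [Py /andP[d0 dc]]; exact: anti Py.
have : \forall c \near (0 : R)^'+, 0 < c /\ S `<=` P c.
  by near=> c; split; [near: c; exact: nbhs_right_gt|near: c].
by move=> /filter_ex[c [c0 hc]]; exists c.
Unshelve. all: by end_near. Qed.

Lemma surface_measure_fin (A : set 'rV[R]_n) : measurable A -> (surface_measure A < +oo)%E.
Proof.
move=> mA; rewrite /surface_measure /mscale /= /pushforward /mrestr.
have ub : (lebesgue_rV R n unit_ball < +oo)%E.
  apply: lebesgue_bounded_fin; first exact: measurable_unit_ball.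
  exists 1; split; first exact: num_real.
  by move=> y y1 x /= h; apply: le_trans (norm_le_enorm x) _; apply: le_trans h (ltW y1).
apply: lte_mul_pinfty => //.
apply: le_lt_trans ub; apply: le_measure; rewrite ?inE//.
- apply: measurableI; last exact: measurable_unit_ball.
  by rewrite -[X in measurable X]setTI; exact: measurable_normalize.
- exact: measurable_unit_ball.
Qed.

End sphere.

Section gauge_lemmas.
Context {R : realType} {n : nat}.
Implicit Types (x : 'rV[R]_n) (K : set 'rV[R]_n).
Local Notation S := (@sphere R n).
Local Open Scope ereal_scope.

Lemma gauge_ge0 K x : 0 <= gauge K x.
Proof. by apply: le_ereal_inf_tmp => _ [l [/= l0 _] <-]; rewrite lee_fin ltW. Qed.

(** By homogeneity, x lies in l K exactly if g x <= l. This identifies the gauges of all the bodies,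
    defined as sublevel sets, with the prescribed functions. *)
Lemma gauge_sublevel (g : 'rV[R]_n -> \bar R) x :
  (forall y (l : R), (0 < l)%R -> g (l *: y)%R = l%:E * g y) -> 0 <= g x ->
  gauge [set y | g y <= 1] x = g x.
Proof.
move=> hom gx0.
have E (l : R) : (0 < l)%R ->
    [set (l *: y)%R | y in [set y | g y <= 1]] x <-> g x <= l%:E.
  move=> l0; split => [[y /= gy <-]|gxl].
    by rewrite hom// -[leRHS]mule1 lee_pmul2l.
  exists (l^-1 *: x)%R; last by rewrite scalerA divff ?gt_eqF// scale1r.
  by rewrite /= hom ?invr_gt0// lee_pdivrMl// mule1.
apply/eqP; rewrite eq_le; apply/andP; split; last first.
  by apply: le_ereal_inf_tmp => _ [l [/= l0 /E h] <-]; exact: h.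
case gxE : (g x) gx0 => [r| |]; [|by move=> _; rewrite leey|by []].
(* The value r may be 0 whereas only l > 0 is admissible, hence the detour through r + e. *)
rewrite lee_fin => r0; apply/lee_addgt0Pr => e e0.
apply: ereal_inf_lbound; exists (r + e)%R => //=; split; first by rewrite ltr_wpDl.
by apply/E; [rewrite ltr_wpDl|rewrite gxE lee_fin lerDl ltW].
Qed.

(** The gauge is the reciprocal of the radial function; strict inequalities avoid reciprocals of 0
    and +oo. *)
Lemma gauge_lt K x (a : R) : (0 < a)%R -> (gauge K x < a%:E) = (a^-1%:E < radial K x).
Proof.
move=> a0; apply/idP/idP => h.
  have [_ [l [/= l0 [y Ky yx]] <-]] := @ereal_inf_lt _ _ _ h.
  rewrite lte_fin => la.
  apply: (@lt_le_trans _ _ l^-1%:E); first by rewrite lte_fin ltf_pV2.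
  rewrite /radial le_max; apply/orP; right; apply: ereal_sup_ubound.
  exists l^-1%R => //=; split; first by rewrite invr_gt0.
  by rewrite -yx scalerA mulVf ?gt_eqF// scale1r.
have na : (a^-1%:E < 0) = false by apply/negbTE; rewrite -leNgt lee_fin invr_ge0 ltW.
move: h; rewrite /radial lt_max na /= => /ereal_sup_gt[_ [l [/= l0 Klx] <-]]; rewrite lte_fin => la.
apply: (@le_lt_trans _ _ l^-1%:E); last by rewrite lte_fin -[X in (_ < X)%R]invrK ltf_pV2// posrE invr_gt0.
apply: ereal_inf_lbound; exists l^-1%R => //=; split; first by rewrite invr_gt0.
by exists (l *: x)%R => //; rewrite scalerA mulVf ?gt_eqF// scale1r.
Qed.

(** Upper semicontinuity of the gauge off the origin, from which both its boundedness and its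
    measurability on the sphere are derived. *)
Lemma star_body_near_gauge K x (a : R) : star_body K -> x != 0%R -> (0 < a)%R ->
  gauge K x < a%:E -> \forall y \near x, gauge K y < a%:E.
Proof.
move=> [_ sK] x0 a0; rewrite gauge_lt// => h.
have [_ cx] := sK _ x0.
have := cx _ (open_ereal_gt_ereal h).
by apply: (@filterS _ _ (nbhs_filter x)) => y /= hy; rewrite gauge_lt.
Qed.

Lemma star_body_gauge_bounded K : star_body K ->
  exists2 C : R, (0 < C)%R & forall x, S x -> gauge K x < C%:E.
Proof.
move=> sbK; have [_ sK] := sbK.
have [c c0 hc] : exists2 c : R, (0 < c)%R & forall x, S x -> gauge K x < c^-1%:E.
  apply: sphere_uniform => [c d x c0 cd h|x /sphere_neq0 x0].
    by apply: (lt_le_trans h); rewrite lee_fin lef_pV2 ?posrE// (lt_le_trans c0).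
  have [rx _] := sK _ x0.
  have [c c0 cr] : exists2 c : R, (0 < c)%R & c%:E < radial K x.
    case rE : (radial K x) rx => [r| |]; last by [].
      by rewrite lte_fin => r0; exists (r / 2)%R; rewrite ?divr_gt0// lte_fin ltr_pdivrMr// ltr_pMr// ltr1n.
    by move=> _; exists 1%R; rewrite ?ltr01// ltry.
  exists c => //; apply: star_body_near_gauge => //; first by rewrite invr_gt0.
  by rewrite gauge_lt ?invr_gt0// invrK.
by exists c^-1%R => //; rewrite invr_gt0.
Qed.

Lemma star_body_measurable_gauge K : star_body K -> measurable_fun S (fine \o gauge K).
Proof.
move=> sbK; have [C C0 hC] := star_body_gauge_bounded sbK.
have gE x : S x -> gauge K x = (fine (gauge K x))%:E.
  move=> Sx; rewrite fineK// ge0_fin_numE ?gauge_ge0//.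
  exact: lt_trans (hC _ Sx) (ltry _).
apply: (measurability _ (RGenInftyO.measurableE R)) => _ [_ [a ->] <-].
have [a0|a0] := leP a 0%R.
  rewrite (_ : _ `&` _ = set0)//; apply/seteqP; split => // x [_ /=].
  by rewrite in_itv /= ltNge (le_trans a0)// fine_ge0// gauge_ge0.
pose U := [set x | (x != 0)%R /\ gauge K x < a%:E].
have oU : open U.
  rewrite openE => x [x0 gx]; rewrite /interior.
  have h1 := star_body_near_gauge sbK x0 a0 gx.
  have h2 : nbhs x [set y | y != 0%R].
    apply: (@filterS _ _ (nbhs_filter x) _ _ _ (nbhsx_ballx x `|x|%R _)); last by rewrite normr_gt0.
    by move=> y; rewrite -ball_normE /=; apply: contraTN => /eqP ->; rewrite subr0 ltxx.
  by apply: (@filterS _ _ (nbhs_filter x) _ _ _ (@filterI _ _ (nbhs_filter x) _ _ h1 h2)) => y [].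
rewrite (_ : _ `&` _ = S `&` U); first by apply: measurableI; [exact: measurable_sphere|exact: open_measurable_rV].
apply/seteqP; split => x [Sx /=]; rewrite in_itv /= => h; split => //.
  split; first exact: sphere_neq0.
  by rewrite gE.
by move: h => [_]; rewrite gE.
Qed.

Lemma bounded_gauge_gt0 K : bounded_set K ->
  exists2 c : R, (0 < c)%R & forall x, S x -> c%:E <= gauge K x.
Proof.
move=> [M [Mr hM]].
(* The sphere is Euclidean while boundedness refers to the maximum norm; compactness bounds the
   latter away from 0 on the sphere. *)
have [c c0 hc] : exists2 c : R, (0 < c)%R & forall x, S x -> (c <= `|x|)%R.
  apply: sphere_uniform => [c d x c0 cd|x /sphere_neq0 x0]; first exact: le_trans.
  exists (`|x| / 2)%R; first by rewrite divr_gt0// normr_gt0.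
  apply: (@filterS _ _ (nbhs_filter x) _ _ _ (nbhsx_ballx x (`|x| / 2)%R _)); last first.
    by rewrite divr_gt0// normr_gt0.
  move=> y; rewrite -ball_normE /= => xy.
  have h := lerB_dist x y; lra.
pose M' := (`|M| + 1)%R; have M'0 : (0 < M')%R by rewrite ltr_wpDl.
have hM' y : K y -> (`|y| <= M')%R.
  by apply: hM; rewrite /M' (le_lt_trans (ler_norm _))// ltrDl.
exists (c / M')%R; first by rewrite divr_gt0.
move=> x Sx; apply: le_ereal_inf_tmp => _ [l [/= l0 [y Ky yx]] <-].
rewrite lee_fin ler_pdivrMr//; apply: le_trans (hc _ Sx) _.
by rewrite -yx normrZ gtr0_norm// ler_pM2l// hM'.
Qed.

End gauge_lemmas.

Section powR_lemmas.
Context {R : realType}.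
Implicit Types x r c C : R.

Lemma continuous_powR r x : 0 < x -> {for x, continuous (fun a : R => a `^ r)}.
Proof.
move=> x0; apply: differentiable_continuous; apply/derivable1_diffP.
by apply: derivable_powR; rewrite in_itv /= x0.
Qed.

Lemma powRD_gt0 x r t : 0 < x -> x `^ (r + t) = x `^ r * x `^ t.
Proof. by move=> x0; rewrite powRD//; apply/implyP => _; rewrite gt_eqF. Qed.

Lemma powR_le_max c C x r : 0 < c -> c <= x <= C -> x `^ r <= Num.max (C `^ r) (c `^ r).
Proof.
move=> c0 /andP[cx xC]; rewrite le_max; apply/orP.
have x0 : 0 < x by exact: lt_le_trans cx.
have C0 : 0 < C by exact: lt_le_trans xC.
have [r0|r0] := leP 0 r; first by left; apply: ge0_ler_powR => //; rewrite nnegrE ltW.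
right; rewrite -[r]opprK [x `^ _]powRN [c `^ _]powRN lef_pV2 ?posrE ?powR_gt0//.
by apply: ge0_ler_powR => //; rewrite ?nnegrE ?oppr_ge0; exact: ltW.
Qed.

Lemma epow_EFin x r : 0 < x \/ 0 <= r -> epow x%:E r = (x `^ r)%:E.
Proof.
rewrite /epow; have [r0|r0] := leP 0 r; first by move=> _; rewrite poweR_EFin.
move=> [x0|//].
rewrite poweR_EFin inver gt_eqF ?powR_gt0//.
by rewrite powRN invrK.
Qed.

End powR_lemmas.

(** * Convergence of volumes and dual mixed volumes from convergence of gauges *)

Section weighted_integrals.
Context {R : realType} {n : nat}.
Implicit Types (K L : set 'rV[R]_n) (W g : 'rV[R]_n -> R).
Local Notation S := (@sphere R n).
Local Notation sigma := (@surface_measure R n).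

Lemma weighted_integral_cvg W (B r c C : R) (g_ : nat -> 'rV[R]_n -> R) g :
  measurable_fun S W -> (forall x, S x -> 0 <= W x <= B) -> 0 < c ->
  (forall k, measurable_fun S (g_ k)) ->
  (forall k x, S x -> c <= g_ k x <= C) ->
  (forall x, S x -> g_ ^~ x @ \oo --> g x) ->
  (\int[sigma]_(x in S) (W x * g_ k x `^ r)%:E @[k --> \oo] -->
   \int[sigma]_(x in S) (W x * g x `^ r)%:E)%E.
Proof.
move=> mW W0 c0 mg gcC cg.
have mS : measurable S by exact: measurable_sphere.
refine (proj2 (@dominated_cvg_EFin _ _ _ _ S (fun k x => W x * g_ k x `^ r)
  (fun x => W x * g x `^ r) (fun=> B * Num.max (C `^ r) (c `^ r)) mS _ _ _ _)).
- move=> k; apply: measurable_funM => //.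
  exact: (measurableT_comp (measurable_powR r)).
- by apply: integrable_cst_fin => //; exact: surface_measure_fin.
- move=> k x Sx; have /andP[w0 wB] := W0 x Sx.
  rewrite ger0_norm ?mulr_ge0 ?powR_ge0//; apply: ler_pM; rewrite ?powR_ge0//.
  exact: powR_le_max (gcC k x Sx).
- move=> x Sx; apply: cvgM; first exact: cvg_cst.
  apply: (@continuous_cvg _ _ _ _ _ _ (fun a : R => a `^ r)); last exact: cg.
  apply: continuous_powR; apply: (lt_le_trans c0).
  have <- : limn (g_ ^~ x) = g x by apply: cvg_lim => //; exact: cg.
  apply: limr_ge; first by apply: cvgP; exact: cg.
  by apply: nearW => k; have /andP[] := gcC k x Sx.
Qed.

(** Here the two cases for K and q enter. For q > n the exponent q - n is positive, and the upper
    bound of the gauge, valid for every star body, suffices. For q < n it is negative, and a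
    positive lower bound is called for, that is, a bounded K. *)
Lemma star_body_weight K (q : R) :
  (star_body K /\ n%:R < q) \/ [/\ star_body K, bounded_set K, q < n%:R & q != 0] ->
  exists (W : 'rV[R]_n -> R) (B : R), [/\ measurable_fun S W,
    forall x, S x -> 0 <= W x <= B &
    forall x, S x -> epow (gauge K x) (- n%:R + q) = (W x)%:E].
Proof.
move=> Kq; have sbK : star_body K by case: Kq => -[].
have [C C0 hC] := star_body_gauge_bounded sbK.
have gE x : S x -> gauge K x = (fine (gauge K x))%:E.
  move=> Sx; rewrite fineK// ge0_fin_numE ?gauge_ge0//.
  exact: lt_trans (hC _ Sx) (ltry _).
have g0 x : 0 <= fine (gauge K x) by rewrite fine_ge0// gauge_ge0.
have gC x : S x -> fine (gauge K x) <= C.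
  by move=> Sx; rewrite -lee_fin -gE// ltW// hC.
pose W x := fine (gauge K x) `^ (- n%:R + q).
have mW : measurable_fun S W.
  apply: (measurableT_comp (measurable_powR _)).
  exact: star_body_measurable_gauge.
case: Kq => [[_ nq]|[_ bK qn _]].
  have r0 : 0 <= - n%:R + q by rewrite addrC subr_ge0 ltW.
  exists W, (C `^ (- n%:R + q)); split => // x Sx.
    by rewrite powR_ge0/=; apply: ge0_ler_powR => //; rewrite ?nnegrE ?gC// ltW.
  by rewrite gE// epow_EFin//; right.
have [c c0 hc] := bounded_gauge_gt0 bK.
have gc x : S x -> c <= fine (gauge K x) by move=> Sx; rewrite -lee_fin -gE// hc.
exists W, (Num.max (C `^ (- n%:R + q)) (c `^ (- n%:R + q))); split => // x Sx.
  by rewrite powR_ge0/=; apply: powR_le_max => //; rewrite gc// gC.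
by rewrite gE// epow_EFin//; left; apply: (lt_le_trans c0); exact: gc.
Qed.

(** Both quantities integrate a bounded weight times a power of the gauge: weight 1 and exponent - n
    for the volume, the (q - n)-th power of the gauge of K and exponent - q for the dual mixed
    volume. *)
Lemma volume_dual_mixed_volume_cvg K (q c C : R) (L_ : nat -> set 'rV[R]_n) L
    (g_ : nat -> 'rV[R]_n -> R) g :
  (star_body K /\ n%:R < q) \/ [/\ star_body K, bounded_set K, q < n%:R & q != 0] ->
  0 < c -> (forall k, measurable_fun S (g_ k)) ->
  (forall k x, S x -> c <= g_ k x <= C) ->
  (forall x, S x -> g_ ^~ x @ \oo --> g x) ->
  (forall k x, S x -> gauge (L_ k) x = (g_ k x)%:E) ->
  (forall x, S x -> gauge L x = (g x)%:E) ->
  volume (L_ k) @[k --> \oo] --> volume L /\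
  dual_mixed_volume q K (L_ k) @[k --> \oo] --> dual_mixed_volume q K L.
Proof.
move=> Kq c0 mg gcC cg L_E LE.
have gk0 k x : S x -> 0 < g_ k x.
  by move=> Sx; have /andP[h _] := gcC k x Sx; exact: lt_le_trans h.
have g0 x : S x -> 0 < g x.
  move=> Sx; apply: (lt_le_trans c0).
  have <- : limn (g_ ^~ x) = g x by apply: cvg_lim => //; exact: cg.
  apply: limr_ge; first by apply: cvgP; exact: cg.
  by apply: nearW => k; have /andP[] := gcC k x Sx.
split.
  have VE M h : (forall x, S x -> 0 < h x) -> (forall x, S x -> gauge M x = (h x)%:E) ->
      volume M = (n%:R^-1%:E * \int[sigma]_(x in S) (1 * h x `^ (- n%:R))%:E)%E.
    move=> h0 hM; rewrite /volume; congr (_ * _)%E; apply: eq_integral => x; rewrite inE => Sx.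
    by rewrite hM// epow_EFin ?mul1r//; left; exact: h0.
  rewrite (VE L g g0 LE) (_ : (fun k => _) =
    fun k => (n%:R^-1%:E * \int[sigma]_(x in S) (1 * g_ k x `^ (- n%:R))%:E)%E); last first.
    by apply/funext => k; apply: VE => // x Sx; [exact: gk0|exact: L_E].
  apply: cvgeZl => //.
  apply: (@weighted_integral_cvg (cst 1) 1 (- n%:R) c C g_ g) => //.
  by move=> x _; rewrite lexx ler01.
have [W [B [mW WB WE]]] := star_body_weight Kq.
have DE M h : (forall x, S x -> 0 < h x) -> (forall x, S x -> gauge M x = (h x)%:E) ->
    dual_mixed_volume q K M = (n%:R^-1%:E * \int[sigma]_(x in S) (W x * h x `^ (- q))%:E)%E.
  move=> h0 hM; rewrite /dual_mixed_volume; congr (_ * _)%E; apply: eq_integral => x; rewrite inE => Sx.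
  by rewrite WE// hM// epow_EFin//; left; exact: h0.
rewrite (DE L g g0 LE) (_ : (fun k => _) =
  fun k => (n%:R^-1%:E * \int[sigma]_(x in S) (W x * g_ k x `^ (- q))%:E)%E); last first.
  by apply/funext => k; apply: DE => // x Sx; [exact: gk0|exact: L_E].
apply: cvgeZl => //.
exact: (@weighted_integral_cvg W B (- q) c C g_ g).
Qed.

End weighted_integrals.

(** * Limits of p-th roots *)

Section root_limits.
Context {R : realType}.
Implicit Types (K p a x : R).

Lemma cvg_inv_pinfty : p^-1 @[p --> +oo] --> (0 : R).
Proof.
apply/cvgrPdist_lt => e e0; near=> p.
have p0 : 0 < p by near: p; exact: nbhs_pinfty_gt.
rewrite sub0r normrN gtr0_norm ?invr_gt0// invf_plt ?posrE//.
by near: p; apply: nbhs_pinfty_gt; exact: num_real.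
Unshelve. all: by end_near. Qed.

Lemma cvg_root_pinfty K : 0 < K -> K `^ p^-1 @[p --> +oo] --> (1 : R).
Proof.
move=> K0; rewrite (_ : (fun p => _) = fun p => expR (p^-1 * ln K)).
  rewrite -expR0 -[X in expR X](mul0r (ln K)).
  apply: continuous_cvg; first exact: continuous_expR.
  by apply: cvgMr_tmp; exact: cvg_inv_pinfty.
by apply/funext => p; rewrite /powR gt_eqF.
Qed.

Lemma cvg_id_root_pinfty : p `^ p^-1 @[p --> +oo] --> (1 : R).
Proof.
rewrite (_ : 1 = expR 0); last by rewrite expR0.
have h : p^-1 * ln p @[p --> +oo] --> (0 : R).
  apply: (@squeeze_cvgr _ _ _ _ (cst 0) (fun p => 2 * Num.sqrt p^-1)); last 2 first.
  - exact: cvg_cst.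
  - rewrite [X in _ --> X](_ : _ = 2 * Num.sqrt 0); last by rewrite sqrtr0 mulr0.
    apply: cvgMl_tmp; apply: continuous_cvg; first exact: sqrt_continuous.
    exact: cvg_inv_pinfty.
  near=> p.
  have p1 : 1 <= p by near: p; apply: nbhs_pinfty_ge; exact: num_real.
  have p0 : 0 < p by exact: lt_le_trans p1.
  apply/andP; split; first by rewrite /= mulr_ge0 ?ln_ge0// invr_ge0 ltW.
  have sp0 : 0 < Num.sqrt p by rewrite sqrtr_gt0.
  (* ln p is twice the logarithm of the square root of p, and ln y <= y - 1. *)
  have h1 : ln p <= 2 * Num.sqrt p.
    rewrite -[in ln p](sqr_sqrtr (ltW p0)) lnXn// mulr_natl ler_wMn2r//.
    have := @le_ln1Dx R (Num.sqrt p - 1); rewrite addrCA subrr addr0 => /(_ _)/le_trans; apply.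
      by rewrite ltrBrDl subrr.
    by rewrite gerBl.
  rewrite mulrC ler_pdivrMr//; apply: le_trans h1 _.
  rewrite -mulrA ler_wpM2l// sqrtrV ?(ltW p0)// -{3}(sqr_sqrtr (ltW p0)).
  by rewrite expr2 mulrA mulVf ?mul1r ?lexx// gt_eqF.
have E : \forall p \near (pinfty_nbhs R), expR (p^-1 * ln p) = p `^ p^-1.
  by apply: filterS (nbhs_pinfty_gt (num_real (0 : R))) => p p0; rewrite /powR gt_eqF.
apply: cvg_trans (near_eq_cvg E) _.
by apply: continuous_cvg; first exact: continuous_expR.
Unshelve. all: by end_near. Qed.

Section roots.
Variables (cf : R -> R) (s p0 C0 : R).
Hypothesis s0 : 0 < s.
Hypothesis p0_gt0 : 0 < p0.
Hypothesis C0_gt0 : 0 < C0.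
Hypothesis cf0 : forall p, 0 <= cf p.
Hypothesis cf1 : cf p `^ p^-1 @[p --> +oo] --> (1 : R).

(** The limit takes place in the p-th root; the root of order s is a fixed continuous map applied
    afterwards. The factor [cf] will be p (1 - s) for the fractional bodies and 1 for the others. *)
Let rootE p (J : R) : 0 <= J ->
  (cf p * J) `^ (p * s)^-1 = (cf p `^ p^-1 * J `^ p^-1) `^ s^-1.
Proof. by move=> J0; rewrite invfM powRrM powRM. Qed.

(** After taking p-th roots, J lies between a d^(1/p) and N (N^(-p0) C0)^(1/p). The roots of the
    constants tend to 1, and a < N is arbitrary. *)
Lemma cvg_root (J : R -> R) (N : R) : 0 < N ->
  (forall p, p0 <= p -> 0 <= J p <= N `^ (p - p0) * C0) ->
  (forall a, 0 < a < N -> exists2 d, 0 < d & forall p, p0 <= p -> a `^ p * d <= J p) ->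
  (cf p * J p) `^ (p * s)^-1 @[p --> +oo] --> N `^ s^-1.
Proof.
move=> N0 ubJ lbJ.
have cJ : J p `^ p^-1 @[p --> +oo] --> N.
  have cU : N * (N `^ (- p0) * C0) `^ p^-1 @[p --> +oo] --> N.
    rewrite -[X in _ --> X]mulr1; apply: cvgMl_tmp; apply: cvg_root_pinfty.
    by rewrite mulr_gt0// powR_gt0.
  apply/cvgrPdist_le => e e0.
  (* Positive, below N and above N - e. *)
  pose a := Num.max (N - e / 2) (N / 2).
  have a0 : 0 < a by rewrite lt_max; apply/orP; right; rewrite divr_gt0.
  have aN : a < N by rewrite gt_max gtrBl divr_gt0//= ltr_pdivrMr// ltr_pMr// ltr1n.
  have [d d0 hd] : exists2 d, 0 < d & forall p, p0 <= p -> a `^ p * d <= J p.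
    by apply: lbJ; rewrite a0.
  have cD : a * d `^ p^-1 @[p --> +oo] --> a.
    by rewrite -[X in _ --> X]mulr1; apply: cvgMl_tmp; exact: cvg_root_pinfty.
  near=> p.
  have pp0 : p0 <= p by near: p; apply: nbhs_pinfty_ge; exact: num_real.
  have p_gt0 : 0 < p by exact: lt_le_trans pp0.
  have /andP[J0 JU] := ubJ p pp0.
  have ip0 : 0 <= p^-1 by rewrite invr_ge0 ltW.
  have up : J p `^ p^-1 <= N + e.
    apply: (@le_trans _ _ (N * (N `^ (- p0) * C0) `^ p^-1)); last first.
      near: p; apply: (cvgr_le N cU); by rewrite ltrDl.
    have -> : N * (N `^ (- p0) * C0) `^ p^-1 = (N `^ (p - p0) * C0) `^ p^-1.
      rewrite powRD; last by apply/implyP => _; rewrite gt_eqF.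
      have K0 : 0 <= N `^ (- p0) * C0 by apply: mulr_ge0; [exact: powR_ge0|exact: ltW].
      rewrite -[in RHS]mulrA [RHS]powRM//; last exact: powR_ge0.
      by rewrite -powRrM divff ?gt_eqF// powRr1// ltW.
    by apply: ge0_ler_powR => //; rewrite nnegrE//; apply: mulr_ge0; [exact: powR_ge0|exact: ltW].
  have lo : N - e <= J p `^ p^-1.
    apply: (@le_trans _ _ (a * d `^ p^-1)).
      near: p; apply: (cvgr_ge a cD).
      by rewrite lt_max; apply/orP; left; rewrite ltrD2l ltrN2 ltr_pdivrMr// ltr_pMr// ltr1n.
    have -> : a * d `^ p^-1 = (a `^ p * d) `^ p^-1.
      by rewrite powRM ?powR_ge0 ?ltW// -powRrM divff ?gt_eqF// powRr1// ltW.
    apply: ge0_ler_powR => //; rewrite ?nnegrE//; last exact: hd.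
    by apply: mulr_ge0; [exact: powR_ge0|exact: ltW].
  rewrite ler_distlC; apply/andP; split; lra.
have c : cf p `^ p^-1 * J p `^ p^-1 @[p --> +oo] --> N.
  by rewrite -[X in _ --> X]mul1r; apply: cvgM.
have E : \forall p \near +oo%R, (cf p `^ p^-1 * J p `^ p^-1) `^ s^-1 = (cf p * J p) `^ (p * s)^-1.
  near=> p; rewrite rootE//.
  have pp0 : p0 <= p by near: p; apply: nbhs_pinfty_ge; exact: num_real.
  by have /andP[] := ubJ p pp0.
apply: cvg_trans (near_eq_cvg E) _.
by apply: (@continuous_cvg _ _ _ _ _ _ (fun a : R => a `^ s^-1)) => //; exact: continuous_powR.
Unshelve. all: by end_near. Qed.

(** For large p the p-th roots of [cf p], m and C0 lie within a factor 2 of 1. The threshold for p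
    is fixed before J and N, which makes the bounds uniform over directions. The choice M >= 1
    absorbs the exponent (p - p0) / p <= 1 of N. *)
Lemma root_bounds (m C1 : R) : 0 < m -> exists c C : R, 0 < c /\
  \forall p \near +oo%R, p0 <= p /\ forall J N : R, 0 < N <= C1 ->
    m `^ p * m <= J -> J <= N `^ (p - p0) * C0 ->
    c <= (cf p * J) `^ (p * s)^-1 <= C.
Proof.
move=> m0; pose M := Num.max C1 1.
exists ((2^-1 * (m * 2^-1)) `^ s^-1), ((2 * (M * 2)) `^ s^-1).
have M1 : 1 <= M by rewrite le_max lexx orbT.
have M0 : 0 < M by exact: lt_le_trans M1.
split; first by rewrite powR_gt0// !mulr_gt0// invr_gt0.
have h12 : 2^-1 < 1 :> R by rewrite invf_lt1// ltr1n.
have h21 : 1 < 2 :> R by rewrite ltr1n.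
near=> p.
have pp0 : p0 <= p by near: p; apply: nbhs_pinfty_ge; exact: num_real.
split=> // J N /andP[N0 NC1] mJ JN.
have p_gt0 : 0 < p by exact: lt_le_trans pp0.
have ip0 : 0 <= p^-1 by rewrite invr_ge0 ltW.
have J0 : 0 <= J by apply: le_trans mJ; rewrite mulr_ge0 ?powR_ge0// ltW.
have is0 : 0 <= s^-1 by rewrite invr_ge0 ltW.
have cf_lo : 2^-1 <= cf p `^ p^-1 by near: p; exact: (cvgr_ge 1 cf1).
have cf_up : cf p `^ p^-1 <= 2 by near: p; exact: (cvgr_le 1 cf1).
have m_lo : 2^-1 <= m `^ p^-1 by near: p; exact: (cvgr_ge 1 (cvg_root_pinfty m0)).
have C_up : C0 `^ p^-1 <= 2 by near: p; exact: (cvgr_le 1 (cvg_root_pinfty C0_gt0)).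
have J_lo : m * 2^-1 <= J `^ p^-1.
  apply: (@le_trans _ _ (m * m `^ p^-1)); first by rewrite ler_pM2l.
  have -> : m * m `^ p^-1 = (m `^ p * m) `^ p^-1.
    by rewrite powRM ?powR_ge0 ?ltW// -powRrM divff ?gt_eqF// powRr1// ltW.
  apply: ge0_ler_powR => //; rewrite ?nnegrE//.
  by apply: mulr_ge0; [exact: powR_ge0|exact: ltW].
have J_up : J `^ p^-1 <= M * 2.
  apply: (@le_trans _ _ ((N `^ (p - p0) * C0) `^ p^-1)).
    apply: ge0_ler_powR => //; rewrite ?nnegrE//.
    by apply: mulr_ge0; [exact: powR_ge0|exact: ltW].
  rewrite powRM ?powR_ge0 ?(ltW C0_gt0)//; apply: ler_pM; rewrite ?powR_ge0//.
  rewrite -powRrM; apply: (@le_trans _ _ (M `^ ((p - p0) * p^-1))).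
    apply: ge0_ler_powR; rewrite ?nnegrE ?(ltW N0) ?(ltW M0)//; first by rewrite mulr_ge0// subr_ge0.
    by rewrite le_max NC1.
  by apply: ler1_powR => //; rewrite ler_pdivrMr// mul1r gerBl ltW.
have A0 : 0 <= cf p `^ p^-1 by exact: powR_ge0.
have B0 : 0 <= J `^ p^-1 by exact: powR_ge0.
have h20 : 0 <= 2^-1 :> R by rewrite invr_ge0.
have m20 : 0 <= m * 2^-1 by rewrite mulr_ge0// ltW.
have lo : 2^-1 * (m * 2^-1) <= cf p `^ p^-1 * J `^ p^-1 by exact: ler_pM.
have up : cf p `^ p^-1 * J `^ p^-1 <= 2 * (M * 2) by exact: ler_pM.
have AB0 := mulr_ge0 A0 B0.
rewrite rootE//; apply/andP; split; apply: ge0_ler_powR => //; rewrite nnegrE//.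
  exact: mulr_ge0.
by rewrite !mulr_ge0// ltW.
Unshelve. all: by end_near. Qed.

End roots.

End root_limits.

(** * Increments and gauges *)

Section sgpart_lemmas.
Context {R : realType}.
Implicit Types (b : bool) (a l : R).

Lemma sgpart_ge0 b a : 0 <= sgpart b a.
Proof. by rewrite /sgpart; case: b; rewrite le_max lexx orbT. Qed.

Lemma sgpartZ b l a : 0 <= l -> sgpart b (l * a) = l * sgpart b a.
Proof. by move=> l0; rewrite /sgpart; case: b; rewrite maxr_pMr// mulr0// mulrN. Qed.

Lemma measurable_sgpart b : measurable_fun setT (@sgpart R b).
Proof.
by rewrite /sgpart; case: b; apply: measurable_maxr => //; exact: measurable_funN.
Qed.

Lemma sgpart_le_norm b a : sgpart b a <= `|a|.
Proof.
by rewrite /sgpart; case: b; rewrite ge_max normr_ge0 andbT ?ler_norm// -normrN ler_norm.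
Qed.

End sgpart_lemmas.

(** * Measurability and homogeneity of the gauge functions *)

Section measurability.
Context {R : realType} {n : nat}.
Local Notation leb := (lebesgue_rV R n).
Variables (b : bool) (f : 'rV[R]_n -> R).
Hypothesis mf : measurable_fun setT f.
Local Open Scope ereal_scope.

Definition increment_integral (p : R) (xi : 'rV[R]_n) (t : R) : \bar R :=
  \int[leb]_x (sgpart b (f (x + t *: xi) - f x) `^ p)%:E.

Lemma measurable_increment_integral (p : R) :
  measurable_fun setT (fun z : 'rV[R]_n * measurableTypeR R => increment_integral p z.1 z.2).
Proof.
pose H (w : ('rV[R]_n * measurableTypeR R) * 'rV[R]_n) : \bar R :=
  (sgpart b (f (w.2 + w.1.2 *: w.1.1) - f w.2) `^ p)%:E.
have mH : measurable_fun setT H.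
  apply/measurable_EFinP; apply: (measurableT_comp (measurable_powR p)).
  apply: (measurableT_comp (measurable_sgpart b)); apply: measurable_funB.
    apply: (measurableT_comp mf); apply: measurable_funD_rV => //.
    apply: measurable_funZ_rV.
      exact: (measurableT_comp measurable_snd measurable_fst).
    exact: (measurableT_comp measurable_fst measurable_fst).
  exact: (measurableT_comp mf measurable_snd).
apply: (measurable_fun_fubini_tonelli_F H mH) => w.
by rewrite lee_fin powR_ge0.
Qed.

Definition weighted_increment_integral (r p : R) (xi : 'rV[R]_n) : \bar R :=
  \int[lebesgue_measure]_(t in `]0%R, +oo[) ((t `^ r)%:E * increment_integral p xi t).

Lemma increment_integral_ge0 p xi t : 0 <= increment_integral p xi t.
Proof. by apply: integral_ge0 => x _; rewrite lee_fin powR_ge0. Qed.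

Let half_line : set (measurableTypeR R) := [set` `]0%R, +oo[%R].

Let mhalf_line : measurable half_line.
Proof. exact: measurable_itv. Qed.

(** The half-line is absorbed into the weight, so that Tonelli and the scaling formula can be used
    on the whole line. *)
Let weight r t : R := (t `^ r * \1_half_line t)%R.

Let weighted_increment_integralE r p xi : weighted_increment_integral r p xi =
  \int[@lebesgue_measure R]_t ((weight r t)%:E * increment_integral p xi t).
Proof.
rewrite /weighted_increment_integral integral_mkcond; apply: eq_integral => t _.
rewrite patchE /weight indicE -[X in if X then _ else _]/(t \in half_line).
by case: ifPn => _; rewrite ?mulr1// mulr0 mul0e.
Qed.

Let measurable_weight r : measurable_fun setT (weight r : measurableTypeR R -> R).
Proof.
apply: measurable_funM; last exact: measurable_indic.
exact: measurable_powR.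
Qed.

Lemma measurable_weighted_increment_integral r p :
  measurable_fun setT (weighted_increment_integral r p).
Proof.
rewrite (_ : weighted_increment_integral r p = fun xi =>
  \int[@lebesgue_measure R]_t ((weight r t)%:E * increment_integral p xi t)); last first.
  by apply/funext => xi; exact: weighted_increment_integralE.
pose H (z : 'rV[R]_n * measurableTypeR R) := (weight r z.2)%:E * increment_integral p z.1 z.2.
apply: (measurable_fun_fubini_tonelli_F H) => [|z].
  apply: emeasurable_funM; last exact: measurable_increment_integral.
  by apply/measurable_EFinP; exact: (measurableT_comp (measurable_weight r) measurable_snd).
by rewrite mule_ge0// ?increment_integral_ge0// lee_fin mulr_ge0 ?powR_ge0.
Qed.

Lemma increment_integral_scale p l xi t :
  increment_integral p (l *: xi)%R t = increment_integral p xi (l * t)%R.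
Proof. by apply: eq_integral => x _; rewrite scalerA mulrC. Qed.

(** Substituting l t for t gives the factor l^(-r) from the weight and l^(-1) from the measure. For
    r = - p s - 1 the product is l^(p s), which makes the gauge homogeneous of degree 1. *)
Lemma weighted_increment_integral_scale r p l xi : (0 < l)%R ->
  weighted_increment_integral r p (l *: xi)%R =
  (l `^ (- r - 1))%:E * weighted_increment_integral r p xi.
Proof.
move=> l0; rewrite !weighted_increment_integralE.
pose F (t : R) := (weight r t)%:E * increment_integral p xi t.
have mJ : measurable_fun setT (increment_integral p xi : measurableTypeR R -> \bar R).
  have mt : measurable_fun setT (fun t : measurableTypeR R => (xi, t)) by exact: measurable_fun_pair.
  exact: (measurableT_comp (measurable_increment_integral p) mt).
have mF : measurable_fun setT (F : measurableTypeR R -> \bar R).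
  by apply: emeasurable_funM => //; apply/measurable_EFinP; exact: measurable_weight.
have F0 t : 0 <= F t.
  by rewrite mule_ge0// ?increment_integral_ge0// lee_fin mulr_ge0 ?powR_ge0.
have E := ge0_integral_scale1 l0 mF F0.
transitivity (\int[@lebesgue_measure R]_t ((l `^ (- r))%:E * F (l * t)%R)).
  apply: eq_integral => t _; rewrite /F increment_integral_scale muleA -EFinM; congr (_%:E * _).
  rewrite /weight !indicE.
  have -> : (l * t \in half_line)%R = (t \in half_line).
    apply/idP/idP; rewrite !inE /half_line /= !in_itv /= !andbT; first by rewrite pmulr_rgt0.
    by rewrite pmulr_rgt0.
  case: (boolP (t \in half_line)) => [|_]; last by rewrite !mulr0.
  rewrite inE /half_line /= in_itv /= andbT => t0; rewrite !mulr1 powRM ?ltW//.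
  by rewrite mulrA -powRD_gt0// addNr powRr0 mul1r.
have ml : measurable_fun setT ((fun t : R => (l * t)%R) : measurableTypeR R -> measurableTypeR R).
  exact: measurable_funM.
have mFl : measurable_fun setT ((fun t : R => F (l * t)%R) : measurableTypeR R -> \bar R).
  exact: (measurableT_comp mF ml).
have c0 : 0 <= (l `^ (- r))%:E by rewrite lee_fin powR_ge0.
have Z := @ge0_integralZl _ (measurableTypeR R) R (@lebesgue_measure R) setT measurableT _ mFl _ (fun t _ => F0 _) c0.
have -> : (l `^ (- r - 1) = l `^ (- r) * l^-1)%R by rewrite powRD_gt0// powR_inv1// ltW.
have alg (a c : R) (I J : \bar R) : J = c%:E * I -> a%:E * J = (a * c)%:E * I.
  by move=> ->; rewrite muleA -EFinM.
exact: etrans Z (alg _ _ _ _ E).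
Qed.

Lemma gauge_frac_polar_projE s p xi : gauge_frac_polar_proj b s p f xi =
  ((p * (1 - s))%:E * weighted_increment_integral (- (p * s) - 1) p xi) `^ (p * s)^-1.
Proof. by []. Qed.

Lemma gauge_frac_polar_proj_scale s p l xi : (0 < l)%R -> (0 < p)%R -> (0 < s < 1)%R ->
  gauge_frac_polar_proj b s p f (l *: xi)%R = l%:E * gauge_frac_polar_proj b s p f xi.
Proof.
move=> l0 p0 /andP[s0 s1]; rewrite !gauge_frac_polar_projE weighted_increment_integral_scale//.
have ps0 : (0 < p * s)%R by rewrite mulr_gt0.
have -> : (- (- (p * s) - 1) - 1 = p * s)%R by ring.
have h : 0 <= (p * (1 - s))%:E * weighted_increment_integral (- (p * s) - 1) p xi.
  apply: mule_ge0; first by rewrite lee_fin mulr_ge0// ?subr_ge0 ltW.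
  apply: integral_ge0 => t _; apply: mule_ge0; last exact: increment_integral_ge0.
  by rewrite lee_fin powR_ge0.
have lps : 0 <= (l `^ (p * s))%:E by rewrite lee_fin powR_ge0.
rewrite muleCA (poweRM _ lps h) poweR_EFin -powRrM divff ?gt_eqF//.
by rewrite powRr1// ltW.
Qed.

End measurability.

Section homogeneity.
Context {R : realType} {n : nat}.
Local Notation leb := (lebesgue_rV R n).
Variables (b : bool) (f : 'rV[R]_n -> R).
Local Open Scope ereal_scope.

Lemma dotpZr (x : 'rV[R]_n) l xi : dotp x (l *: xi)%R = (l * dotp x xi)%R.
Proof. by rewrite /dotp mulr_sumr; apply: eq_bigr => i _; rewrite mxE mulrCA. Qed.

Lemma measurable_sgpart_grad (G : 'rV[R]_n -> 'rV[R]_n) :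
  (forall i, measurable_fun setT (fun x => G x 0%R i)) ->
  measurable_fun setT (fun z : 'rV[R]_n * 'rV[R]_n => sgpart b (dotp (G z.2) z.1)).
Proof.
move=> mG; apply: (measurableT_comp (measurable_sgpart b)).
apply: measurable_sum => i; apply: measurable_funM.
  exact: (measurableT_comp (mG i) measurable_snd).
exact: (measurableT_comp (measurable_coord i) measurable_fst).
Qed.

Lemma gauge_polar_proj_scale p l xi :
  (forall i, measurable_fun setT (fun x => grad f x 0%R i)) ->
  (0 < l)%R -> (0 < p)%R ->
  gauge_polar_proj b p f (l *: xi)%R = l%:E * gauge_polar_proj b p f xi.
Proof.
move=> mG l0 p0; rewrite /gauge_polar_proj.
have -> : \int[leb]_x (sgpart b (dotp (grad f x) (l *: xi)) `^ p)%:E =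
    (l `^ p)%:E * \int[leb]_x (sgpart b (dotp (grad f x) xi) `^ p)%:E.
  rewrite -ge0_integralZl//.
  - apply: eq_integral => x _; rewrite dotpZr sgpartZ ?(ltW l0)// powRM ?sgpart_ge0 ?(ltW l0)//.
  - apply/measurable_EFinP; apply: (measurableT_comp (measurable_powR p)).
    have mx : measurable_fun setT (fun x : 'rV[R]_n => (xi, x)) by exact: measurable_fun_pair.
    exact: (measurableT_comp (measurable_sgpart_grad mG) mx).
  - by move=> x _; rewrite lee_fin powR_ge0.
  - by rewrite lee_fin powR_ge0.
rewrite poweRM ?lee_fin ?powR_ge0//; last by apply: integral_ge0 => x _; rewrite lee_fin powR_ge0.
by rewrite poweR_EFin -powRrM divff ?gt_eqF// powRr1// ltW.
Qed.

Lemma gauge_polar_proj_oo_scale l xi : (0 < l)%R ->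
  gauge_polar_proj_oo b f (l *: xi)%R = l%:E * gauge_polar_proj_oo b f xi.
Proof.
move=> l0; rewrite /gauge_polar_proj_oo -ess_sup_pZl//; congr (ess_sup _ _).
by apply/funext => x; rewrite /= dotpZr sgpartZ// ltW.
Qed.

Lemma gauge_frac_polar_proj_oo_ge0 s xi : 0 <= gauge_frac_polar_proj_oo b s f xi.
Proof. exact: poweR_ge0. Qed.

Lemma gauge_frac_polar_proj_oo_scale s l xi : (0 < l)%R -> (0 < s)%R ->
  gauge_frac_polar_proj_oo b s f (l *: xi)%R = l%:E * gauge_frac_polar_proj_oo b s f xi.
Proof.
move=> l0 s0; rewrite /gauge_frac_polar_proj_oo.
set q := fun xi (z : 'rV[R]_n * R) => (z.2 `^ (- s) * sgpart b (f (z.1 + z.2 *: xi) - f z.1))%:E.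
pose N xi := ereal_sup [set q xi z | z in [set z : 'rV[R]_n * R | (0 < z.2)%R]].
have qE m y (z : 'rV[R]_n * R) : (0 < m)%R -> (0 < z.2)%R ->
    q (m *: y)%R z = (m `^ s)%:E * q y (z.1, m * z.2)%R.
  move=> m0 z0; rewrite /q /= scalerA -EFinM; congr EFin.
  by rewrite powRM ?(ltW m0) ?(ltW z0)// [(z.2 * m)%R]mulrC !mulrA -powRD_gt0// subrr powRr0 mul1r.
have le m y : (0 < m)%R -> N (m *: y)%R <= (m `^ s)%:E * N y.
  move=> m0; apply: ge_ereal_sup => _ [z /= z0 <-]; rewrite qE//.
  rewrite lee_pmul2l ?fin_numE//; last by rewrite lte_fin powR_gt0.
  by apply: ereal_sup_ubound; exists (z.1, m * z.2)%R => //=; rewrite mulr_gt0.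
have N0 y : 0 <= N y.
  apply: (@le_trans _ _ (q y (0, 1)%R)); first by rewrite lee_fin mulr_ge0 ?powR_ge0 ?sgpart_ge0.
  by apply: ereal_sup_ubound; exists (0, 1)%R => //=.
have NE : N (l *: xi)%R = (l `^ s)%:E * N xi.
  (* The reverse inequality is the same one for the factor l^-1 and the vector l xi. *)
  apply/eqP; rewrite eq_le le//=.
  have := le l^-1%R (l *: xi)%R; rewrite invr_gt0 scalerA mulVf ?gt_eqF// scale1r => /(_ l0) h.
  apply: (@le_trans _ _ ((l `^ s)%:E * ((l^-1 `^ s)%:E * N (l *: xi)%R))).
    by apply: lee_wpmul2l => //; rewrite lee_fin powR_ge0.
  rewrite muleA -EFinM -powRM ?invr_ge0 ?(ltW l0)// divff ?gt_eqF// powR1 mul1e//.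
have ls : 0 <= (l `^ s)%:E by rewrite lee_fin powR_ge0.
change ((N (l *: xi)%R) `^ s^-1 = l%:E * (N xi) `^ s^-1).
rewrite NE (poweRM _ ls (N0 _)) poweR_EFin -powRrM divff ?gt_eqF//.
by rewrite powRr1// ltW.
Qed.

End homogeneity.

Section signed_increments.
Context {R : realType} {n : nat}.
Local Notation leb := (lebesgue_rV R n).
Local Notation S := (@sphere R n).
Variables (b : bool) (f : 'rV[R]_n -> R) (G : 'rV[R]_n -> 'rV[R]_n) (L : R).
Hypothesis L0 : 0 <= L.
Hypothesis intf : leb.-integrable setT (EFin \o f).
Hypothesis lf : forall x y, `|f x - f y| <= L * `|x - y|.
Hypothesis wG : bump_weak_gradient f G.
Hypothesis iG : forall i, leb.-integrable setT (EFin \o (fun x => G x 0 i)).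
Hypothesis f_neq0 : exists x, f x != 0.
Implicit Types (x xi eta : 'rV[R]_n) (t : R).

(** With this sign, the part of f selected by b is the positive part for u = sg f and H = sg G, so
    the one-sided results above cover both cases. *)
Let sg : R := if b then 1 else -1.

Let normr_sg : `|sg| = 1. Proof. by rewrite /sg; case: b; rewrite ?normrN normr1. Qed.

Let sg_neq0 : sg != 0. Proof. by rewrite -normr_eq0 normr_sg oner_neq0. Qed.

Let u x := sg * f x.
Let H x := sg *: G x.

Let sgpartE a : sgpart b a = Num.max (sg * a) 0.
Proof. by rewrite /sgpart /sg; case: b; rewrite ?mul1r ?mulN1r. Qed.

Let sgpart_incE x t xi :
  sgpart b (f (x + t *: xi) - f x) = Num.max (u (x + t *: xi) - u x) 0.
Proof. by rewrite sgpartE mulrBr. Qed.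

Let sgpart_dotpE x xi : sgpart b (dotp (G x) xi) = Num.max (dotp (H x) xi) 0.
Proof.
rewrite sgpartE; congr (Num.max _ _); rewrite /dotp mulr_sumr.
by apply: eq_bigr => i _; rewrite mxE mulrA.
Qed.

Let iu : leb.-integrable setT (EFin \o u).
Proof.
rewrite (_ : EFin \o u = fun x => sg%:E * (EFin \o f) x)%E; last by apply/funext.
exact: integrableZl.
Qed.

Let lu x y : `|u x - u y| <= L * `|x - y|.
Proof. by rewrite /u -mulrBr normrM normr_sg mul1r. Qed.

Let iH i : leb.-integrable setT (EFin \o (fun x => H x 0 i)).
Proof.
rewrite (_ : EFin \o _ = fun x => sg%:E * (EFin \o (fun x => G x ord0 i)) x)%E.
  exact: integrableZl.
by apply/funext => x; rewrite /= /H mxE.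
Qed.

Let wH : bump_weak_gradient u H.
Proof.
move=> i phi bphi tphi.
have i1 : leb.-integrable setT (EFin \o (f \* partial i phi)).
  by apply: integrable_mul_bump => //; exact: bump_partial.
have i2 : leb.-integrable setT (EFin \o ((fun x => G x 0 i) \* phi)).
  exact: integrable_mul_bump.
transitivity (\int[leb]_x (sg * (f \* partial i phi) x)).
  by apply: eq_Rintegral => x _; rewrite /u /= mulrA.
rewrite RintegralZl// (wG i bphi tphi) mulrN -RintegralZl//; congr (- _).
by apply: eq_Rintegral => x _; rewrite /H mxE mulrA.
Qed.

Lemma sgpart_increment_gt0 xi : xi != 0 ->
  exists x t, 0 < t /\ 0 < sgpart b (f (x + t *: xi) - f x).
Proof.
move=> xi0; have u0 : exists x, u x != 0.
  by have [x fx] := f_neq0; exists x; rewrite /u mulf_neq0.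
have [x [t [t0 h]]] := exists_increase iu lu xi0 u0.
by exists x, t; split => //; rewrite sgpart_incE lt_max subr_gt0 h.
Qed.

Lemma sgpart_increment_le_of_ae xi N : 0 <= N ->
  {ae leb, forall x, sgpart b (dotp (G x) xi) <= N} ->
  forall x t, 0 <= t -> sgpart b (f (x + t *: xi) - f x) <= t * N.
Proof.
move=> N0 aeN x t t0; rewrite sgpart_incE ge_max mulr_ge0// andbT.
apply: (difference_le_of_ae iu lu wH iH) => //.
by apply: filterS aeN => y; rewrite sgpart_dotpE ge_max => /andP[].
Qed.

Lemma ae_sgpart_le_of_increment xi N : 0 <= N ->
  (forall x t, 0 < t -> sgpart b (f (x + t *: xi) - f x) <= t * N) ->
  {ae leb, forall x, sgpart b (dotp (G x) xi) <= N}.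
Proof.
move=> N0 h; have := @ae_le_of_difference _ _ u H L iu lu wH iH xi N.
have hu x t : 0 < t -> u (x + t *: xi) - u x <= t * N.
  by move=> t0; have := h x t t0; rewrite sgpart_incE ge_max => /andP[].
by move=> /(_ hu); apply: filterS => x hx; rewrite sgpart_dotpE ge_max hx.
Qed.

Lemma sgpart_increment_le_lip x t xi : 0 <= t ->
  sgpart b (f (x + t *: xi) - f x) <= t * (L * `|xi|).
Proof.
move=> t0; apply: le_trans (sgpart_le_norm _ _) _; apply: le_trans (lf _ _) _.
by rewrite addrAC subrr add0r normrZ ger0_norm// mulrCA.
Qed.

(** The Lipschitz bound on increments passes to the gradient. Applied to a difference of directions
    with both signs, it controls how <G, xi> varies with xi. *)
Lemma ae_sgpart_dotp_le xi : {ae leb, forall x, sgpart b (dotp (G x) xi) <= L * `|xi|}.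
Proof.
apply: ae_sgpart_le_of_increment; first by rewrite mulr_ge0.
by move=> x t t0; apply: sgpart_increment_le_lip; exact: ltW.
Qed.

Lemma sgpart_lip (a c : R) : sgpart b a <= sgpart b c + `|a - c|.
Proof.
rewrite !sgpartE -[`|a - c|]mul1r -normr_sg -normrM mulrBr.
have := ler_norm (sg * a - sg * c); set d := `|_| => hd.
rewrite ge_max; apply/andP; split.
  have : sg * c <= Num.max (sg * c) 0 by rewrite le_max lexx.
  lra.
by rewrite addr_ge0// ?normr_ge0// le_max lexx orbT.
Qed.

End signed_increments.

(** * The limit p -> +oo *)

Section assembly.
Context {R : realType} {n : nat}.
Local Notation S := (@sphere R n).

(** Dominated convergence concerns sequences all of whose terms obey the bounds, which hold only for
    large p. Dropping finitely many terms of a sequence tending to +oo bridges the gap. *)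
Lemma cvg_of_shifted_sequences (g : R -> \bar R) (l : \bar R) (P : R -> Prop) :
  (\forall p \near +oo%R, P p) ->
  (forall v : nat -> R, (forall k, P (v k)) -> v k @[k --> \oo] --> +oo%R ->
    g (v k) @[k --> \oo] --> l) ->
  g p @[p --> +oo%R] --> l.
Proof.
move=> nP H; apply/cvge_pinftyP => v vy.
have [K _ hK] : \forall k \near \oo, P (v k) by exact: (vy _ nP).
rewrite -(cvg_shiftn K); apply: (H (fun k => v (k + K)%N)).
  by move=> k; apply: hK => /=; rewrite leq_addl.
by rewrite (cvg_shiftn K v).
Qed.

(* The hypotheses on I mimic the relation between the p-th power I p of an L^p norm
   and the sup norm N. *)
Lemma volume_dual_mixed_volume_cvg_pinfty (K : set 'rV[R]_n) (q : R)
    (I : R -> 'rV[R]_n -> \bar R) (N : 'rV[R]_n -> R) (L_ : R -> set 'rV[R]_n)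
    (L : set 'rV[R]_n) (cf : R -> R) (s p0 C0 C1 : R) :
  (star_body K /\ n%:R < q) \/ [/\ star_body K, bounded_set K, q < n%:R & q != 0] ->
  0 < s -> 0 < p0 -> 0 < C0 -> (forall p, 0 <= cf p) ->
  cf p `^ p^-1 @[p --> +oo] --> (1 : R) ->
  (forall p, measurable_fun setT (I p)) -> (forall p x, (0 <= I p x)%E) ->
  (forall x, S x -> 0 < N x <= C1) ->
  (forall x p, S x -> p0 <= p -> (I p x <= (N x `^ (p - p0) * C0)%:E)%E) ->
  (forall x a, S x -> 0 < a < N x -> exists2 d, 0 < d &
     \forall y \near x, forall p, p0 <= p -> ((a `^ p * d)%:E <= I p y)%E) ->
  (forall x p, S x -> p0 <= p -> gauge (L_ p) x = (((cf p)%:E * I p x) `^ (p * s)^-1)%E) ->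
  (forall x, S x -> gauge L x = (N x `^ s^-1)%:E) ->
  volume (L_ p) @[p --> +oo%R] --> volume L /\
  dual_mixed_volume q K (L_ p) @[p --> +oo%R] --> dual_mixed_volume q K L.
Proof.
move=> Kq s0 p00 C00 cf0 cf1 mI I0 N0 ubI lbI L_E LE.
pose J p x := fine (I p x).
have IE x p : S x -> p0 <= p -> I p x = (J p x)%:E.
  move=> Sx pp0; rewrite fineK// ge0_fin_numE//.
  exact: le_lt_trans (ubI x p Sx pp0) (ltry _).
(* [lbI] provides a base and a mass that depend on x. Replacing both by their minimum leaves one
   parameter, and the estimate passes to smaller values of it, as [sphere_uniform] demands. *)
have [m m0 hm] : exists2 m : R, 0 < m &
    forall x, S x -> forall p, p0 <= p -> ((m `^ p * m)%:E <= I p x)%E.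
  apply: (@sphere_uniform R n (fun m x => forall p, p0 <= p -> ((m `^ p * m)%:E <= I p x)%E)).
    move=> c d x c0 cd h p pp0; apply: le_trans (h p pp0).
    have d0 : 0 < d by exact: lt_le_trans cd.
    have pge0 : 0 <= p by apply: le_trans pp0; exact: ltW.
    rewrite lee_fin; apply: ler_pM => //; [exact: powR_ge0|exact: ltW|].
    by apply: ge0_ler_powR => //; rewrite nnegrE ltW.
  move=> x Sx; have /andP[Nx0 _] := N0 x Sx.
  have aN : 0 < N x / 2 < N x by rewrite divr_gt0//= ltr_pdivrMr// ltr_pMr// ltr1n.
  have /andP[a0 _] := aN.
  have [d d0 hd] := lbI x (N x / 2) Sx aN.
  exists (Num.min (N x / 2) d); first by rewrite lt_min a0 d0.
  apply: (@filterS _ _ (nbhs_filter x) _ _ _ hd) => y hy p pp0.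
  apply: le_trans (hy p pp0).
  have pge0 : 0 <= p by apply: le_trans pp0; exact: ltW.
  have min0 : 0 <= Num.min (N x / 2) d by rewrite le_min !ltW.
  rewrite lee_fin; apply: ler_pM => //; first exact: powR_ge0.
    by apply: ge0_ler_powR => //; rewrite ?nnegrE ?(ltW a0)// ge_min lexx.
  by rewrite ge_min lexx orbT.
have [c [C [c0 hcC]]] := @root_bounds R cf s p0 C0 s0 p00 C00 cf0 cf1 m C1 m0.
pose g p x := (cf p * J p x) `^ (p * s)^-1.
have mg p : measurable_fun S (g p).
  apply: measurable_funTS; apply: (measurableT_comp (measurable_powR _)).
  by apply: measurable_funM => //; exact: measurableT_comp.
have cvg_g x : S x -> g p x @[p --> +oo%R] --> N x `^ s^-1.
  move=> Sx; have /andP[Nx0 _] := N0 x Sx.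
  apply: (@cvg_root R cf s p0 C0) => //.
    move=> p pp0; apply/andP; split; first exact: fine_ge0.
    by rewrite -lee_fin -IE// ubI.
  move=> a aN; have [d d0 hd] := lbI x a Sx aN; exists d => // p pp0.
  rewrite -lee_fin -IE//.
  by have := nbhs_singleton hd; apply.
have gL_ p x : p0 <= p -> S x -> gauge (L_ p) x = (g p x)%:E.
  by move=> pp0 Sx; rewrite L_E// IE// -EFinM poweR_EFin.
have H (v : nat -> R) : (forall k, p0 <= v k /\ forall J N : R, 0 < N <= C1 ->
    m `^ v k * m <= J -> J <= N `^ (v k - p0) * C0 ->
    c <= (cf (v k) * J) `^ (v k * s)^-1 <= C) -> v k @[k --> \oo] --> +oo%R ->
    volume (L_ (v k)) @[k --> \oo] --> volume L /\
    dual_mixed_volume q K (L_ (v k)) @[k --> \oo] --> dual_mixed_volume q K L.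
  move=> hv vy.
  apply: (@volume_dual_mixed_volume_cvg R n K q c C _ _ (fun k => g (v k)) (fun x => N x `^ s^-1)) => //.
  - move=> k x Sx; have [vp0 hk] := hv k; apply: (hk _ (N x)); first exact: N0.
      by rewrite -lee_fin -IE// hm.
    by rewrite -lee_fin -IE// ubI.
  - by move=> x Sx; exact: (cvg_comp _ _ vy (cvg_g x Sx)).
  - by move=> k x Sx; have [vp0 _] := hv k; exact: gL_.
by split; apply: (cvg_of_shifted_sequences hcC) => v hv vy; have [] := H v hv vy.
Qed.

End assembly.

(** * Polar projection bodies as p -> +oo *)

Section polar_projection.
Context {R : realType} {n : nat}.
Local Notation leb := (lebesgue_rV R n).
Local Notation S := (@sphere R n).
Variables (b : bool) (f : 'rV[R]_n -> R) (L : R).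
Let G := grad f.
Hypothesis L0 : 0 <= L.
Hypothesis intf : leb.-integrable setT (EFin \o f).
Hypothesis lf : forall x y, `|f x - f y| <= L * `|x - y|.
Hypothesis wG : bump_weak_gradient f G.
Hypothesis iG : forall i, leb.-integrable setT (EFin \o (fun x => G x 0 i)).
Hypothesis f_neq0 : exists x, f x != 0.
Implicit Types (x xi eta : 'rV[R]_n) (t p : R).

Let mG i : measurable_fun setT (fun x => G x 0 i).
Proof. by apply/measurable_EFinP; exact: measurable_int (iG i). Qed.

Let leb_setT_gt0 : (0 < leb setT)%E.
Proof.
apply: lt_le_trans (lebesgue_ball_gt0 0 (@ltr01 R)) _.
by apply: le_measure; rewrite ?inE//; exact: measurable_ball_rV.
Qed.

Definition polar_radius xi : R := fine (gauge_polar_proj_oo b f xi).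

Lemma gauge_polar_proj_ooE xi : gauge_polar_proj_oo b f xi = (polar_radius xi)%:E.
Proof.
have ub : (gauge_polar_proj_oo b f xi <= (L * `|xi|)%:E)%E.
  apply/ess_supP; apply: filterS (ae_sgpart_dotp_le b L0 intf lf wG iG xi) => x h.
  by rewrite lee_fin.
have lb : (0 <= gauge_polar_proj_oo b f xi)%E.
  apply: ess_sup_gee => //; apply: nearW => x; rewrite lee_fin; exact: sgpart_ge0.
by rewrite /polar_radius fineK// ge0_fin_numE// (le_lt_trans ub)// ltry.
Qed.

Lemma polar_radius_ge0 xi : 0 <= polar_radius xi.
Proof.
apply: fine_ge0; apply: ess_sup_gee => //.
by apply: nearW => x; rewrite lee_fin; exact: sgpart_ge0.
Qed.

Lemma polar_radius_leP xi (N : R) :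
  (polar_radius xi <= N) <-> {ae leb, forall x, sgpart b (dotp (G x) xi) <= N}.
Proof.
rewrite -lee_fin -gauge_polar_proj_ooE; split.
  by move=> /ess_supP; apply: filterS => x; rewrite lee_fin.
by move=> h; apply/ess_supP; apply: filterS h => x; rewrite lee_fin.
Qed.

Lemma polar_radius_le xi : S xi -> polar_radius xi <= L.
Proof.
move=> Sxi; apply: (@le_trans _ _ (L * `|xi|)).
  by apply/polar_radius_leP; exact: (ae_sgpart_dotp_le b L0 intf lf wG iG).
by rewrite ler_piMr//; exact: sphere_norm_le1.
Qed.

Lemma increment_le_polar_radius x t xi : 0 <= t ->
  sgpart b (f (x + t *: xi) - f x) <= t * polar_radius xi.
Proof.
move=> t0; apply: (sgpart_increment_le_of_ae intf lf wG iG) => //.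
  exact: polar_radius_ge0.
exact/polar_radius_leP.
Qed.

Lemma polar_radius_gt0 xi : xi != 0 -> 0 < polar_radius xi.
Proof.
move=> /(sgpart_increment_gt0 b intf lf f_neq0)[x [t [t0 h]]].
have := lt_le_trans h (increment_le_polar_radius x xi (ltW t0)).
by rewrite pmulr_rgt0.
Qed.

Definition polar_integral p xi : \bar R :=
  (\int[leb]_x (sgpart b (dotp (G x) xi) `^ p)%:E)%E.

Lemma polar_integral_ge0 p xi : (0 <= polar_integral p xi)%E.
Proof. by apply: integral_ge0 => x _; rewrite lee_fin powR_ge0. Qed.

Lemma measurable_polar_integral p : measurable_fun setT (polar_integral p).
Proof.
apply: (measurable_fun_fubini_tonelli_F
  (fun z : 'rV[R]_n * 'rV[R]_n => (sgpart b (dotp (G z.2) z.1) `^ p)%:E)).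
  apply/measurable_EFinP; apply: (measurableT_comp (measurable_powR p)).
  exact: measurable_sgpart_grad.
by move=> z; rewrite lee_fin powR_ge0.
Qed.

Let measurable_sgpart_dotp xi : measurable_fun setT (fun x => sgpart b (dotp (G x) xi)).
Proof.
have mx : measurable_fun setT (fun x : 'rV[R]_n => (xi, x)) by exact: measurable_fun_pair.
exact: (measurableT_comp (measurable_sgpart_grad b mG) mx).
Qed.

Let sumG x := \sum_i `|G x 0 i|.

Let integrable_sumG : leb.-integrable setT (EFin \o sumG).
Proof.
have : leb.-integrable setT (fun x => \sum_i (EFin \o (fun x => `|G x 0%R i|%R)) x)%E.
  by apply: integrable_sum => // i _; exact: integrable_abse (iG i).
by apply: eq_integrable => // x _; rewrite /= /sumG -sumEFin.
Qed.

Let sgpart_le_sumG x xi : S xi -> sgpart b (dotp (G x) xi) <= sumG x.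
Proof.
move=> Sxi; apply: le_trans (sgpart_le_norm _ _) _; apply: le_trans (ler_norm_sum _ _ _) _.
apply: ler_sum => i _; rewrite normrM ler_piMr//.
by apply: le_trans (normr_coord_le _ _) _; exact: sphere_norm_le1.
Qed.

(** [sumG] dominates |<G, xi>| for all xi on the sphere, since their coordinates are at most 1 in
    absolute value. Adding 1 makes the constant positive. *)
Definition polar_integral_bound : R := fine (\int[leb]_x (sumG x)%:E)%E + 1.

Lemma polar_integral_bound_gt0 : 0 < polar_integral_bound.
Proof.
rewrite ltr_wpDl// fine_ge0//; apply: integral_ge0 => x _; rewrite lee_fin.
by apply: sumr_ge0.
Qed.

Lemma polar_integral_le xi p : S xi -> 1 <= p ->
  (polar_integral p xi <= (polar_radius xi `^ (p - 1) * polar_integral_bound)%:E)%E.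
Proof.
move=> Sxi p1; have N0 := polar_radius_ge0 xi.
have mS : measurable_fun setT (fun x => (sumG x)%:E) by exact: measurable_int integrable_sumG.
have sG0 x : 0 <= sumG x by apply: sumr_ge0.
apply: (@le_trans _ _ (\int[leb]_x ((polar_radius xi `^ (p - 1))%:E * (sumG x)%:E))%E).
  apply: ae_ge0_le_integral => //.
  - by move=> x _; rewrite lee_fin powR_ge0.
  - by apply/measurable_EFinP; apply: (measurableT_comp (measurable_powR p)).
  - by move=> x _; rewrite -EFinM lee_fin mulr_ge0 ?powR_ge0.
  - exact: measurable_funeM.
  have /polar_radius_leP h := lexx (polar_radius xi).
  apply: filterS h => x h _; rewrite -EFinM lee_fin.
  have g0 := sgpart_ge0 b (dotp (G x) xi).
  have -> : sgpart b (dotp (G x) xi) `^ p =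
      sgpart b (dotp (G x) xi) `^ (p - 1) * sgpart b (dotp (G x) xi).
    by rewrite mulrC mulr_powRB1// (lt_le_trans ltr01).
  apply: ler_pM => //; first exact: powR_ge0.
    by apply: ge0_ler_powR; rewrite ?nnegrE// subr_ge0.
  exact: sgpart_le_sumG.
rewrite ge0_integralZl//; last 2 first.
- by move=> x _; rewrite lee_fin.
- by rewrite lee_fin powR_ge0.
rewrite EFinM; apply: lee_wpmul2l; first by rewrite lee_fin powR_ge0.
rewrite -[leLHS]fineK; last exact: (integrable_fin_num measurableT integrable_sumG).
by rewrite lee_fin lerDl.
Qed.

(** The set A where <G, xi>_+- exceeds c, midway between a and the supremum, has positive measure.
    Turning xi by less than e changes <G, xi> by at most c - a almost everywhere, so the value for
    eta still exceeds a on almost all of A: one d serves all eta near xi. *)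
Lemma polar_integral_ge xi (a : R) : 0 < a < polar_radius xi -> exists2 d, 0 < d &
  \forall eta \near xi, forall p, 1 <= p -> ((a `^ p * d)%:E <= polar_integral p eta)%E.
Proof.
move=> /andP[a0 aN].
pose c := (a + polar_radius xi) / 2.
have ac : a < c by rewrite /c; lra.
have cN : c < polar_radius xi by rewrite /c; lra.
pose A := [set x | c < sgpart b (dotp (G x) xi)].
have mA : measurable A.
  rewrite -[A]setTI; have := measurable_sgpart_dotp xi measurableT (measurable_itv `]c, +oo[).
  by congr (measurable (_ `&` _)); apply/seteqP; split => x /=; rewrite in_itv /= andbT.
have A0 : (0 < leb A)%E.
  rewrite lt0e measure_ge0 andbT; apply/negP => /eqP A0.
  have : polar_radius xi <= c.
    apply/polar_radius_leP; exists A; split => //.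
    by move=> x /= /negP; rewrite -ltNge.
  by rewrite leNgt cN.
(* Only a positive real number below [leb A] is wanted; if the measure is infinite, 1 will do. *)
have [d d0 dA] : exists2 d : R, 0 < d & (d%:E <= leb A)%E.
  case AE : (leb A) A0 => [r| |] //; first by rewrite lte_fin => r0; exists r.
  by move=> _; exists 1; rewrite ?leey.
exists d => //.
pose e := (c - a) / (L + 1).
have e0 : 0 < e by rewrite divr_gt0 ?subr_gt0// ltr_wpDl.
apply: (@filterS _ _ (nbhs_filter xi) _ _ _ (nbhsx_ballx xi e e0)) => eta.
have L1 : 0 < L + 1 by rewrite ltr_wpDl.
rewrite -ball_normE /= /e ltr_pdivlMr// => he p p1.
apply: (@le_trans _ _ (\int[leb]_x ((a `^ p)%:E * (\1_A x)%:E))%E).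
  have mI : measurable_fun setT (fun x => (\1_A x : R)%:E).
    exact/measurable_EFinP/measurable_indic.
  have I0 x : setT x -> (0 <= (\1_A x : R)%:E)%E by rewrite lee_fin.
  have ap0 : (0 <= (a `^ p)%:E)%E by rewrite lee_fin powR_ge0.
  rewrite (@ge0_integralZl _ _ R leb setT measurableT _ mI _ I0 ap0) integral_indic// setIT EFinM.
  exact: lee_wpmul2l.
apply: ae_ge0_le_integral => //.
- by move=> x _; rewrite -EFinM lee_fin mulr_ge0 ?powR_ge0.
- by apply: measurable_funeM; exact/measurable_EFinP/measurable_indic.
- by move=> x _; rewrite lee_fin powR_ge0.
- by apply/measurable_EFinP; apply: (measurableT_comp (measurable_powR p)).
(* The two signs together bound the absolute value of <G, xi - eta>. *)
have h1 := ae_sgpart_dotp_le true L0 intf lf wG iG (xi - eta).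
have h2 := ae_sgpart_dotp_le false L0 intf lf wG iG (xi - eta).
apply: (@filterS2 _ _ (ae_filter_ringOfSetsType leb) _ _ _ _ h1 h2) => x h1x h2x _.
rewrite -EFinM lee_fin indicE; have [Ax|nAx] := pselect (A x); last first.
  by rewrite memNset// mulr0 powR_ge0.
rewrite mem_set// mulr1; apply: ge0_ler_powR; rewrite ?nnegrE ?(ltW a0) ?sgpart_ge0//.
  exact: le_trans p1.
have hd : `|dotp (G x) xi - dotp (G x) eta| <= L * `|xi - eta|.
  have -> : dotp (G x) xi - dotp (G x) eta = dotp (G x) (xi - eta).
    by rewrite /dotp -sumrB; apply: eq_bigr => i _; rewrite !mxE mulrBr.
  move: h1x h2x; rewrite /sgpart !ge_max => /andP[h1x _] /andP[h2x _].
  by rewrite ler_norml; apply/andP; split; lra.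
have h3 := sgpart_lip b (dotp (G x) xi) (dotp (G x) eta).
have h4 : L * `|xi - eta| <= c - a.
  by apply: le_trans (ltW he); rewrite mulrC ler_wpM2l// lerDl.
move: Ax; rewrite /A /=; lra.
Qed.

Lemma polar_proj_cvg (K : set 'rV[R]_n) (q : R) :
  (star_body K /\ n%:R < q) \/ [/\ star_body K, bounded_set K, q < n%:R & q != 0] ->
  volume (polar_proj b p f) @[p --> +oo%R] --> volume (polar_proj_oo b f) /\
  dual_mixed_volume q K (polar_proj b p f) @[p --> +oo%R] -->
    dual_mixed_volume q K (polar_proj_oo b f).
Proof.
move=> Kq.
(* No prefactor and no further root here, so [cf] and s are 1. One factor of the integrand is kept
   for integrability, so p0 = 1. *)
apply: (@volume_dual_mixed_volume_cvg_pinfty R n K q polar_integral polar_radius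
  (fun p => polar_proj b p f) _ (fun=> 1) 1 1 polar_integral_bound (L + 1)) => //.
- exact: polar_integral_bound_gt0.
- by under eq_fun do rewrite powR1; exact: cvg_cst.
- exact: measurable_polar_integral.
- exact: polar_integral_ge0.
- move=> x Sx; rewrite polar_radius_gt0 ?sphere_neq0//=.
  by rewrite (le_trans (polar_radius_le Sx))// lerDl.
- by move=> x p Sx p1; exact: polar_integral_le.
- by move=> x a Sx; exact: polar_integral_ge.
- move=> x p Sx p1; rewrite mul1e mulr1 gauge_sublevel//.
    by move=> y l l0; apply: gauge_polar_proj_scale => //; exact: lt_le_trans p1.
  exact: poweR_ge0.
- move=> x Sx; rewrite invr1 powRr1 ?polar_radius_ge0// -gauge_polar_proj_ooE gauge_sublevel//.
    by move=> y l l0; exact: gauge_polar_proj_oo_scale.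
  by rewrite gauge_polar_proj_ooE lee_fin polar_radius_ge0.
Qed.

End polar_projection.

(** * Fractional projection bodies *)

Section fractional_radius.
Context {R : realType} {n : nat}.
Local Notation leb := (lebesgue_rV R n).
Local Notation S := (@sphere R n).
Variables (b : bool) (f : 'rV[R]_n -> R) (L B : R).
Hypothesis L0 : 0 <= L.
Hypothesis B0 : 0 <= B.
Hypothesis intf : leb.-integrable setT (EFin \o f).
Hypothesis lf : forall x y, `|f x - f y| <= L * `|x - y|.
Hypothesis fB : forall x, `|f x| <= B.
Hypothesis f_neq0 : exists x, f x != 0.
Implicit Types (x xi eta : 'rV[R]_n) (t s p : R).

Definition increment x t xi : R := sgpart b (f (x + t *: xi) - f x).

Lemma increment_ge0 x t xi : 0 <= increment x t xi.
Proof. exact: sgpart_ge0. Qed.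

Lemma increment_le_bound x t xi : increment x t xi <= 2 * B.
Proof.
apply: le_trans (sgpart_le_norm _ _) _; apply: le_trans (ler_normB _ _) _.
by rewrite mulr_natl mulr2n; apply: lerD.
Qed.

Lemma increment_le_lip x t xi : 0 <= t -> S xi -> increment x t xi <= t * L.
Proof.
move=> t0 Sxi; apply: le_trans (sgpart_increment_le_lip b lf x xi t0) _.
by rewrite ler_wpM2l// ler_piMr// sphere_norm_le1.
Qed.

(** For t <= 1 the Lipschitz bound leaves t^(1-s) L <= L; for t > 1 the factor t^(-s) is at most 1
    and the increment at most 2 B. *)
Lemma increment_le_powR x t s xi : 0 < t -> 0 <= s <= 1 -> S xi ->
  t `^ (- s) * increment x t xi <= L + 2 * B.
Proof.
move=> t0 /andP[s0 s1] Sxi; have B2 : 0 <= 2 * B by rewrite mulr_ge0.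
have tp r : 0 <= t `^ r by exact: powR_ge0.
have [t1|t1] := leP t 1.
  apply: (@le_trans _ _ L); last by rewrite lerDl.
  apply: (@le_trans _ _ (t `^ (- s) * (t * L))).
    by rewrite ler_wpM2l//; apply: increment_le_lip => //; exact: ltW.
  have -> : t `^ (- s) * (t * L) = t `^ (1 - s) * L.
    by rewrite mulrA powRD_gt0// powRr1 ?(ltW t0)// [t * _]mulrC.
  rewrite ler_piMl// -[X in _ <= X](powRr0 t); apply: ger_powR; first by rewrite t0.
  by rewrite subr_ge0.
apply: (@le_trans _ _ (2 * B)); last by rewrite lerDr.
apply: (@le_trans _ _ (t `^ (- s) * (2 * B))).
  by rewrite ler_wpM2l//; exact: increment_le_bound.
rewrite ler_piMl// -[X in _ <= X](powRr0 t); apply: ler_powR; first exact: ltW.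
by rewrite oppr_le0.
Qed.

Definition frac_sup s xi : \bar R :=
  ereal_sup [set (z.2 `^ (- s) * increment z.1 z.2 xi)%:E
            | z in [set z : 'rV[R]_n * R | (0 < z.2)%R]].

Definition frac_radius s xi : R := fine (frac_sup s xi).

Lemma frac_sup_ge0 s xi : (0 <= frac_sup s xi)%E.
Proof.
apply: (@le_trans _ _ ((1 `^ (- s) * increment 0 1 xi)%:E)).
  by rewrite lee_fin mulr_ge0 ?powR_ge0 ?increment_ge0.
by apply: ereal_sup_ubound; exists (0, 1) => /=.
Qed.

Lemma frac_supE s xi : 0 <= s <= 1 -> S xi -> frac_sup s xi = (frac_radius s xi)%:E.
Proof.
move=> s01 Sxi; rewrite fineK// ge0_fin_numE ?frac_sup_ge0//.
apply: (@le_lt_trans _ _ (L + 2 * B)%:E); last by rewrite ltry.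
apply: ge_ereal_sup => _ [[x t] /= t0 <-]; rewrite lee_fin.
exact: increment_le_powR.
Qed.

Lemma frac_radius_ge0 s xi : 0 <= frac_radius s xi.
Proof. exact/fine_ge0/frac_sup_ge0. Qed.

Lemma frac_radius_leP s xi (N : R) : 0 <= s <= 1 -> S xi ->
  (frac_radius s xi <= N) <-> (forall x t, 0 < t -> t `^ (- s) * increment x t xi <= N).
Proof.
move=> s01 Sxi; rewrite -lee_fin -frac_supE//; split=> [h x t t0|h].
  rewrite -lee_fin; apply: le_trans h; apply: ereal_sup_ubound.
  by exists (x, t).
by apply: ge_ereal_sup => _ [[x t] /= t0 <-]; rewrite lee_fin; exact: h.
Qed.

Lemma frac_radius_le s xi : 0 <= s <= 1 -> S xi -> frac_radius s xi <= L + 2 * B.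
Proof.
by move=> s01 Sxi; apply/frac_radius_leP => // x t t0; exact: increment_le_powR.
Qed.

Lemma frac_radius_ge s xi x t : 0 <= s <= 1 -> S xi -> 0 < t ->
  t `^ (- s) * increment x t xi <= frac_radius s xi.
Proof. by move=> s01 Sxi; apply: (frac_radius_leP _ s01 Sxi).1. Qed.

Lemma frac_radius_gtP s xi (a : R) : 0 <= s <= 1 -> S xi -> a < frac_radius s xi ->
  exists x t, 0 < t /\ a < t `^ (- s) * increment x t xi.
Proof.
move=> s01 Sxi aN; apply: contrapT => h.
suff : frac_radius s xi <= a by rewrite leNgt aN.
apply/frac_radius_leP => // x t t0; rewrite leNgt; apply/negP => ha.
by apply: h; exists x, t.
Qed.

Lemma increment_lip x t eta y r xi : 0 <= r ->
  increment x t eta <= increment y r xi +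
    L * (2 * `|x - y| + `|t - r| * `|eta| + r * `|eta - xi|).
Proof.
move=> r0; apply: le_trans (sgpart_lip b _ (f (y + r *: xi) - f y)) _.
rewrite lerD2l [X in `|X|](_ : _ = (f (x + t *: eta) - f (y + r *: xi)) - (f x - f y)); last by ring.
apply: le_trans (ler_normB _ _) _.
apply: (@le_trans _ _ (L * `|x + t *: eta - (y + r *: xi)| + L * `|x - y|)).
  exact: lerD.
rewrite -mulrDr ler_wpM2l//.
have -> : x + t *: eta - (y + r *: xi) = (x - y) + ((t - r) *: eta + r *: (eta - xi)).
  by rewrite scalerBl scalerBr opprD addrACA; congr (_ + _); rewrite addrA addrNK.
have h1 := ler_normD (x - y) ((t - r) *: eta + r *: (eta - xi)).
have h2 := ler_normD ((t - r) *: eta) (r *: (eta - xi)).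
by move: h1 h2; rewrite !normrZ (ger0_norm r0); lra.
Qed.

Lemma increment_near x t xi (v : R) : 0 < t -> v < increment x t xi ->
  exists2 d, 0 < d & forall y r eta, `|x - y| < d -> `|t - r| < d -> `|xi - eta| < d ->
    v < increment y r eta.
Proof.
move=> t0 vx; set g := increment x t xi - v.
have g0 : 0 < g by rewrite subr_gt0.
(* D bounds the Lipschitz factor in [increment_lip] as long as r < 2 t. The minimum with t below
   ensures 0 < r < 2 t. *)
pose D := (L + 1) * (2 + `|xi| + 2 * t).
have c0 : 0 < 2 + `|xi| + 2 * t by rewrite ltr_wpDl// ?mulr_gt0// addr_ge0.
have D0 : 0 < D by rewrite mulr_gt0// ltr_wpDl.
exists (Num.min t (g / D)); first by rewrite lt_min t0 divr_gt0.
move=> y r eta; rewrite !lt_min => /andP[_ h1] /andP[h2' h2] /andP[_ h3].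
move: h2'; rewrite ltr_norml => /andP[r2 r1].
have r0 : 0 < r by lra.
have H := increment_lip x t xi y eta (ltW r0).
have hr : r * `|xi - eta| <= 2 * t * (g / D).
  by apply: ler_pM; [exact: ltW|exact: normr_ge0|lra|exact: ltW].
have hx : `|t - r| * `|xi| <= g / D * `|xi| by rewrite ler_wpM2r// ltW.
have hL : L * (2 * `|x - y| + `|t - r| * `|xi| + r * `|xi - eta|) <=
    L * ((2 + `|xi| + 2 * t) * (g / D)).
  rewrite ler_wpM2l//; lra.
have hg : (L + 1) * ((2 + `|xi| + 2 * t) * (g / D)) = g.
  by rewrite mulrA -/D mulrC divfK// gt_eqF.
have hp : 0 < (2 + `|xi| + 2 * t) * (g / D).
  by rewrite mulr_gt0 ?divr_gt0.
set c := _ * (g / D) in hL hg hp.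
have hg' : L * c + c = g by rewrite -hg mulrDl mul1r.
have := le_trans H (lerD (lexx _) hL); rewrite /g in hg'; lra.
Qed.

Lemma increment_gt0_near xi : S xi -> exists2 d, 0 < d & \forall eta \near xi,
  forall s, 0 <= s <= 1 -> S eta -> d <= frac_radius s eta.
Proof.
move=> Sxi; have [x [t [t0 h]]] := sgpart_increment_gt0 b intf lf f_neq0 (sphere_neq0 Sxi).
have hv : increment x t xi / 2 < increment x t xi.
  by rewrite ltr_pdivrMr// ltr_pMr// ltr1n.
have [d d0 hd] := increment_near t0 hv.
(* min (1, 1 / t) is a lower bound of t^(-s) for all s in [0, 1] at once, so one increment serves
   all orders. *)
pose e := Num.min 1 t^-1 * (increment x t xi / 2).
have m0 : 0 < Num.min 1 t^-1 by rewrite lt_min ltr01 invr_gt0.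
exists e; first by rewrite mulr_gt0// divr_gt0.
apply: (@filterS _ _ (nbhs_filter xi) _ _ _ (nbhsx_ballx xi d d0)) => eta.
rewrite -ball_normE /= => he s /andP[s0 s1] Seta.
apply: (@le_trans _ _ (t `^ (- s) * increment x t eta)); last first.
  by apply: frac_radius_ge => //; rewrite s0.
apply: ler_pM.
- exact: ltW.
- by rewrite divr_ge0// increment_ge0.
- have [t1|t1] := leP t 1.
    apply: (@le_trans _ _ 1); first by rewrite ge_min lexx.
    by rewrite -[X in X <= _](powRr0 t); apply: ger_powR; rewrite ?t0 ?oppr_le0.
  apply: (@le_trans _ _ t^-1); first by rewrite ge_min lexx orbT.
  by rewrite -powR_inv1 ?(ltW t0)//; apply: ler_powR; [exact: ltW|rewrite lerN2].
- by apply/ltW; apply: hd => //; rewrite ?subrr ?normr0.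
Qed.

Lemma frac_radius_lower_bound : exists2 c, 0 < c &
  forall xi, S xi -> forall s, 0 <= s <= 1 -> c <= frac_radius s xi.
Proof.
have [c c0 hc] := @sphere_uniform R n (fun c eta => forall s, 0 <= s <= 1 -> S eta ->
   c <= frac_radius s eta) (fun c d x _ cd h s s01 Sx => le_trans cd (h s s01 Sx))
   increment_gt0_near.
by exists c => // xi Sxi s s01; exact: hc.
Qed.

(** A supremum of functions continuous in xi: its superlevel sets are relatively open in the
    sphere. *)
Lemma measurable_frac_radius s : 0 <= s <= 1 -> measurable_fun S (frac_radius s).
Proof.
move=> s01; apply: (measurability _ (RGenOInfty.measurableE R)) => _ [_ [a ->] <-].
pose U := [set xi | exists x t, 0 < t /\ a < t `^ (- s) * increment x t xi].
have oU : open U.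
  rewrite openE => xi [x [t [t0 ha]]]; rewrite /interior.
  have ts : 0 < t `^ (- s) by exact: powR_gt0.
  have hv : a / t `^ (- s) < increment x t xi by rewrite ltr_pdivrMr// mulrC.
  have [d d0 hd] := increment_near t0 hv.
  apply: (@filterS _ _ (nbhs_filter xi) _ _ _ (nbhsx_ballx xi d d0)) => eta.
  rewrite -ball_normE /= => he; exists x, t; split => //.
  by rewrite mulrC -ltr_pdivrMr//; apply: hd => //; rewrite subrr normr0.
rewrite (_ : _ `&` _ = S `&` U); first by apply: measurableI; [exact: measurable_sphere|exact: open_measurable_rV].
apply/seteqP; split => xi [Sxi /=]; rewrite in_itv /= andbT.
  by move=> h; split => //; exact: frac_radius_gtP.
move=> [x [t [t0 h]]]; split => //=.
by apply: lt_le_trans h _; exact: frac_radius_ge.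
Qed.

End fractional_radius.

(** * Fractional polar projection bodies as p -> +oo *)

Section fractional_projection.
Context {R : realType} {n : nat}.
Local Notation leb := (lebesgue_rV R n).
Local Notation S := (@sphere R n).
Variables (b : bool) (f : 'rV[R]_n -> R) (L B : R).
Hypothesis L0 : 0 <= L.
Hypothesis B0 : 0 <= B.
Hypothesis intf : leb.-integrable setT (EFin \o f).
Hypothesis lf : forall x y, `|f x - f y| <= L * `|x - y|.
Hypothesis fB : forall x, `|f x| <= B.
Hypothesis f_neq0 : exists x, f x != 0.
Variable s : R.
Hypothesis s01 : 0 < s < 1.
Implicit Types (x xi eta : 'rV[R]_n) (t p : R).

Let s0 : 0 < s. Proof. by have /andP[] := s01. Qed.
Let s1 : s < 1. Proof. by have /andP[] := s01. Qed.
Let s01' : 0 <= s <= 1. Proof. by rewrite !ltW. Qed.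
Let mf : measurable_fun setT f.
Proof. by apply/measurable_EFinP; exact: measurable_int intf. Qed.

Local Notation J := (increment_integral b f).
Local Notation W p := (weighted_increment_integral b f (- (p * s) - 1) p).
Local Notation N := (frac_radius b f s).

Let half : set (measurableTypeR R) := [set` `]0%R, +oo[%R].

Let mhalf : measurable half. Proof. exact: measurable_itv. Qed.

Let halfP t : half t -> 0 < t.
Proof. by rewrite /half /= in_itv /= andbT. Qed.

Let mincr xi t : measurable_fun setT (fun x => increment b f x t xi).
Proof.
apply: (measurableT_comp (measurable_sgpart b)); apply: measurable_funB => //.
exact: (measurableT_comp mf (measurable_shift_rV _)).
Qed.

Let mincrp p xi t : measurable_fun setT (fun x => (increment b f x t xi `^ p)%:E).
Proof. by apply/measurable_EFinP; exact: (measurableT_comp (measurable_powR p)). Qed.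

Let mJ p xi : measurable_fun half (J p xi : measurableTypeR R -> \bar R).
Proof.
apply: measurable_funTS.
have mt : measurable_fun setT (fun t : measurableTypeR R => (xi, t)) by exact: measurable_fun_pair.
exact: (measurableT_comp (measurable_increment_integral b mf p) mt).
Qed.

Let mint r p xi : measurable_fun half ((fun t : R => (t `^ r)%:E * J p xi t)%E : measurableTypeR R -> \bar R).
Proof.
apply: emeasurable_funM; last exact: mJ.
by apply/measurable_EFinP; apply: measurable_funTS; exact: measurable_powR.
Qed.

Let int0 r p xi t : (0 <= (t `^ r)%:E * J p xi t)%E.
Proof. by rewrite mule_ge0// ?increment_integral_ge0// lee_fin powR_ge0. Qed.

(* For the exponent p0, the bound increment <= min (t L) (2 B) makes the weighted
   integrand bounded near t = 0 and O(t ^ -2) near t = +oo. *)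
Definition frac_p0 : R := 2 / (1 - s) + s^-1.

Lemma frac_p0_ge1 : 1 <= frac_p0.
Proof.
have h : 1 <= s^-1 by rewrite invf_ge1 ?ltW.
by apply: le_trans h _; rewrite lerDr divr_ge0// subr_ge0 ltW.
Qed.

Let p0 := frac_p0.

Let p0_gt0 : 0 < p0. Proof. exact: lt_le_trans ltr01 frac_p0_ge1. Qed.

(** At infinity, t^(- p0 s - 1) <= t^(-2) amounts to p0 s >= 1. At 0, the Lipschitz bound
    contributes t^(p0 - 1), and the total exponent p0 (1 - s) - 2 has to be nonnegative. The two
    summands of p0 secure one condition each. *)
Let p0s : 1 <= p0 * s.
Proof.
rewrite mulrDl mulVf ?gt_eqF// lerDr mulr_ge0 ?(ltW s0)//.
by rewrite divr_ge0// subr_ge0 ltW.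
Qed.

Let p0s1 : 2 <= p0 * (1 - s).
Proof.
rewrite mulrDl divfK; last by rewrite gt_eqF// subr_gt0.
by rewrite lerDl mulr_ge0 ?invr_ge0 ?subr_ge0 ?(ltW s0) ?(ltW s1).
Qed.

Let powR_mul_incr p x t xi : p0 <= p -> 0 < t -> S xi ->
  increment b f x t xi `^ p <=
  (t `^ s * N xi) `^ (p - p0) * increment b f x t xi `^ p0.
Proof.
move=> pp0 t0 Sxi; have g0 := increment_ge0 b f x t xi.
have [/eqP ->|gn0] := boolP (increment b f x t xi == 0).
  by rewrite !powR0 ?mulr0// gt_eqF// (lt_le_trans p0_gt0).
have ggt0 : 0 < increment b f x t xi by rewrite lt_neqAle eq_sym gn0.
have -> : increment b f x t xi `^ p =
    increment b f x t xi `^ (p - p0) * increment b f x t xi `^ p0.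
  by rewrite -powRD_gt0// subrK.
rewrite ler_wpM2r ?powR_ge0//.
have tN : increment b f x t xi <= t `^ s * N xi.
  have := @frac_radius_ge _ _ b f L B L0 B0 lf fB s xi x t s01' Sxi t0.
  by rewrite powRN mulrC ler_pdivrMr ?powR_gt0// mulrC.
apply: ge0_ler_powR; rewrite ?nnegrE ?subr_ge0//.
exact: le_trans tN.
Qed.

(** Each of the p - p0 factors split off is at most t^s N. Their powers of t turn the weight t^(- p
    s - 1) into t^(- p0 s - 1), which leaves the same integral with exponent p0. *)
Lemma weighted_increment_integral_le_radius p xi : p0 <= p -> S xi ->
  (W p xi <= (N xi `^ (p - p0))%:E * W p0 xi)%E.
Proof.
move=> pp0 Sxi; have N0 : 0 <= N xi by exact: frac_radius_ge0.
have le_trans_eq (y z x : \bar R) : y = z -> (x <= y -> x <= z)%E by move=> <-.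
have c0 : (0 <= (N xi `^ (p - p0))%:E)%E by rewrite lee_fin powR_ge0.
have Z : (\int[@lebesgue_measure R]_(t in half) ((N xi `^ (p - p0))%:E *
    ((t `^ (- (p0 * s) - 1))%:E * J p0 xi t)) = (N xi `^ (p - p0))%:E * W p0 xi)%E
  := @ge0_integralZl _ (measurableTypeR R) R (@lebesgue_measure R) half mhalf _
  (mint (- (p0 * s) - 1) p0 xi) _ (fun t _ => int0 _ _ _ t) c0.
apply: (le_trans_eq _ _ _ Z).
apply: (@ge0_le_integral _ (measurableTypeR R) R (@lebesgue_measure R) half mhalf).
- by move=> t _; exact: int0.
- exact: mint.
- by apply: measurable_funeM; exact: mint.
move=> t /halfP t0.
have d0 : (0 <= ((t `^ s * N xi) `^ (p - p0))%:E)%E by rewrite lee_fin powR_ge0.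
have hJ : (J p xi t <= ((t `^ s * N xi) `^ (p - p0))%:E * J p0 xi t)%E.
  have Z' := @ge0_integralZl _ _ R leb setT measurableT _ (mincrp p0 xi t) _
    (fun x _ => powR_ge0 _ _ : (0 <= (increment b f x t xi `^ p0)%:E)%E) d0.
  apply: (le_trans_eq _ _ _ Z').
  apply: ge0_le_integral => //.
  - by move=> x _; rewrite lee_fin powR_ge0.
  - exact: mincrp.
  - by apply: measurable_funeM; exact: mincrp.
  - by move=> x _; rewrite -EFinM lee_fin; exact: powR_mul_incr.
apply: le_trans (lee_wpmul2l _ hJ) _; first by rewrite lee_fin powR_ge0.
have alg (a1 c1 a2 c2 : R) (I : \bar R) : (0 <= I)%E -> a1 * c1 = a2 * c2 ->
    (a1%:E * (c1%:E * I) <= a2%:E * (c2%:E * I))%E.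
  by move=> I0 h; rewrite !muleA -!EFinM h.
apply: alg; first exact: increment_integral_ge0.
rewrite powRM ?powR_ge0// -powRrM mulrA -powRD_gt0// mulrC; congr (_ * t `^ _).
by ring.
Qed.

Let U : \bar R := (\int[leb]_x `|(f x)%:E|)%E.

Let UE : U = (fine U)%:E.
Proof. by rewrite fineK//; exact: integrable_fin_num (integrable_abse intf). Qed.

Let U0 : 0 <= fine U.
Proof. by apply: fine_ge0; exact: integral_ge0. Qed.

Let integral_increment_le t xi : (\int[leb]_x (increment b f x t xi)%:E <= (2 * fine U)%:E)%E.
Proof.
have mn : measurable_fun setT (fun x => `|(f x)%:E|%E).
  by apply: measurableT_comp => //; exact/measurable_EFinP.
have mns : measurable_fun setT (fun x => `|(f (x + t *: xi))%:E|%E).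
  exact: (measurableT_comp mn (measurable_shift_rV _)).
apply: (@le_trans _ _ (\int[leb]_x (`|(f (x + t *: xi)%R)%:E| + `|(f x)%:E|))%E).
  apply: ge0_le_integral => //.
  - by move=> x _; rewrite lee_fin increment_ge0.
  - by apply/measurable_EFinP.
  - exact: emeasurable_funD.
  - move=> x _; rewrite -EFinD lee_fin; apply: le_trans (sgpart_le_norm _ _) _.
    exact: ler_normB.
rewrite ge0_integralD// (ge0_integral_translation (t *: xi) mn)//.
by rewrite -/U UE -EFinD lee_fin mulr_natl mulr2n.
Qed.

(** All but one of the factors are bounded by c; the remaining one integrates to at most twice the
    L^1 norm of f, by translation invariance. *)
Let increment_integral_le p0' t xi c : 1 <= p0' -> (forall x, increment b f x t xi <= c) ->
  (J p0' xi t <= (c `^ (p0' - 1) * (2 * fine U))%:E)%E.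
Proof.
move=> p1 hc; have c0 : 0 <= c by apply: le_trans (hc 0); exact: increment_ge0.
have d0 : (0 <= (c `^ (p0' - 1))%:E)%E by rewrite lee_fin powR_ge0.
have mi : measurable_fun setT (fun x => (increment b f x t xi)%:E) by exact/measurable_EFinP.
rewrite EFinM; apply: le_trans (lee_wpmul2l d0 (integral_increment_le t xi)).
have i0 x : setT x -> (0 <= (increment b f x t xi)%:E)%E by rewrite lee_fin increment_ge0.
rewrite -(@ge0_integralZl _ _ R leb setT measurableT _ mi _ i0 d0).
apply: ge0_le_integral => //.
- by move=> x _; rewrite lee_fin powR_ge0.
- exact: mincrp.
- exact: measurable_funeM.
move=> x _; rewrite -EFinM lee_fin.
rewrite -[leLHS]/(increment b f x t xi `^ p0') -mulr_powRB1 ?increment_ge0//; last first.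
  exact: lt_le_trans p1.
rewrite mulrC ler_wpM2r ?increment_ge0//.
by apply: ge0_ler_powR; rewrite ?nnegrE ?subr_ge0 ?increment_ge0.
Qed.

Let D : R := (L `^ (p0 - 1) + (2 * B) `^ (p0 - 1)) * (2 * fine U).

Let D0 : 0 <= D.
Proof. by rewrite mulr_ge0 ?addr_ge0 ?powR_ge0// mulr_ge0. Qed.

(** The bound D for t <= 1 and D t^(-2) for t > 1 are merged into one majorant 2 D / (1 + t^2),
    whose integral is known. *)
Let weighted_le t xi : 0 < t -> S xi ->
  ((t `^ (- (p0 * s) - 1))%:E * J p0 xi t <= (2 * D)%:E * ((oneDsqr t)^-1)%:E)%E.
Proof.
move=> t0 Sxi; have U20 : 0 <= 2 * fine U by rewrite mulr_ge0.
have p1 := frac_p0_ge1.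
have o0 : 0 < oneDsqr t by exact: lt_le_trans (oneDsqr_ge1 t).
have t20 : 0 < t ^+ 2 by rewrite exprn_gt0.
have tr0 : (0 <= (t `^ (- (p0 * s) - 1))%:E)%E by rewrite lee_fin powR_ge0.
have [t1|t1] := leP t 1.
  have hJ := increment_integral_le (p0' := p0) (t := t) (xi := xi) p1
    (fun x => increment_le_lip b L0 lf x (ltW t0) Sxi).
  apply: le_trans (lee_wpmul2l tr0 hJ) _; rewrite -!EFinM lee_fin.
  apply: (@le_trans _ _ D).
    rewrite /D [leLHS]mulrA; apply: ler_wpM2r => //.
    apply: (@le_trans _ _ (L `^ (p0 - 1))); last by rewrite lerDl powR_ge0.
    rewrite powRM ?(ltW t0)// mulrA -powRD_gt0// ler_piMl ?powR_ge0//.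
    rewrite -[X in _ <= X](powRr0 t); apply: ger_powR; first by rewrite t0.
    by have := p0s1; rewrite mulrBr mulr1; lra.
  rewrite -mulrA mulrCA ler_peMr// ler_pdivlMr// mul1r /oneDsqr.
  have : t ^+ 2 <= 1 by rewrite expr_le1// ltW.
  lra.
have hJ := increment_integral_le (p0' := p0) (t := t) (xi := xi) p1
  (fun x => increment_le_bound b fB x t xi).
apply: le_trans (lee_wpmul2l tr0 hJ) _; rewrite -!EFinM lee_fin.
apply: (@le_trans _ _ ((t ^+ 2)^-1 * D)).
  rewrite /D [leLHS]mulrA [leRHS]mulrA; apply: ler_wpM2r => //; apply: ler_pM; rewrite ?powR_ge0//.
    rewrite -powR_invn ?(ltW t0)//; apply: ler_powR; first exact: ltW.
    by have := p0s; lra.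
  by rewrite lerDr powR_ge0.
rewrite [2 * D]mulrC -mulrA [leLHS]mulrC ler_wpM2l// ler_pdivlMr// mulrC ler_pdivrMr//.
rewrite /oneDsqr; have : 1 <= t ^+ 2 by rewrite expr_ge1// ltW.
lra.
Qed.

(** pi / 2 is the integral of 1 / (1 + t^2) over the half-line; the summand 1 makes the constant
    positive. *)
Definition frac_bound : R := 2 * D * (pi / 2) + 1.

Lemma frac_bound_gt0 : 0 < frac_bound.
Proof. by rewrite ltr_wpDl// mulr_ge0 ?divr_ge0 ?pi_ge0// mulr_ge0. Qed.

Lemma weighted_increment_integral_le_bound xi : S xi -> (W p0 xi <= frac_bound%:E)%E.
Proof.
move=> Sxi.
pose half0 : set (measurableTypeR R) := [set` `[0%R, +oo[%R].
have mhalf0 : measurable half0 by exact: measurable_itv.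
have mo : measurable_fun setT ((fun t : R => ((oneDsqr t)^-1)%:E) : measurableTypeR R -> \bar R).
  by apply/measurable_EFinP; apply: continuous_measurable_fun; exact: continuous_oneDsqrV.
have o0 t : (0 <= ((oneDsqr t)^-1)%:E :> \bar R)%E.
  by rewrite lee_fin invr_ge0 (le_trans ler01)// oneDsqr_ge1.
have d0 : (0 <= (2 * D)%:E)%E by rewrite lee_fin mulr_ge0.
have Z : (\int[@lebesgue_measure R]_(t in half0) ((2 * D)%:E * ((oneDsqr t)^-1)%:E) =
    (2 * D * (pi / 2))%:E)%E.
  rewrite [RHS]EFinM -(integral0y_oneDsqr R).
  exact: (@ge0_integralZl _ (measurableTypeR R) R (@lebesgue_measure R) half0 mhalf0 _
    (measurable_funTS mo) _ (fun t _ => o0 t) d0).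
apply: (@le_trans _ _ (2 * D * (pi / 2))%:E); last by rewrite lee_fin lerDl.
rewrite -Z.
apply: (@le_trans _ _ (\int[@lebesgue_measure R]_(t in half) ((2 * D)%:E * ((oneDsqr t)^-1)%:E))%E).
  apply: (@ge0_le_integral _ (measurableTypeR R) R (@lebesgue_measure R) half mhalf).
  - by move=> t _; exact: int0.
  - exact: mint.
  - by apply: measurable_funTS; exact: measurable_funeM.
  - by move=> t /halfP t0; exact: weighted_le.
apply: (@ge0_subset_integral _ (measurableTypeR R) R (@lebesgue_measure R) half half0 mhalf mhalf0).
- by apply: measurable_funTS; exact: measurable_funeM.
- by move=> t _; rewrite mule_ge0.
- by move=> t; rewrite /half /half0 /= !in_itv /= !andbT => /ltW.
Qed.

(** Some increment at (x, t) exceeds a t^s, and increments near it, also in directions eta near xi,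
    still exceed a r^s. Integrating over the ball around x bounds the inner integral from below by
    beta times the p-th power of a r^s. Against the weight, only r^(-1) > 1 / (2 t) remains of the
    powers of r; integrating over an interval of length 2 h gives the constant, free of p. *)
Lemma weighted_increment_integral_ge xi (a : R) : S xi -> 0 < a < N xi ->
  exists2 d, 0 < d & \forall eta \near xi, forall p, p0 <= p -> ((a `^ p * d)%:E <= W p eta)%E.
Proof.
move=> Sxi /andP[a0 aN].
have [x [t [t0 hax]]] := frac_radius_gtP L0 B0 lf fB s01' Sxi aN.
have hv : a * t `^ s < increment b f x t xi.
  by move: hax; rewrite powRN mulrC ltr_pdivlMr// powR_gt0.
(* A level strictly between the two sides, so that the increment and a r^s can be perturbed
   independently. *)
pose v := (a * t `^ s + increment b f x t xi) / 2.
have [d d0 hd] : exists2 d, 0 < d & forall y r eta, `|x - y| < d -> `|t - r| < d ->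
    `|xi - eta| < d -> v < increment b f y r eta.
  by apply: (increment_near L0 lf t0); rewrite /v; lra.
have [e e0 he] : exists2 e, 0 < e & forall r, `|t - r| < e -> a * r `^ s < v.
  have c : {for t, continuous (fun r : R => a * r `^ s)}.
    by apply: continuousM; [exact: cst_continuous|exact: continuous_powR].
  have : \forall r \near t, a * r `^ s < v by apply: (cvgr_lt _ c); rewrite /v; lra.
  by move=> /nbhs_ballP[e /= e0 he]; exists e => // r hr; apply: he.
(* The bound t / 2 keeps r between 0 and 2 t. *)
pose h := Num.min (Num.min d e) (t / 2).
have h0 : 0 < h by rewrite !lt_min d0 e0 divr_gt0.
have beta0 : (0 < leb (ball x d))%E by exact: lebesgue_ball_gt0.
have betafin : (leb (ball x d) < +oo)%E by exact: lebesgue_ball_fin.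
have betaE : leb (ball x d) = (fine (leb (ball x d)))%:E.
  by rewrite fineK// ge0_fin_numE.
set beta := fine _ in betaE.
have beta_gt0 : 0 < beta by rewrite -lte_fin -betaE.
exists (beta / (2 * t) * (2 * h)).
  by rewrite !mulr_gt0 ?invr_gt0 ?mulr_gt0.
apply: (@filterS _ _ (nbhs_filter xi) _ _ _ (nbhsx_ballx xi d d0)) => eta.
rewrite -ball_normE /= => heta p pp0.
have p_ge0 : 0 <= p by apply: le_trans pp0; exact: ltW.
pose I : set (measurableTypeR R) := [set` `](t - h), (t + h)[%R].
have mI : measurable I by exact: measurable_itv.
have It (r : R) : I r -> [/\ 0 < r, r < 2 * t, `|t - r| < d & `|t - r| < e].
  rewrite /I /= in_itv /= => /andP[r1 r2].
  have hh : `|t - r| < h by rewrite ltr_distlC r1.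
  have := hh; rewrite !lt_min => /andP[/andP[hd' he']].
  by rewrite ltr_distlC => /andP[ht1 ht2]; split => //; lra.
have JL (r : R) : I r -> (((a * r `^ s) `^ p * beta)%:E <= J p eta r)%E.
  move=> /It[r0 r2 rd re].
  have ar0 : 0 <= a * r `^ s by rewrite mulr_ge0 ?powR_ge0 ?(ltW a0).
  rewrite EFinM -betaE -integral_cst; last exact: measurable_ball_rV.
  apply: (@le_trans _ _ (\int[leb]_(y in ball x d) (increment b f y r eta `^ p)%:E)%E).
    apply: ge0_le_integral => //.
    - exact: measurable_ball_rV.
    - by move=> y _; rewrite lee_fin powR_ge0.
    - by apply: measurable_funTS; exact: mincrp.
    - move=> y; rewrite -ball_normE /= => xy; rewrite lee_fin.
      apply: ge0_ler_powR; rewrite ?nnegrE ?increment_ge0//.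
      by apply/ltW/(lt_trans (he r re)); exact: hd.
  apply: ge0_subset_integral => //; first exact: measurable_ball_rV.
  by move=> y _; rewrite lee_fin powR_ge0.
have cst_ge0 : 0 <= a `^ p * (beta / (2 * t)).
  by rewrite mulr_ge0 ?powR_ge0// divr_ge0 ?(ltW beta_gt0)// mulr_ge0 ?(ltW t0).
apply: (@le_trans _ _ (\int[@lebesgue_measure R]_(r in I)
   (cst (a `^ p * (beta / (2 * t)))%:E r))%E).
  rewrite (@integral_cst _ (measurableTypeR R) R (@lebesgue_measure R) I mI).
  rewrite [X in (_ <= _ * X)%E](_ : _ = (2 * h)%:E); last first.
    apply: etrans (@lebesgue_measure_itv R `](t - h), (t + h)[) _.
    rewrite /= lte_fin ifT; last by lra.
    by rewrite -EFinB; congr EFin; ring.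
  by rewrite -EFinM mulrA.
apply: (@le_trans _ _ (\int[@lebesgue_measure R]_(r in I)
   ((r `^ (- (p * s) - 1))%:E * J p eta r))%E).
  apply: (@ge0_le_integral _ (measurableTypeR R) R (@lebesgue_measure R) I mI).
  - by move=> r _; rewrite lee_fin.
  - exact: measurable_cst.
  - by apply: (measurable_funS mhalf) (mint _ _ _) => r /It[r0 _ _ _]; rewrite /half /= in_itv /= andbT.
  move=> r Ir; have [r0 r2 _ _] := It r Ir.
  have rr0 : (0 <= (r `^ (- (p * s) - 1))%:E)%E by rewrite lee_fin powR_ge0.
  apply: le_trans (lee_wpmul2l rr0 (JL r Ir)); rewrite -EFinM lee_fin.
  rewrite powRM ?powR_ge0 ?(ltW a0)// -powRrM.
  have -> : r `^ (- (p * s) - 1) * (a `^ p * r `^ (s * p) * beta) =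
     a `^ p * (beta * (r `^ (- (p * s) - 1) * r `^ (s * p))) by ring.
  rewrite -powRD_gt0//.
  have -> : - (p * s) - 1 + s * p = -1 by ring.
  rewrite powR_inv1 ?(ltW r0)// ler_wpM2l ?powR_ge0// ler_wpM2l ?(ltW beta_gt0)//.
  by rewrite lef_pV2 ?posrE ?mulr_gt0// ltW.
apply: (@ge0_subset_integral _ (measurableTypeR R) R (@lebesgue_measure R) I half mI mhalf).
- exact: mint.
- by move=> r _; exact: int0.
- by move=> r /It[r0 _ _ _]; rewrite /half /= in_itv /= andbT.
Qed.

Lemma frac_polar_proj_cvg (K : set 'rV[R]_n) (q : R) :
  (star_body K /\ n%:R < q) \/ [/\ star_body K, bounded_set K, q < n%:R & q != 0] ->
  volume (frac_polar_proj b s p f) @[p --> +oo%R] --> volume (frac_polar_proj_oo b s f) /\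
  dual_mixed_volume q K (frac_polar_proj b s p f) @[p --> +oo%R] -->
    dual_mixed_volume q K (frac_polar_proj_oo b s f).
Proof.
move=> Kq.
have [c c0 hc] := frac_radius_lower_bound b L0 B0 intf lf fB f_neq0.
(* The absolute value makes [cf] nonnegative for all p; for p > 0 it is the factor p (1 - s) of the
   gauge. *)
apply: (@volume_dual_mixed_volume_cvg_pinfty R n K q (fun p => W p) N
  (fun p => frac_polar_proj b s p f) _ (fun p => `|p| * (1 - s)) s p0 frac_bound (L + 2 * B)) => //.
- exact: frac_bound_gt0.
- by move=> p; rewrite mulr_ge0// subr_ge0 ltW.
- have c1 : p `^ p^-1 * (1 - s) `^ p^-1 @[p --> +oo] --> (1 : R).
    rewrite -[X in _ --> X]mulr1; apply: cvgM; first exact: cvg_id_root_pinfty.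
    by apply: cvg_root_pinfty; rewrite subr_gt0.
  apply: cvg_trans c1; apply: near_eq_cvg; near=> p.
  have p_gt0 : 0 < p by near: p; apply: nbhs_pinfty_gt; exact: num_real.
  by rewrite gtr0_norm// powRM ?(ltW p_gt0)// subr_ge0 ltW.
- by move=> p; exact: measurable_weighted_increment_integral.
- by move=> p x; apply: integral_ge0 => t _; exact: int0.
- move=> x Sx; rewrite (lt_le_trans c0) ?hc//=.
  exact: frac_radius_le.
- move=> x p Sx pp0; apply: le_trans (weighted_increment_integral_le_radius pp0 Sx) _.
  rewrite EFinM; apply: lee_wpmul2l; first by rewrite lee_fin powR_ge0.
  exact: weighted_increment_integral_le_bound.
- by move=> x a Sx; exact: weighted_increment_integral_ge.
- move=> x p Sx pp0; have p_gt0 : 0 < p by exact: lt_le_trans pp0.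
  rewrite gtr0_norm// gauge_sublevel//.
    by move=> y l l0; exact: gauge_frac_polar_proj_scale.
  exact: poweR_ge0.
- move=> x Sx; rewrite gauge_sublevel//; last exact: gauge_frac_polar_proj_oo_ge0.
    rewrite /gauge_frac_polar_proj_oo -[X in (X `^ _)%E]/(frac_sup b f s x).
    by rewrite (@frac_supE _ _ b f L B L0 B0 lf fB s x s01' Sx) poweR_EFin.
  by move=> y l l0; exact: gauge_frac_polar_proj_oo_scale.
Unshelve. all: by end_near. Qed.

End fractional_projection.

(** * The limit s -> 1 *)

(** The substitution s = 1 - 1 / p lets the passage to sequences tending to +oo serve for s -> 1 as
    well. *)
Lemma cvg_at_left_substitution {R : realType} (T : topologicalType) (h : R -> T) (l : T) :
  h (1 - p^-1) @[p --> +oo] --> l -> h s @[s --> 1^'-] --> l.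
Proof.
move=> hl; have vy : (1 - s)^-1 @[s --> (1:R)^'-] --> +oo.
  apply/(@cvgrVy R R (1^'-) _ (fun s => 1 - s)).
    by near=> s; rewrite subr_gt0; near: s; exact: nbhs_left_lt.
  rewrite -[X in _ --> X](subrr 1); apply: cvgB; first exact: cvg_cst.
  by apply: cvg_within_filter; exact: cvg_id.
have := cvg_comp _ _ vy hl; apply: cvg_trans; apply: near_eq_cvg.
by near=> s; rewrite /= invrK opprB addrC subrK.
Unshelve. all: by end_near. Qed.

Section order_limit.
Context {R : realType} {n : nat}.
Local Notation leb := (lebesgue_rV R n).
Local Notation S := (@sphere R n).
Variables (b : bool) (f : 'rV[R]_n -> R) (L B : R).
Hypothesis L0 : 0 <= L.
Hypothesis B0 : 0 <= B.
Hypothesis intf : leb.-integrable setT (EFin \o f).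
Hypothesis lf : forall x y, `|f x - f y| <= L * `|x - y|.
Hypothesis fB : forall x, `|f x| <= B.
Hypothesis wG : bump_weak_gradient f (grad f).
Hypothesis iG : forall i, leb.-integrable setT (EFin \o (fun x => grad f x 0 i)).
Hypothesis f_neq0 : exists x, f x != 0.
Implicit Types (x xi eta : 'rV[R]_n) (t p s : R).

Local Notation N := (frac_radius b f).
Let P s xi (N : R) := @frac_radius_leP R n b f L B L0 B0 lf fB s xi N.
Let ge s xi x t := @frac_radius_ge R n b f L B L0 B0 lf fB s xi x t.

Let one01 : 0 <= (1 : R) <= 1. Proof. by rewrite ler01 lexx. Qed.

Lemma frac_radius1E xi : S xi -> N 1 xi = polar_radius b f xi.
Proof.
move=> Sxi; apply/eqP; rewrite eq_le; apply/andP; split.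
  apply/P => // x t t0; rewrite powR_inv1 ?(ltW t0)// mulrC ler_pdivrMr// mulrC.
  exact: (increment_le_polar_radius b L0 intf lf wG iG x xi (ltW t0)).
apply/(polar_radius_leP b L0 intf lf wG iG).
apply: (ae_sgpart_le_of_increment intf lf wG iG); first exact: frac_radius_ge0.
move=> x t t0; have := ge (s := 1) (xi := xi) x one01 Sxi t0.
by rewrite powR_inv1 ?(ltW t0)// mulrC ler_pdivrMr// mulrC.
Qed.

Let order p := 1 - p^-1.

Let order01 p : 2 <= p -> 0 <= order p <= 1.
Proof.
move=> p2; have p0 : 0 < p by lra.
have : p^-1 <= 1 by rewrite invf_le1//; lra.
have : 0 <= p^-1 by rewrite invr_ge0 ltW.
by rewrite /order; lra.
Qed.

Let N1_gt0 xi : S xi -> 0 < N 1 xi.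
Proof.
move=> Sxi; have [c c0 hc] := frac_radius_lower_bound b L0 B0 intf lf fB f_neq0.
exact: lt_le_trans (hc xi Sxi 1 one01).
Qed.

Let powR_order t p : 0 < t -> t `^ (- order p) = t `^ p^-1 * t `^ (- 1).
Proof. by move=> t0; rewrite -powRD_gt0// /order opprB. Qed.

(** With s = 1 - 1 / p, the weight t^(-s) is t^(1/p) t^(-1). For t <= T this costs at most the
    factor T^(1/p) against order 1. For t > T the increment is at most 2 B <= T N, and T^(-s) T =
    T^(1/p) again. *)
Let frac_radius_order_le xi T p : S xi -> 1 <= T -> 2 * B <= T * N 1 xi -> 2 <= p ->
  N (order p) xi <= T `^ p^-1 * N 1 xi.
Proof.
move=> Sxi T1 BT p2; have p0 : 0 < p by lra.
have pV0 : 0 <= p^-1 by rewrite invr_ge0 ltW.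
have T0 : 0 < T by lra.
have N0 := N1_gt0 Sxi.
apply/P => //; first exact: order01.
move=> x t t0; have [tT|Tt] := leP t T.
  rewrite powR_order// -mulrA; apply: ler_pM; rewrite ?powR_ge0//.
  - by rewrite mulr_ge0 ?powR_ge0 ?increment_ge0.
  - by apply: ge0_ler_powR; rewrite ?nnegrE ?(ltW t0) ?(ltW T0).
  - exact: ge.
apply: (@le_trans _ _ (T `^ (- order p) * (T * N 1 xi))); last first.
  by rewrite powR_order// powR_inv1 ?(ltW T0)// -mulrA mulKf// gt_eqF.
apply: ler_pM; rewrite ?powR_ge0 ?increment_ge0//.
  rewrite !powRN lef_pV2 ?posrE ?powR_gt0//.
  have /andP[h0 _] := order01 p2.
  by apply: ge0_ler_powR; rewrite ?nnegrE ?(ltW t0) ?(ltW T0)// ltW.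
exact: le_trans (increment_le_bound b fB x t xi) BT.
Qed.

Let frac_radius_order_cvg xi : S xi -> N (order p) xi @[p --> +oo] --> N 1 xi.
Proof.
move=> Sxi; have N0 := N1_gt0 Sxi.
apply/cvgrPdist_lt => e e0.
pose T := 1 + 2 * B / N 1 xi.
have T1 : 1 <= T by rewrite lerDl divr_ge0 ?mulr_ge0 ?(ltW N0).
have T0 : 0 < T by lra.
have BT : 2 * B <= T * N 1 xi by rewrite /T [leRHS]mulrDl divfK ?gt_eqF// mul1r lerDr ltW.
(* For the lower bound, an increment that is almost optimal for order 1 is kept fixed; passing to
   order 1 - 1 / p multiplies it by t^(1/p), which tends to 1. *)
have [x [t [t0 ht]]] : exists x t, 0 < t /\ N 1 xi - e < t `^ (- 1) * increment b f x t xi.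
  by apply: (frac_radius_gtP L0 B0 lf fB one01 Sxi); rewrite ltrBlDr ltrDl.
have up : T `^ p^-1 * N 1 xi @[p --> +oo] --> 1 * N 1 xi.
  by apply: cvgMl; exact: cvg_root_pinfty.
have lo : t `^ p^-1 * (t `^ (- 1) * increment b f x t xi) @[p --> +oo] -->
    1 * (t `^ (- 1) * increment b f x t xi).
  by apply: cvgMl; exact: cvg_root_pinfty.
rewrite !mul1r in up lo.
near=> p; have p2 : 2 <= p by near: p; apply: nbhs_pinfty_ge; exact: num_real.
rewrite distrC ltr_distl; apply/andP; split.
  apply: (@lt_le_trans _ _ (t `^ p^-1 * (t `^ (- 1) * increment b f x t xi))).
    by near: p; exact: (cvgr_gt _ lo).
  by rewrite mulrA -powR_order//; apply: ge => //; exact: order01.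
apply: (@le_lt_trans _ _ (T `^ p^-1 * N 1 xi)); first exact: frac_radius_order_le.
by near: p; apply: (cvgr_lt _ up); rewrite ltrDl.
Unshelve. all: by end_near. Qed.

Let invr_order_cvg : (order p)^-1 @[p --> +oo] --> (1 : R).
Proof.
rewrite -[X in _ --> X]invr1; apply: cvgV; first exact: oner_neq0.
rewrite -[X in _ --> X]subr0; apply: cvgB; first exact: cvg_cst.
apply/(@gtr0_cvgV0 R R +oo%R _ id); last exact: cvg_id.
by apply: nbhs_pinfty_gt; exact: num_real.
Qed.

(** Base and exponent move together, so the limit is taken inside exp of the exponent times ln of
    the base. The positive lower bound uniform in s gives the power this form. *)
Let root_order_cvg xi : S xi -> N (order p) xi `^ (order p)^-1 @[p --> +oo] --> N 1 xi.
Proof.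
move=> Sxi; have N0 := N1_gt0 Sxi; have Np := frac_radius_order_cvg Sxi.
have [c c0 hc] := frac_radius_lower_bound b L0 B0 intf lf fB f_neq0.
have lnN : ln (N (order p) xi) @[p --> +oo] --> ln (N 1 xi).
  exact: continuous_cvg (continuous_ln N0) Np.
have h : expR ((order p)^-1 * ln (N (order p) xi)) @[p --> +oo] --> N 1 xi.
  rewrite -[X in _ --> X]lnK ?posrE// -[X in _ --> expR X]mul1r.
  by apply: continuous_cvg; [exact: continuous_expR|exact: cvgM].
apply: cvg_trans h; apply: near_eq_cvg; near=> p.
have p2 : 2 <= p by near: p; apply: nbhs_pinfty_ge; exact: num_real.
by rewrite /powR gt_eqF// (lt_le_trans c0)// hc// order01.
Unshelve. all: by end_near. Qed.

Lemma frac_polar_proj_oo_cvg (K : set 'rV[R]_n) (q : R) :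
  (star_body K /\ n%:R < q) \/ [/\ star_body K, bounded_set K, q < n%:R & q != 0] ->
  volume (frac_polar_proj_oo b s f) @[s --> 1^'-] --> volume (polar_proj_oo b f) /\
  dual_mixed_volume q K (frac_polar_proj_oo b s f) @[s --> 1^'-] -->
    dual_mixed_volume q K (polar_proj_oo b f).
Proof.
move=> Kq.
have [c c0 hc] := frac_radius_lower_bound b L0 B0 intf lf fB f_neq0.
(* Since m <= 1 <= M, powers of numbers in [m, M] with exponents in [1, 2] lie between m^2 and M^2;
   the exponents 1 / s are in [1, 2] once p >= 2. *)
pose m := Num.min c 1; pose M := Num.max (L + 2 * B) 1.
have m0 : 0 < m by rewrite lt_min c0 ltr01.
have H (v : nat -> R) : (forall k, 2 <= v k) -> v k @[k --> \oo] --> +oo%R ->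
    volume (frac_polar_proj_oo b (order (v k)) f) @[k --> \oo] --> volume (polar_proj_oo b f) /\
    dual_mixed_volume q K (frac_polar_proj_oo b (order (v k)) f) @[k --> \oo] -->
      dual_mixed_volume q K (polar_proj_oo b f).
  move=> v2 vy; have o01 k := order01 (v2 k).
  have o12 k : 1 <= (order (v k))^-1 <= 2.
    have v0 : 0 < v k by have := v2 k; lra.
    have vV : (v k)^-1 <= 2^-1 by rewrite lef_pV2 ?posrE.
    have /andP[_ h] := o01 k.
    have h' : 2^-1 <= order (v k) by rewrite /order; lra.
    have h0 : 0 < order (v k) by lra.
    by rewrite invf_ge1// h/= -[2]invrK lef_pV2 ?posrE.
  apply: (@volume_dual_mixed_volume_cvg R n K q (m `^ 2) (M `^ 2) _ _
    (fun k x => N (order (v k)) x `^ (order (v k))^-1) (N 1)) => //.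
  - exact: powR_gt0.
  - move=> k; apply: (measurableT_comp (measurable_powR _)).
    exact: (measurable_frac_radius b L0 B0 lf fB (o01 k)).
  - move=> k x Sx; have /andP[r1 r2] := o12 k.
    have r0 : 0 <= (order (v k))^-1 by apply: le_trans r1.
    have mN : m <= N (order (v k)) x by rewrite ge_min hc.
    have NM : N (order (v k)) x <= M.
      by rewrite le_max (@frac_radius_le R n b f L B).
    apply/andP; split.
      apply: (@le_trans _ _ (m `^ (order (v k))^-1)).
        by apply: ger_powR => //; rewrite m0 ge_min lexx orbT.
      apply: ge0_ler_powR; rewrite ?nnegrE ?frac_radius_ge0 ?(ltW m0)//.
    apply: (@le_trans _ _ (M `^ (order (v k))^-1)).
      apply: ge0_ler_powR; rewrite ?nnegrE ?frac_radius_ge0//.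
      by rewrite le_max ler01 orbT.
    by apply: ler_powR => //; rewrite le_max lexx orbT.
  - by move=> x Sx; exact: (cvg_comp _ _ vy (root_order_cvg Sx)).
  - move=> k x Sx; have /andP[r1 _] := o12 k.
    have o0 : 0 < order (v k) by rewrite -invr_gt0; exact: lt_le_trans r1.
    rewrite gauge_sublevel//; last exact: gauge_frac_polar_proj_oo_ge0.
      rewrite /gauge_frac_polar_proj_oo -[X in (X `^ _)%E]/(frac_sup b f (order (v k)) x).
      by rewrite (@frac_supE _ _ b f L B L0 B0 lf fB _ x (o01 k) Sx) poweR_EFin.
    by move=> y l l0; exact: gauge_frac_polar_proj_oo_scale.
  - move=> x Sx; rewrite frac_radius1E// -(gauge_polar_proj_ooE b L0 intf lf wG iG) gauge_sublevel//.
      by move=> y l l0; exact: gauge_polar_proj_oo_scale.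
    by rewrite (gauge_polar_proj_ooE b L0 intf lf wG iG) lee_fin polar_radius_ge0.
have n2 : \forall p \near +oo%R, 2 <= p :> R.
  by apply: nbhs_pinfty_ge; exact: num_real.
by split; apply: cvg_at_left_substitution; apply: (cvg_of_shifted_sequences n2) => v v2 vy;
  have [] := H v v2 vy.
Qed.

End order_limit.

(** * Sobolev functions *)

Section sobolev_data.
Context {R : realType} {n : nat}.
Local Notation leb := (lebesgue_rV R n).
Implicit Types (f u : 'rV[R]_n -> R).

Lemma locally_integrable_measurable u : locally_integrable_rV u -> measurable_fun setT u.
Proof.
move=> lu; pose A (k : nat) : set 'rV[R]_n := [set x | `|x| <= k%:R].
have cA k : closed (A k).
  exact: (closed_comp (fun x _ => @norm_continuous _ _ x) (@closed_le R k%:R)).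
have mA k : measurable (A k).
  by rewrite -[A k]setCK; apply: measurableC; apply: open_measurable_rV; exact/closed_openC.
have -> : [set: 'rV[R]_n] = \bigcup_k A k.
  apply/seteqP; split => // x _.
  by exists (Num.truncn `|x|).+1 => //; rewrite /A /= ltW// truncnS_gt.
apply/(measurable_fun_bigcup u mA) => k; apply/measurable_EFinP.
apply: (measurable_int leb); apply: lu; apply: bounded_closed_compact => //.
exists k%:R; split; first exact: num_real.
by move=> y ky x Ax; apply: le_trans Ax _; exact: ltW.
Qed.

Lemma weak_gradient_grad f : (exists g, weak_gradient f g) -> weak_gradient f (grad f).
Proof. by move=> [g wg]; rewrite /grad; case: xgetP => [h _ //|/(_ g)]. Qed.

(** The Sobolev norm controls the length of the gradient; the measurability of each coordinate is
    taken from its local integrability. *)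
Lemma integrable_grad f : sobolev1 1%:E f ->
  forall i, leb.-integrable setT (EFin \o (fun x => grad f x 0 i)).
Proof.
move=> [_ /weak_gradient_grad[_ lG _] /Lfun1_integrable iG] i.
apply: (integrable_le _ iG) => //.
  exact: locally_integrable_measurable.
by move=> x _; exact: coord_le_enorm.
Qed.

Lemma sobolev_bump_weak_gradient f : sobolev1 1%:E f -> bump_weak_gradient f (grad f).
Proof.
move=> sf i phi bphi tphi; have iG := integrable_grad sf i.
have [/Lfun1_integrable fi /weak_gradient_grad[_ _ wG] _] := sf.
rewrite /Rintegral wG// fineN//.
Qed.

Lemma lipschitz_bound f : lipschitz f ->
  exists2 L, 0 <= L & forall x y, `|f x - f y| <= L * `|x - y|.
Proof.
(* [lipschitz] provides a threshold above which every constant works; this one lies above it and is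
   nonnegative. *)
move=> [M [_ hM]]; exists (Num.max 0 (M + 1)); first by rewrite le_max lexx.
move=> x y; apply: (hM (Num.max 0 (M + 1)) _ (x, y)) => //.
by rewrite lt_max ltrDl ltr01 orbT.
Qed.

End sobolev_data.

(* The boolean b selects the sign: true for +, false for -. *)
Theorem proposition5p3 (R : realType) (n : nat) (n_gt0 : (0 < n)%N)
    (f : 'rV[R]_n -> R)
    (f_W11 : sobolev1 1%:E f) (f_W1oo : sobolev1 +oo%E f)
    (f_lipschitz : lipschitz f) (f_neq0 : exists x, f x != 0)
    (K : set 'rV[R]_n) (q : R)
    (Kq : (star_body K /\ n%:R < q) \/
          [/\ star_body K, bounded_set K, q < n%:R & q != 0])
    (b : bool) :
  [/\ forall s : R, 0 < s < 1 ->
        volume (frac_polar_proj b s p f) @[p --> +oo] -->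
          volume (frac_polar_proj_oo b s f) /\
        dual_mixed_volume q K (frac_polar_proj b s p f) @[p --> +oo] -->
          dual_mixed_volume q K (frac_polar_proj_oo b s f),
      volume (polar_proj b p f) @[p --> +oo] --> volume (polar_proj_oo b f) /\
      dual_mixed_volume q K (polar_proj b p f) @[p --> +oo] -->
        dual_mixed_volume q K (polar_proj_oo b f) &
      volume (frac_polar_proj_oo b s f) @[s --> 1^'-] --> volume (polar_proj_oo b f) /\
      dual_mixed_volume q K (frac_polar_proj_oo b s f) @[s --> 1^'-] -->
        dual_mixed_volume q K (polar_proj_oo b f)].
Proof.
have intf : (lebesgue_rV R n).-integrable setT (EFin \o f).
  by apply/Lfun1_integrable; case: f_W11.
have [L L0 lf] := lipschitz_bound f_lipschitz.
have [B B0 fB] := bounded_lip intf lf.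
have wG := sobolev_bump_weak_gradient f_W11.
have iG := integrable_grad f_W11.
split.
- by move=> s s01; exact: (frac_polar_proj_cvg b L0 B0).
- exact: (polar_proj_cvg b L0).
- exact: (frac_polar_proj_oo_cvg b L0 B0).
Qed.
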